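(* Let $(b,o,c)$ be a magnetic Schrödinger graph over $(X,m)$ whose form $Q$ is positive and closable on $\ell^2$, and let $d$ be an intrinsic metric with finite jump size $s>0$. Assume the graph $b$ has exponential volume growth with growth rate $\nu>0$. Then, for all $\beta>3\nu/2$, with $C_\beta=s^{-2}(\cosh(\beta s)-1)$, there exists a constant $M=M_\beta>0$ such that for all $t\ge0$ $$\|S_2(t)\|_{1,1}\le M e^{(C_\beta-\lambda_2)t}.$$ In particular, the semigroup $S_2$ extends consistently to a strongly continuous semigroup on $\ell^p$ for $1\le p<\infty$ and to a weak-$*$-continuous semigroup on $\ell^\infty$.
   Context: $X$ is a discrete set, $m:X\to(0,\infty)$ (extended to a measure $m(A)=\sum_Am$), $C_c(X)$ the finitely supported complex functions on $X$, $\ell^p=\ell^p(X,m)$. A graph $b$ over $(X,m)$ is a symmetric $b:X\times X\to[0,\infty)$ with zero diagonal and $\sum_yb(x,y)<\infty$ for all $x$; a magnetic potential is $o:X\times X\to\{z\in\mathbb C:|z|=1\}$ with $o(x,y)=\overline{o(y,x)}$; an electric potential is $c:X\to\mathbb R$. The triple $(b,o,c)$ is called a magnetic Schrödinger graph over $(X,m)$. With $\nabla_of(x,y)=f(x)-o(x,y)f(y)$, its form on $C_c(X)$ is $$Q(\varphi,\psi)=\tfrac12\sum_{X\times X}b\,\nabla_o\varphi\,\overline{\nabla_o\psi}+\sum_Xc\,\varphi\overline\psi .$$ $Q$ is positive if $Q(\varphi):=Q(\varphi,\varphi)\ge0$ for all $\varphi\in C_c(X)$. $H_2$ is the positive self-adjoint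 operator on $\ell^2$ associated with the closure of $Q$, $\lambda_2=\inf\sigma(H_2)$, and $S_2(t)=e^{-tH_2}$. An intrinsic metric is a pseudo metric $d$ on $X$ with $\frac1{m(x)}\sum_yb(x,y)d(x,y)^2\le1$ for all $x$; its jump size is $s=\sup\{d(x,y):b(x,y)>0\}$. $b$ has (uniform) exponential volume growth with growth rate $\nu>0$ if there is $C\ge0$ such that $m(B_r(x))\le Ce^{\nu r}m(x)$ for all $x\in X$, $r>0$, where $B_r(x)=\{y:d(x,y)\le r\}$. $\|T\|_{p,p}$ is the operator norm on $\ell^p$ (of the extension of $T$ from $\ell^2\cap\ell^p$). Consistent extension means that the extended semigroup $S_p$ satisfies $S_p(t)=S_2(t)$ on $\ell^2\cap\ell^p$ for all $t\ge0$. *)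

(* Defs.v *)
From HB Require Import structures.
From mathcomp Require Import all_boot all_order all_algebra.
From mathcomp Require Import all_classical all_reals all_analysis.
From mathcomp Require Import complex.

Set Implicit Arguments.
Unset Strict Implicit.
Unset Printing Implicit Defensive.

Import Order.TTheory GRing.Theory Num.Theory.
Import numFieldNormedType.Exports.

Local Open Scope classical_set_scope.
Local Open Scope ring_scope.
Local Open Scope complex_scope.

(* The topology and the norm used below are those of R; the modulus of a
   complex number is taken in R. *)
Definition cabs (R : realType) (z : R[i]) : R := complex.Re `|z|.

(** * Sums over discrete sets *)

(* Absolutely convergent sums: the library's [\esum] is the supremum of the
   finite partial sums, hence only meaningful for nonnegative terms.  The value
   is irrelevant if the family is not absolutely summable. *)
Definition rsum (R : realType) (T : choiceType) (f : T -> R) : R :=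
  fine (\esum_(x in [set: T]) (Num.max (f x) 0)%:E) -
  fine (\esum_(x in [set: T]) (Num.max (- f x) 0)%:E).

Definition csum (R : realType) (T : choiceType) (f : T -> R[i]) : R[i] :=
  rsum (fun x => complex.Re (f x)) +i* rsum (fun x => complex.Im (f x)).

Definition mass (R : realType) (X : choiceType) (m : X -> R) (A : set X)
  : \bar R := \esum_(x in A) (m x)%:E.

(** * The spaces l^p(X, m) and C_c(X) *)

(* Since m > 0 everywhere, elements of l^p are honest functions.  The value 0
   is added to the supremum for p = +oo only to cover an empty X; p = -oo is
   junk. *)
Definition lpnorm (R : realType) (X : choiceType) (m : X -> R) (p : \bar R)
    (f : X -> R[i]) : \bar R :=
  match p with
  | p%:E => poweR (\esum_(x in [set: X]) (powR (cabs (f x)) p * m x)%:E) p^-1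
  | +oo%E => ereal_sup ([set 0%E] `|` [set (cabs (f x))%:E | x in [set: X]])
  | -oo%E => 0%E
  end.

Definition lp (R : realType) (X : choiceType) (m : X -> R) (p : \bar R)
    (f : X -> R[i]) : Prop := (lpnorm m p f < +oo)%E.

Definition Cc (R : realType) (X : choiceType) (f : X -> R[i]) : Prop :=
  finite_set [set x | f x != 0].

(* Inner product of l^2, and dual pairing of l^oo with l^1. *)
Definition dot (R : realType) (X : choiceType) (m : X -> R)
    (f g : X -> R[i]) : R[i] :=
  csum (fun x => f x * (g x)^* * (m x)%:C).

(** * Magnetic Schroedinger graphs *)

Record is_graph (R : realType) (X : choiceType) (b : X -> X -> R) : Prop := {
  graph_ge0 : forall x y, 0 <= b x y ;
  graph_sym : forall x y, b x y = b y x ;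
  graph_diag : forall x, b x x = 0 ;
  graph_summable : forall x, (\esum_(y in [set: X]) (b x y)%:E < +oo)%E }.

Definition is_magnetic_potential (R : realType) (X : choiceType)
    (o : X -> X -> R[i]) : Prop :=
  forall x y, `|o x y| = 1 /\ o x y = (o y x)^*.

Definition nabla (R : realType) (X : choiceType) (o : X -> X -> R[i])
    (f : X -> R[i]) (x y : X) : R[i] := f x - o x y * f y.

Definition schrodinger_form (R : realType) (X : choiceType) (b : X -> X -> R)
    (o : X -> X -> R[i]) (c : X -> R)
    (phi psi : X -> R[i]) : R[i] :=
  2^-1 * csum (fun z : X * X =>
     (b z.1 z.2)%:C * nabla o phi z.1 z.2 * (nabla o psi z.1 z.2)^*) +
  csum (fun x => (c x)%:C * phi x * (psi x)^*).

(** * Forms on C_c(X), their closure in l^2 and the associated operator *)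

(* The order of R[i] makes [0 <= z] mean that z is real and nonnegative. *)
Definition form_positive (R : realType) (X : choiceType)
    (Q : (X -> R[i]) -> (X -> R[i]) -> R[i]) : Prop :=
  forall phi, Cc phi -> 0 <= Q phi phi.

Definition form_cauchy (R : realType) (X : choiceType)
    (Q : (X -> R[i]) -> (X -> R[i]) -> R[i]) (phi : nat -> X -> R[i]) : Prop :=
  forall e : R, 0 < e -> exists N : nat, forall n k : nat,
    (N <= n)%N -> (N <= k)%N -> cabs (Q (phi n - phi k) (phi n - phi k)) < e.

Definition form_approx (R : realType) (X : choiceType) (m : X -> R)
    (Q : (X -> R[i]) -> (X -> R[i]) -> R[i])
    (phi : nat -> X -> R[i]) (f : X -> R[i]) : Prop :=
  [/\ forall n, Cc (phi n), form_cauchy Q phi &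
      (fun n => lpnorm m 2%:E (phi n - f)) @ \oo --> 0%E].

Definition form_closable (R : realType) (X : choiceType) (m : X -> R)
    (Q : (X -> R[i]) -> (X -> R[i]) -> R[i]) : Prop :=
  forall phi, form_approx m Q phi 0 ->
    (fun n => cabs (Q (phi n) (phi n))) @ \oo --> (0 : R).

Definition closure_dom (R : realType) (X : choiceType) (m : X -> R)
    (Q : (X -> R[i]) -> (X -> R[i]) -> R[i]) (f : X -> R[i]) : Prop :=
  lp m 2%:E f /\ exists phi, form_approx m Q phi f.

(* [closure_value m Q f g z] : the closure of Q takes the value z at (f, g). *)
Definition closure_value (R : realType) (X : choiceType) (m : X -> R)
    (Q : (X -> R[i]) -> (X -> R[i]) -> R[i]) (f g : X -> R[i]) (z : R[i])
    : Prop :=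
  exists phi psi, [/\ form_approx m Q phi f, form_approx m Q psi g &
    (fun n => cabs (Q (phi n) (psi n) - z)) @ \oo --> (0 : R)].

(* Unbounded operators are given by their graph: [A f h] means that f is in the
   domain of A and A f = h. *)
Definition form_operator (R : realType) (X : choiceType) (m : X -> R)
    (Q : (X -> R[i]) -> (X -> R[i]) -> R[i]) (f h : X -> R[i]) : Prop :=
  [/\ closure_dom m Q f, lp m 2%:E h &
      forall g, closure_dom m Q g -> closure_value m Q f g (dot m h g)].

(* A - z is a bijection from the domain of A onto l^2 with bounded inverse. *)
Definition resolvent_set (R : realType) (X : choiceType) (m : X -> R)
    (A : (X -> R[i]) -> (X -> R[i]) -> Prop) : set R[i] :=
  [set z | exists K : R, forall g, lp m 2%:E g ->
     exists f, [/\ A f (fun x => g x + z * f x),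
       (forall f', A f' (fun x => g x + z * f' x) -> f' = f) &
       (lpnorm m 2%:E f <= K%:E * lpnorm m 2%:E g)%E]].

Definition spectrum (R : realType) (X : choiceType) (m : X -> R)
    (A : (X -> R[i]) -> (X -> R[i]) -> Prop) : set R[i] :=
  ~` resolvent_set m A.

(* Infimum of the spectrum; meant for self-adjoint A, whose spectrum is real. *)
Definition spectrum_bottom (R : realType) (X : choiceType) (m : X -> R)
    (A : (X -> R[i]) -> (X -> R[i]) -> Prop) : R :=
  inf [set r : R | spectrum m A r%:C].

(** * Bounded operators and semigroups *)

Definition bounded_op (R : realType) (X : choiceType) (m : X -> R) (p : \bar R)
    (T : (X -> R[i]) -> X -> R[i]) : Prop :=
  (forall (a : R[i]) f g, lp m p f -> lp m p g ->
     T (fun x => a * f x + g x) = (fun x => a * T f x + T g x)) /\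
  exists2 K : R, 0 <= K &
    forall f, lp m p f -> (lpnorm m p (T f) <= K%:E * lpnorm m p f)%E.

(* The norm ||T||_{p,p} of an operator T on l^2, computed on the intersection
   of l^2 and l^p. *)
Definition opnorm (R : realType) (X : choiceType) (m : X -> R) (p : \bar R)
    (T : (X -> R[i]) -> X -> R[i]) : \bar R :=
  ereal_sup [set lpnorm m p (T f) | f in
    [set f | [/\ lp m 2%:E f, lp m p f & (lpnorm m p f <= 1)%E]]].

(* In the semigroups S below only the values S t f for t >= 0 and f in the
   relevant space are meaningful. *)
Definition semigroup (R : realType) (X : choiceType) (m : X -> R) (p : \bar R)
    (S : R -> (X -> R[i]) -> X -> R[i]) : Prop :=
  [/\ forall t, 0 <= t -> bounded_op m p (S t),
      forall f, lp m p f -> S 0 f = f &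
      forall t u f, 0 <= t -> 0 <= u -> lp m p f ->
        S (t + u) f = S t (S u f)].

Definition C0_semigroup (R : realType) (X : choiceType) (m : X -> R)
    (p : \bar R) (S : R -> (X -> R[i]) -> X -> R[i]) : Prop :=
  semigroup m p S /\
  forall f (t : R), lp m p f -> 0 <= t ->
    (fun u => lpnorm m p (S u f - S t f))
      @ within [set u : R | 0 <= u] (nbhs t) --> 0%E.

(* Weak-* continuity on l^oo, the dual of l^1, of a linear operator. *)
Definition weakstar_continuous_op (R : realType) (X : choiceType) (m : X -> R)
    (T : (X -> R[i]) -> X -> R[i]) : Prop :=
  forall g, lp m 1%:E g -> forall e : R, 0 < e ->
    exists (s : seq (X -> R[i])) (r : R),
      [/\ forall h, h \in s -> lp m 1%:E h, 0 < r &
          forall f, lp m +oo%E f ->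
            (forall h, h \in s -> cabs (dot m f h) < r) ->
            cabs (dot m (T f) g) < e].

Definition weakstar_semigroup (R : realType) (X : choiceType) (m : X -> R)
    (S : R -> (X -> R[i]) -> X -> R[i]) : Prop :=
  [/\ semigroup m +oo%E S,
      forall t, 0 <= t -> weakstar_continuous_op m (S t) &
      forall f g (t : R), lp m +oo%E f -> lp m 1%:E g -> 0 <= t ->
        (fun u => cabs (dot m (S u f) g - dot m (S t f) g))
          @ within [set u : R | 0 <= u] (nbhs t) --> (0 : R)].

(* S(t) = e^{-tA}: S is the strongly continuous semigroup on l^2 whose
   generator is -A, domains included. *)
Definition exp_semigroup (R : realType) (X : choiceType) (m : X -> R)
    (A : (X -> R[i]) -> (X -> R[i]) -> Prop)
    (S : R -> (X -> R[i]) -> X -> R[i]) : Prop :=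
  C0_semigroup m 2%:E S /\
  forall f h, A f h <->
    [/\ lp m 2%:E f, lp m 2%:E h &
        (fun t : R => lpnorm m 2%:E
           (fun x => (t^-1)%:C * (f x - S t f x) - h x)) @ 0^'+ --> 0%E].

Definition extends_consistently (R : realType) (X : choiceType) (m : X -> R)
    (p : \bar R) (S2 Sp : R -> (X -> R[i]) -> X -> R[i]) : Prop :=
  forall t f, 0 <= t -> lp m 2%:E f -> lp m p f -> Sp t f = S2 t f.

(** * Intrinsic metrics and volume growth *)

Record is_pseudo_metric (R : realType) (X : choiceType) (d : X -> X -> R)
    : Prop := {
  pmetric_ge0 : forall x y, 0 <= d x y ;
  pmetric_refl : forall x, d x x = 0 ;
  pmetric_sym : forall x y, d x y = d y x ;
  pmetric_triangle : forall x y z, d x z <= d x y + d y z }.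

Definition is_intrinsic_metric (R : realType) (X : choiceType) (m : X -> R)
    (b d : X -> X -> R) : Prop :=
  is_pseudo_metric d /\
  forall x,
    (((m x)^-1)%:E *
       (\esum_(y in [set: X]) (b x y * d x y ^+ 2)%:E) <= 1)%E.

Definition jump_size (R : realType) (X : choiceType) (b d : X -> X -> R)
    : \bar R :=
  ereal_sup [set (d z.1 z.2)%:E | z in [set z : X * X | 0 < b z.1 z.2]].

Definition dball (R : realType) (X : choiceType) (d : X -> X -> R)
    (r : R) (x : X) : set X := [set y | d x y <= r].

Definition exp_volume_growth (R : realType) (X : choiceType) (m : X -> R)
    (d : X -> X -> R) (nu : R) : Prop :=
  exists2 C : R, 0 <= C &
    forall x r, 0 < r ->
      (mass m (dball d r x) <= (C * expR (nu * r) * m x)%:E)%E.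

Definition cosh (R : realType) (x : R) : R := (expR x + expR (- x)) / 2.

(* Main.v *)
(** Uniform volume growth bounds the number of points of every ball, so balls are
    finite and, the jump size being finite, the graph is locally finite: the form
    operator acts as the formal Schroedinger operator L.  For u(t) = S2(t) 1_y,
    W = exp(- beta d(., x0)) and the finitely supported cutoff eta = max(W - eps, 0),
    the ground-state type identity
      Re <L u, eta^2 u> = Q(eta u) - 1/2 sum b(x,y) (eta x - eta y)^2 Re(u x conj(o(x,y) u y))
    together with (W x - W y)^2 <= 2 C_beta d(x,y)^2 W x W y and the intrinsic
    metric inequality gives a Gronwall estimate for |eta u(t)|^2 (Davies' method).
    As eps -> 0,
      |S2(t) 1_y (x0)| <= exp((C_beta - lambda2) t) sqrt(m y / m x0) exp(- beta d(x0,y)),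
    and for beta > 3 nu / 2 the kernel on the right has uniformly bounded row and
    weighted column sums.  Hence S2(t) f x = sum_y (S2(t) 1_y x) f y is bounded on
    every l^p, and dominated convergence yields the continuity in t. *)
Require Import Defs.
From HB Require Import structures.
From mathcomp Require Import all_boot all_order all_algebra.
From mathcomp Require Import all_classical all_reals all_analysis.
From mathcomp Require Import complex finmap ring lra.

Set Implicit Arguments.
Unset Strict Implicit.
Unset Printing Implicit Defensive.

Import Order.TTheory GRing.Theory Num.Theory.
Import numFieldNormedType.Exports.

Local Open Scope classical_set_scope.
Local Open Scope ring_scope.
Local Open Scope complex_scope.
Local Open Scope ring_scope.

(** The cutoff keeps every computation finite: since eta has finite support, the energy identity and
    the time derivative of |eta u(t)|^2 involve finitely many points, and of the operator only its
    pointwise action at these points enters. Truncation costs an error 2 eps C_beta |u(t)|^2,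
    because W^2 <= eta^2 + 2 eps; a local bound on |u(t)| controls it over [0, T], and it vanishes
    with eps. The number lambda2 enters only through lambda2 |f|^2 <= Q(f) for finitely supported f.
    This is drawn from the definition of the spectrum by a variational argument: the best constant E
    in E |f|^2 <= Q(f) cannot lie in the resolvent set, because a bounded inverse of H - E would
    improve it. The time dependence of the kernel bound is a scalar factor, so on bounded time
    intervals one multiple of a fixed kernel dominates everything. This is what dominated
    convergence in t rests on. *)

Section Modulus.
Variable R : realType.
Implicit Types (z w : R[i]) (a r : R).

Local Notation Re := complex.Re.
Local Notation Im := complex.Im.

Lemma cabsE z : cabs z = Num.sqrt (Re z ^+ 2 + Im z ^+ 2).
Proof. by rewrite /cabs normc_def. Qed.

Lemma cabs_ge0 z : 0 <= cabs z.
Proof. by rewrite cabsE sqrtr_ge0. Qed.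

Lemma cabs_sqr z : cabs z ^+ 2 = Re z ^+ 2 + Im z ^+ 2.
Proof. by rewrite cabsE sqr_sqrtr // addr_ge0 ?sqr_ge0. Qed.

Lemma normc_cabs z : `|z| = (cabs z)%:C.
Proof. by rewrite cabsE normc_def. Qed.

Lemma cabsM z w : cabs (z * w) = cabs z * cabs w.
Proof. by apply: complexI; rewrite rmorphM -!normc_cabs normrM. Qed.

Lemma cabsD z w : cabs (z + w) <= cabs z + cabs w.
Proof. by rewrite -lecR rmorphD -!normc_cabs ler_normD. Qed.

Lemma cabsN z : cabs (- z) = cabs z.
Proof. by apply: complexI; rewrite -!normc_cabs normrN. Qed.

Lemma cabs0 : cabs (0 : R[i]) = 0.
Proof. by apply: complexI; rewrite -normc_cabs normr0. Qed.

Lemma cabs1 : cabs (1 : R[i]) = 1.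
Proof. by apply: complexI; rewrite -normc_cabs normr1. Qed.

Lemma cabs_eq0 z : cabs z = 0 -> z = 0.
Proof. by move=> h; apply/eqP; rewrite -normr_eq0 normc_cabs h. Qed.

Lemma cabs_conj z : cabs (z^*) = cabs z.
Proof. by case: z => x y; rewrite !cabsE /= sqrrN. Qed.

Lemma cabsR a : cabs a%:C = `|a|.
Proof. by rewrite cabsE /= expr0n addr0 sqrtr_sqr. Qed.

Lemma ger0_cabsR a : 0 <= a -> cabs a%:C = a.
Proof. by move=> a0; rewrite cabsR ger0_norm. Qed.

Lemma Re_le_cabs z : `|Re z| <= cabs z.
Proof. by rewrite cabsE -sqrtr_sqr ler_wsqrtr // lerDl sqr_ge0. Qed.

Lemma Im_le_cabs z : `|Im z| <= cabs z.
Proof. by rewrite cabsE -sqrtr_sqr ler_wsqrtr // lerDr sqr_ge0. Qed.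

Lemma cabs_ge0_Re z : 0 <= z -> cabs z = Re z.
Proof. by move=> z0; rewrite /cabs ger0_norm. Qed.

Lemma mulc_conj z : z * z^* = (cabs z ^+ 2)%:C.
Proof. by rewrite rmorphXn /= -normc_cabs sqr_normc. Qed.

Lemma complexP z w : Re z = Re w -> Im z = Im w -> z = w.
Proof. by case: z => ? ?; case: w => ? ? /= -> ->. Qed.

Lemma ReD z w : Re (z + w) = Re z + Re w. Proof. by case: z; case: w. Qed.
Lemma ImD z w : Im (z + w) = Im z + Im w. Proof. by case: z; case: w. Qed.
Lemma ReN z : Re (- z) = - Re z. Proof. by case: z. Qed.
Lemma ImN z : Im (- z) = - Im z. Proof. by case: z. Qed.
Lemma ReB z w : Re (z - w) = Re z - Re w. Proof. by rewrite ReD ReN. Qed.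
Lemma ImB z w : Im (z - w) = Im z - Im w. Proof. by rewrite ImD ImN. Qed.
Lemma ReM z w : Re (z * w) = Re z * Re w - Im z * Im w.
Proof. by case: z; case: w. Qed.
Lemma ImM z w : Im (z * w) = Re z * Im w + Im z * Re w.
Proof. by case: z; case: w. Qed.
Lemma Re_conj z : Re (z^*) = Re z. Proof. by case: z. Qed.
Lemma Im_conj z : Im (z^*) = - Im z. Proof. by case: z. Qed.
Lemma conj_real a : (a%:C)^* = a%:C.
Proof. by apply: complexP; rewrite ?Re_conj ?Im_conj /= ?oppr0. Qed.

Lemma ReZ a z : Re (a%:C * z) = a * Re z.
Proof. by rewrite ReM /= mul0r subr0. Qed.
Lemma Re_sum (I : Type) (r : seq I) (P : pred I) (F : I -> R[i]) :
  Re (\sum_(i <- r | P i) F i) = \sum_(i <- r | P i) Re (F i).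
Proof. by elim/big_rec2: _ => // i y z _ <-; rewrite ReD. Qed.

Lemma Im_sum (I : Type) (r : seq I) (P : pred I) (F : I -> R[i]) :
  Im (\sum_(i <- r | P i) F i) = \sum_(i <- r | P i) Im (F i).
Proof. by elim/big_rec2: _ => // i y z _ <-; rewrite ImD. Qed.

End Modulus.

(** * Sums over discrete sets *)

Section NonnegSums.
Variables (R : realType) (T : choiceType).
Implicit Types (f g : T -> R) (a : T -> \bar R).

Lemma esum_fset_le f (F : {fset T}) : (forall x, 0 <= f x) ->
  ((\sum_(x <- F) f x)%:E <= \esum_(x in [set: T]) (f x)%:E)%E.
Proof.
move=> f0; apply: esum_ge; exists [set` F]; first by split => //; exact: finite_fset.
by rewrite fsbig_finite //= set_fsetK sumEFin.
Qed.

Lemma esum_le_fset f (M : \bar R) :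
  (forall F : {fset T}, ((\sum_(x <- F) f x)%:E <= M)%E) ->
  (\esum_(x in [set: T]) (f x)%:E <= M)%E.
Proof.
move=> h; apply: ub_ereal_sup => _ [A [fA _] <-].
by rewrite fsbig_finite //= sumEFin.
Qed.

Definition summ f : Prop := (\esum_(x in [set: T]) (`|f x|)%:E < +oo)%E.

Lemma summ_ub f M : (forall F : {fset T}, \sum_(x <- F) `|f x| <= M) -> summ f.
Proof.
move=> h; apply: le_lt_trans (ltry M); apply: esum_le_fset => F.
by rewrite lee_fin.
Qed.

Lemma summ_le f g : (forall x, `|f x| <= `|g x|) -> summ g -> summ f.
Proof.
move=> fg; apply: le_lt_trans; apply: le_esum => x _; by rewrite lee_fin.
Qed.

Lemma summD f g : summ f -> summ g -> summ (fun x => f x + g x).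
Proof.
move=> sf sg.
have : (\esum_(x in [set: T]) ((`|f x|)%:E + (`|g x|)%:E) < +oo)%E.
  by rewrite esumD // ?lte_add_pinfty // => x _; rewrite lee_fin.
by apply: le_lt_trans; apply: le_esum => x _; rewrite -EFinD lee_fin ler_normD.
Qed.

Lemma esumZl (k : R) f : 0 <= k -> (forall x, 0 <= f x) ->
  \esum_(x in [set: T]) (k * f x)%:E = (k%:E * \esum_(x in [set: T]) (f x)%:E)%E.
Proof.
move=> k0 f0; apply/eqP; rewrite eq_le; apply/andP; split.
  apply: esum_le_fset => F; rewrite -mulr_sumr EFinM.
  by rewrite lee_wpmul2l ?lee_fin // esum_fset_le.
have [->|kn0] := eqVneq k 0.
  rewrite mul0e; apply: esum_ge0 => x _; by rewrite mul0r.
have kp : 0 < k by rewrite lt_neqAle eq_sym kn0.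
rewrite muleC -lee_pdivlMr //; apply: esum_le_fset => F.
rewrite lee_pdivlMr // -EFinM mulrC mulr_sumr; apply: esum_fset_le => x.
by rewrite mulr_ge0.
Qed.

Lemma summZ k f : summ f -> summ (fun x => k * f x).
Proof.
move=> sf; rewrite /summ.
under eq_esum do rewrite normrM.
rewrite esumZl // lte_mul_pinfty // ?lee_fin //.
Qed.

Lemma esum_fin f : (forall x, 0 <= f x) -> summ f ->
  \esum_(x in [set: T]) (f x)%:E = (fine (\esum_(x in [set: T]) (f x)%:E))%:E.
Proof.
move=> f0 sf; rewrite fineK // ge0_fin_numE; last by apply: esum_ge0 => x _; rewrite lee_fin.
move: sf; rewrite /summ; under eq_esum do rewrite ger0_norm //; done.
Qed.

(* Equal to 0 when the sum diverges. *)
Definition nsum f : R := fine (\esum_(x in [set: T]) (f x)%:E).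

Lemma nsum_ge0 f : (forall x, 0 <= f x) -> 0 <= nsum f.
Proof. by move=> f0; apply: fine_ge0; apply: esum_ge0 => x _; rewrite lee_fin. Qed.

Lemma nsumD f g : (forall x, 0 <= f x) -> (forall x, 0 <= g x) ->
  summ f -> summ g -> nsum (fun x => f x + g x) = nsum f + nsum g.
Proof.
move=> f0 g0 sf sg; apply: EFin_inj; rewrite EFinD -!esum_fin //.
- by rewrite -esumD // => x _; rewrite lee_fin.
- by move=> x; rewrite addr_ge0.
- exact: summD.
Qed.

(** Also covers divergent families, for which both sides take the default value 0. *)
Lemma nsumZ k f : 0 <= k -> (forall x, 0 <= f x) ->
  nsum (fun x => k * f x) = k * nsum f.
Proof.
move=> k0 f0; rewrite /nsum esumZl //.
case: (\esum_(x in [set: T]) (f x)%:E)%E (@esum_ge0 R T setT (fun x => (f x)%:E) (fun x _ => f0 x)) => [r| |] // _.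
have [->|kn0] := eqVneq k 0; first by rewrite mul0e mul0r.
by rewrite gt0_muley ?mulr0 // lte_fin lt_neqAle eq_sym kn0.
Qed.

Lemma le_nsum f g : (forall x, 0 <= f x) -> (forall x, f x <= g x) -> summ g -> 
  nsum f <= nsum g.
Proof.
move=> f0 fg sg; have g0 x : 0 <= g x by apply: le_trans (fg x).
rewrite -lee_fin -!esum_fin //; first by apply: le_esum => x _; rewrite lee_fin.
by apply: summ_le sg => x; rewrite !ger0_norm.
Qed.

Lemma fset_le_nsum f (F : {fset T}) : (forall x, 0 <= f x) -> summ f ->
  \sum_(x <- F) f x <= nsum f.
Proof. by move=> f0 sf; rewrite -lee_fin -esum_fin // esum_fset_le. Qed.

Lemma point_le_nsum f x : (forall x, 0 <= f x) -> summ f -> f x <= nsum f.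
Proof.
by move=> f0 sf; have := fset_le_nsum [fset x]%fset f0 sf; rewrite big_seq_fset1.
Qed.

Lemma nsum_le_fset f M : (forall F : {fset T}, \sum_(x <- F) f x <= M) ->
  (forall x, 0 <= f x) -> nsum f <= M.
Proof.
move=> h f0; rewrite -lee_fin -esum_fin //.
  by apply: esum_le_fset => F; rewrite lee_fin.
apply: (summ_ub (M := M)) => F; under eq_bigr do rewrite ger0_norm //; done.
Qed.

Lemma nsum_split f (F : {fset T}) :
  (forall x, 0 <= f x) -> summ f ->
  nsum f = \sum_(x <- F) f x + nsum (fun x => if x \in F then 0 else f x).
Proof.
move=> f0 sf.
have s1 : summ (fun x => if x \in F then f x else 0).
  by apply: summ_le sf => x; case: ifP; rewrite ?normr0.
have s2 : summ (fun x => if x \in F then 0 else f x).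
  by apply: summ_le sf => x; case: ifP; rewrite ?normr0.
have -> : nsum f = nsum (fun x => if x \in F then f x else 0) +
                nsum (fun x => if x \in F then 0 else f x).
  rewrite -nsumD //; try by move=> x; case: ifP.
  by congr nsum; apply/funext => x; case: ifP; rewrite ?addr0 ?add0r.
congr (_ + _).
have -> : \sum_(x <- F) f x = \sum_(x <- F) (if x \in F then f x else 0).
  by rewrite big_seq [RHS]big_seq; apply: eq_bigr => x ->.
have f1 x : 0 <= (if x \in F then f x else 0) by case: ifP.
apply/eqP; rewrite eq_le fset_le_nsum // andbT.
apply: nsum_le_fset => // G.
rewrite (big_fsetID _ [in F] G) /= [X in _ + X]big1_fset ?addr0; last first.
  by move=> i; rewrite !inE /= => /andP[_ /negPf ->].
rewrite [leRHS](big_fsetID _ [in G] F) /=.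
rewrite (_ : [fset x in F | x \in G]%fset = [fset x in G | x \in F]%fset); last first.
  by apply/fsetP => x; rewrite !inE /= andbC.
by rewrite lerDl sumr_ge0.
Qed.

Lemma summ_tail f (e : R) : (forall x, 0 <= f x) -> summ f -> 0 < e ->
  exists F : {fset T}, nsum (fun x => if x \in F then 0 else f x) < e.
Proof.
move=> f0 sf e0.
have [_ [A [fA _] <-]] : exists2 y, [set \sum_(x \in A) (f x)%:E | A in fsets [set: T]]%E y &
     ((nsum f - e)%:E < y)%E.
  apply: ereal_sup_gt; rewrite -/(esum _ _) esum_fin // lte_fin ltrBlDr.
  by rewrite ltrDl.
rewrite fsbig_finite //= sumEFin lte_fin => h.
exists (fset_set A).
rewrite (nsum_split (fset_set A)) // in h.
by rewrite -(ltrD2l (\sum_(x <- fset_set A) f x)) -ltrBlDr.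
Qed.

End NonnegSums.

Section NonnegSums2.
Variables (R : realType).

Lemma nsum0 (T : choiceType) : nsum (fun _ : T => 0 : R) = 0.
Proof. by rewrite /nsum esum1. Qed.

Lemma eq_nsum (T : choiceType) (f g : T -> R) : f =1 g -> nsum f = nsum g.
Proof. by move=> /funext ->. Qed.

Lemma nsum_fsupp (T : choiceType) (f : T -> R) (F : {fset T}) :
  (forall x, 0 <= f x) -> (forall x, x \notin F -> f x = 0) ->
  summ f /\ nsum f = \sum_(x <- F) f x.
Proof.
move=> f0 fF.
have sf : summ f.
  apply: (@summ_ub _ _ _ (\sum_(x <- F) f x)) => G.
  under eq_bigr do rewrite ger0_norm //.
  rewrite (big_fsetID _ [in F] G) /= [X in _ + X]big1_fset ?addr0; last first.
    by move=> i; rewrite !inE /= => /andP[_ /fF ->].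
  rewrite [leRHS](big_fsetID _ [in G] F) /=.
  rewrite (_ : [fset x in F | x \in G]%fset = [fset x in G | x \in F]%fset); last first.
    by apply/fsetP => x; rewrite !inE /= andbC.
  by rewrite lerDl sumr_ge0.
split=> //; rewrite (nsum_split F) //.
rewrite (_ : (fun x => _) = fun=> 0) ?nsum0 ?addr0 //.
by apply/funext => x; case: ifPn => // /fF.
Qed.

Lemma cvg_sumr (U I : Type) (F : set_system U) {FF : Filter F} (r : seq I)
    (f : I -> U -> R) (l : I -> R) :
  (forall i, f i u @[u --> F] --> l i) ->
  \sum_(i <- r) f i u @[u --> F] --> \sum_(i <- r) l i.
Proof.
move=> h; elim: r => [|i r ih].
  by rewrite big_nil; under eq_cvg do rewrite big_nil; exact: cvg_cst.
rewrite big_cons; under eq_cvg do rewrite big_cons.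
exact: cvgD.
Qed.

(** Dominated convergence for sums: outside a finite set the dominating tail is below e / 2
    uniformly in u, and on that set pointwise convergence suffices. The filter is arbitrary because
    the limits in time are taken within [0, oo). *)
Lemma nsum_dct (T : choiceType) (U : Type) (F : set_system U) {FF : Filter F}
    (g : T -> R) (a : U -> T -> R) :
  (forall x, 0 <= g x) -> summ g ->
  (\forall u \near F, forall x, 0 <= a u x <= g x) ->
  (forall x, a ^~ x @ F --> (0 : R)) ->
  nsum (a u) @[u --> F] --> (0 : R).
Proof.
move=> g0 sg ag a0; apply/cvgrPdist_lt => e e0.
have e2 : 0 < e / 2 by rewrite divr_gt0.
have [G hG] := summ_tail g0 sg e2.
have : \sum_(x <- G) a u x @[u --> F] --> \sum_(x <- G) (0 : R).
  by apply: cvg_sumr => x; exact: a0.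
rewrite big1 // => /cvgrPdist_lt /(_ _ e2) h.
near=> u.
have agu : forall x, 0 <= a u x <= g x by near: u.
have a1 x : 0 <= a u x by have /andP[] := agu x.
have sa : summ (a u).
  by apply: summ_le sg => x; rewrite !ger0_norm //; have /andP[] := agu x.
rewrite sub0r normrN ger0_norm ?nsum_ge0 // (nsum_split G) //.
have : `|0 - \sum_(x <- G) a u x| < e / 2 by near: u.
rewrite sub0r normrN ger0_norm ?sumr_ge0 // => h1.
have h2 : nsum (fun x => if x \in G then 0 else a u x) <=
   nsum (fun x => if x \in G then 0 else g x).
  apply: le_nsum => [x|x|].
  - by case: ifP.
  - by case: ifP => // _; have /andP[] := agu x.
  - by apply: summ_le sg => x; case: ifP; rewrite ?normr0.
by lra.
Unshelve. all: by end_near. Qed.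

Section Product.
Variables A B : choiceType.
Implicit Type p : A * B -> R.

Let esum_prod p : (forall z, 0 <= p z) ->
  (\esum_(z in [set: A * B]) (p z)%:E =
   \esum_(x in [set: A]) \esum_(y in [set: B]) (p (x, y))%:E)%E.
Proof.
move=> p0; rewrite (esum_esum (a := fun x y => (p (x, y))%:E)) //=; last first.
  by move=> *; rewrite lee_fin.
rewrite (_ : [set: A] `*`` (fun=> [set: B]) = [set: A * B]); last by apply/seteqP; split.
by apply: eq_esum => -[].
Qed.

Lemma summ_swap (p : A * B -> R) : (forall z, 0 <= p z) ->
  summ p -> summ (fun z : B * A => p (z.2, z.1)).
Proof.
move=> p0; rewrite /summ (@reindex_esum R _ _ [set: B * A] setT (fun z => (z.2, z.1))) //.
by rewrite setTT_bijective; exists (fun z => (z.2, z.1)) => -[].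
Qed.

Lemma nsum_swap (p : A * B -> R) : nsum (fun z : B * A => p (z.2, z.1)) = nsum p.
Proof.
rewrite /nsum [in RHS](@reindex_esum R _ _ [set: B * A] setT (fun z => (z.2, z.1))) //.
by rewrite setTT_bijective; exists (fun z => (z.2, z.1)) => -[].
Qed.

Lemma summ_prod p : (forall z, 0 <= p z) ->
  (forall x, summ (fun y => p (x, y))) ->
  summ (fun x => nsum (fun y => p (x, y))) -> summ p.
Proof.
move=> p0 s1 s2; rewrite /summ; under eq_esum do rewrite ger0_norm //.
rewrite esum_prod //; under eq_esum => x _ do rewrite esum_fin //.
move: s2; rewrite /summ; under eq_esum do rewrite ger0_norm ?nsum_ge0 //; done.
Qed.

Lemma summ_slice p x : (forall z, 0 <= p z) -> summ p -> summ (fun y => p (x, y)).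
Proof.
move=> p0 sp; apply: (@summ_ub _ _ _ (nsum p)) => F.
under eq_bigr do rewrite ger0_norm //.
apply: le_trans (fset_le_nsum [fset (x, y) | y in F]%fset p0 sp).
by rewrite big_imfset //= => y z _ _ [].
Qed.

Lemma nsum_prod p : (forall z, 0 <= p z) -> summ p ->
  summ (fun x => nsum (fun y => p (x, y))) /\
  nsum p = nsum (fun x => nsum (fun y => p (x, y))).
Proof.
move=> p0 sp; have := esum_prod p0; rewrite esum_fin //.
rewrite (eq_esum (b := fun x => (nsum (fun y => p (x, y)))%:E)); last first.
  by move=> x _; rewrite esum_fin //; exact: summ_slice.
move=> e; split; last by rewrite {2}/nsum -e.
rewrite /summ; under eq_esum do rewrite ger0_norm ?nsum_ge0 //.
by rewrite -e ltry.
Qed.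

End Product.
End NonnegSums2.

(** * Signed absolutely convergent sums *)

Section SignedSums.
Variables (R : realType).

Lemma maxr0B (a : R) : Num.max a 0 - Num.max (- a) 0 = a.
Proof. by rewrite !maxEle oppr_le0; do 2 case: (lerP _ _) => ?; lra. Qed.

(** The value of a sum does not depend on how it is split into nonnegative parts. Linearity and
    Fubini for signed sums reduce to [nsum] through this freedom. *)
Lemma rsumB (T : choiceType) (p q : T -> R) :
  (forall x, 0 <= p x) -> (forall x, 0 <= q x) -> summ p -> summ q ->
  rsum (fun x => p x - q x) = nsum p - nsum q.
Proof.
move=> p0 q0 sp sq.
have spq : summ (fun x => p x - q x).
  by apply: summD => //; apply: summ_le sq => x; rewrite normrN.
have s1 : summ (fun x => Num.max (p x - q x) 0).
  apply: summ_le spq => x; rewrite ger0_norm ?le_max ?lexx ?orbT //.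
  by rewrite ge_max normr_ge0 ler_norm.
have s2 : summ (fun x => Num.max (- (p x - q x)) 0).
  apply: summ_le spq => x; rewrite ger0_norm ?le_max ?lexx ?orbT //.
  by rewrite ge_max normr_ge0 -normrN ler_norm.
rewrite /rsum -/(nsum _) -/(nsum _).
have m0 (a : R) : 0 <= Num.max a 0 by rewrite le_max lexx orbT.
(* The identity is moved to a form without subtraction, where additivity of [nsum] applies. *)
suff : nsum (fun x => Num.max (p x - q x) 0) + nsum q =
       nsum (fun x => Num.max (- (p x - q x)) 0) + nsum p by lra.
rewrite -!nsumD //; apply: eq_nsum => x.
by have := maxr0B (p x - q x); lra.
Qed.

Let pos0 (a : R) : 0 <= Num.max a 0. Proof. by rewrite le_max lexx orbT. Qed.

Let summ_pos (T : choiceType) (f : T -> R) : summ f -> summ (fun x => Num.max (f x) 0).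
Proof.
move=> sf; apply: summ_le sf => x; rewrite ger0_norm //.
by rewrite ge_max normr_ge0 ler_norm.
Qed.

Lemma summN (T : choiceType) (f : T -> R) : summ f -> summ (fun x => - f x).
Proof. by move=> sf; apply: summ_le sf => x; rewrite normrN. Qed.

Let rsumE (T : choiceType) (f : T -> R) :
  rsum f = nsum (fun x => Num.max (f x) 0) - nsum (fun x => Num.max (- f x) 0).
Proof. by []. Qed.

Lemma rsumD (T : choiceType) (f g : T -> R) : summ f -> summ g ->
  rsum (fun x => f x + g x) = rsum f + rsum g.
Proof.
move=> sf sg; rewrite [rsum f]rsumE [rsum g]rsumE.
have sf' := summN sf; have sg' := summN sg.
rewrite addrACA -opprD -!nsumD //; try exact: summ_pos.
rewrite -rsumB //; first last.
- by apply: summD; apply: summ_pos.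
- by apply: summD; apply: summ_pos.
- by move=> x; rewrite addr_ge0.
- by move=> x; rewrite addr_ge0.
by congr rsum; apply/funext => x; have := maxr0B (f x); have := maxr0B (g x); lra.
Qed.

Lemma rsumN (T : choiceType) (f : T -> R) : rsum (fun x => - f x) = - rsum f.
Proof.
rewrite !rsumE opprB; congr (_ - _); apply: eq_nsum => x; by rewrite opprK.
Qed.

Lemma rsumZ (T : choiceType) k (f : T -> R) : summ f ->
  rsum (fun x => k * f x) = k * rsum f.
Proof.
move=> sf; wlog k0 : k / 0 <= k.
  move=> h; have [|k0] := leP 0 k; first exact: h.
  have := h (- k); rewrite oppr_ge0 => /(_ (ltW k0)).
  rewrite mulNr => /(congr1 -%R); rewrite opprK -rsumN => <-.
  by congr rsum; apply/funext => x; lra.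
rewrite [rsum f]rsumE mulrBr -!nsumZ // -rsumB.
- by congr rsum; apply/funext => x; rewrite -mulrBr maxr0B.
- by move=> x; rewrite mulr_ge0.
- by move=> x; rewrite mulr_ge0.
- by apply/summZ/summ_pos.
- by apply/summZ/summ_pos/summN.
Qed.

Lemma rsum_nsum (T : choiceType) (f : T -> R) : (forall x, 0 <= f x) ->
  rsum f = nsum f.
Proof.
move=> f0; rewrite rsumE [X in _ - X](_ : _ = 0) ?subr0; last first.
  rewrite -[RHS](@nsum0 R T); apply: eq_nsum => x.
  by rewrite max_r // oppr_le0.
by apply: eq_nsum => x; rewrite max_l.
Qed.

Lemma rsum_le (T : choiceType) (f g : T -> R) : (forall x, f x <= g x) ->
  summ f -> (forall x, 0 <= g x) -> summ g -> rsum f <= nsum g.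
Proof.
move=> fg sf g0 sg; rewrite rsumE.
apply: (@le_trans _ _ (nsum (fun x => Num.max (f x) 0))).
  by rewrite lerBlDr lerDl nsum_ge0.
by apply: le_nsum => // x; rewrite ge_max fg g0.
Qed.

Lemma rsum_fubini (A B : choiceType) (f : A * B -> R) : summ f ->
  rsum (fun x => rsum (fun y => f (x, y))) = rsum (fun y => rsum (fun x => f (x, y))).
Proof.
move=> sf; pose p z := Num.max (f z) 0; pose q z := Num.max (- f z) 0.
have sp : summ p by exact: summ_pos.
have sq : summ q by exact/summ_pos/summN.
have p0 z : 0 <= p z by exact: pos0.
have q0 z : 0 <= q z by exact: pos0.
have sp' := summ_swap p0 sp; have sq' := summ_swap q0 sq.
transitivity (nsum p - nsum q).
  have [s1 ->] := nsum_prod p0 sp; have [s2 ->] := nsum_prod q0 sq.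
  by rewrite -rsumB // => x; apply: nsum_ge0.
rewrite -(nsum_swap p) -(nsum_swap q).
have [|s1 ->] := nsum_prod _ sp'; first by move=> z; exact: p0.
have [|s2 ->] := nsum_prod _ sq'; first by move=> z; exact: q0.
by rewrite -rsumB // => x; apply: nsum_ge0.
Qed.

End SignedSums.

(** * Complex absolutely convergent sums *)

Section ComplexSums.
Variables (R : realType).

Definition csumm (T : choiceType) (f : T -> R[i]) : Prop := summ (fun x => cabs (f x)).

Local Notation Re := complex.Re.
Local Notation Im := complex.Im.

Section OneIndex.
Variable T : choiceType.
Implicit Types f g : T -> R[i].

Lemma csumm_Re f : csumm f -> summ (fun x => Re (f x)).
Proof. by apply: summ_le => x; rewrite (ger0_norm (cabs_ge0 _)) Re_le_cabs. Qed.

Lemma csumm_Im f : csumm f -> summ (fun x => Im (f x)).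
Proof. by apply: summ_le => x; rewrite (ger0_norm (cabs_ge0 _)) Im_le_cabs. Qed.

Lemma csumm_le f (g : T -> R) : (forall x, cabs (f x) <= g x) -> summ g -> csumm f.
Proof.
move=> fg; apply: summ_le => x; rewrite ger0_norm ?cabs_ge0 //.
exact: le_trans (fg x) (ler_norm _).
Qed.

Lemma csummZ k f : csumm f -> csumm (fun x => k * f x).
Proof. by move=> sf; apply: csumm_le (summZ (cabs k) sf) => x; rewrite cabsM. Qed.

Lemma csumD f g : csumm f -> csumm g ->
  csum (fun x => f x + g x) = csum f + csum g.
Proof.
move=> sf sg; apply: complexP; rewrite /= ?ReD ?ImD /=.
  by rewrite -rsumD; [congr rsum; apply/funext => x; rewrite ReD | exact: csumm_Re..].
by rewrite -rsumD; [congr rsum; apply/funext => x; rewrite ImD | exact: csumm_Im..].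
Qed.

Lemma csumZ k f : csumm f -> csum (fun x => k * f x) = k * csum f.
Proof.
move=> sf; have sr := csumm_Re sf; have si := csumm_Im sf.
apply: complexP.
  rewrite ReM /= (_ : (fun x => _) = (fun x => Re k * Re (f x) + - (Im k * Im (f x)))).
    by rewrite rsumD ?rsumN ?rsumZ //; [exact: summZ | exact/summN/summZ].
  by apply/funext => x; rewrite ReM.
rewrite ImM /= (_ : (fun x => _) = (fun x => Re k * Im (f x) + Im k * Re (f x))).
  by rewrite rsumD ?rsumZ //; exact: summZ.
by apply/funext => x; rewrite ImM.
Qed.

Lemma csumB f g : csumm f -> csumm g ->
  csum (fun x => f x - g x) = csum f - csum g.
Proof.
move=> sf sg; rewrite -[- csum g]mulN1r -csumZ // -csumD //; last exact: csummZ.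
by congr csum; apply/funext => x; rewrite mulN1r.
Qed.

Lemma csum_conj f : csum (fun x => (f x)^*) = (csum f)^*.
Proof.
apply: complexP => /=; first by congr rsum; apply/funext => x; rewrite Re_conj.
by rewrite -rsumN; congr rsum; apply/funext => x; rewrite Im_conj.
Qed.

(* Rotating by the phase of the sum reduces to the real part. *)
Lemma cabs_csum f : csumm f -> cabs (csum f) <= nsum (fun x => cabs (f x)).
Proof.
move=> sf; set z := csum f.
have s0 : 0 <= nsum (fun x => cabs (f x)) by apply: nsum_ge0 => x; exact: cabs_ge0.
have [->//|zn0] := eqVneq (cabs z) 0.
have zp : 0 < cabs z by rewrite lt_neqAle eq_sym zn0 cabs_ge0.
have sz := csummZ z^* sf.
rewrite -(ler_pM2l zp) -expr2.
have -> : cabs z ^+ 2 = Re (csum (fun x => z^* * f x)).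
  by rewrite csumZ // mulrC mulc_conj.
rewrite -nsumZ => [/=||x]; [|exact: cabs_ge0|exact: cabs_ge0].
apply: rsum_le => [x|||].
- apply: le_trans (ler_norm _) _; apply: le_trans (Re_le_cabs _) _.
  by rewrite cabsM cabs_conj.
- exact: csumm_Re.
- by move=> x; rewrite mulr_ge0 ?cabs_ge0.
- exact: summZ.
Qed.

Lemma csumm_fsupp f (F : {fset T}) : (forall x, x \notin F -> f x = 0) -> csumm f.
Proof.
move=> fF; have [||s _] := @nsum_fsupp _ _ (fun x => cabs (f x)) F; last exact: s.
- by move=> x; exact: cabs_ge0.
- by move=> x /fF ->; rewrite cabs0.
Qed.

Lemma csum_nsum (f : T -> R) : (forall x, 0 <= f x) ->
  csum (fun x => (f x)%:C) = (nsum f)%:C.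
Proof.
move=> f0; apply: complexP => /=; first exact: rsum_nsum.
by rewrite rsum_nsum // nsum0.
Qed.

Lemma csum0 : csum (fun _ : T => 0 : R[i]) = 0.
Proof. by rewrite (csum_nsum (f := fun=> 0)) // nsum0. Qed.

Lemma csum_fsupp f (F : {fset T}) : (forall x, x \notin F -> f x = 0) ->
  csum f = \sum_(x <- F) f x.
Proof.
have aux (g : T -> R) : (forall x, x \notin F -> g x = 0) -> rsum g = \sum_(x <- F) g x.
  move=> gF; rewrite /rsum -/(nsum _) -/(nsum _).
  have [||_ ->] := @nsum_fsupp _ _ (fun x => Num.max (g x) 0) F.
  - by move=> x; rewrite le_max lexx orbT.
  - by move=> x /gF ->; rewrite maxxx.
  have [||_ ->] := @nsum_fsupp _ _ (fun x => Num.max (- g x) 0) F.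
  - by move=> x; rewrite le_max lexx orbT.
  - by move=> x /gF ->; rewrite oppr0 maxxx.
  by rewrite -sumrB; apply: eq_bigr => x _; rewrite maxr0B.
move=> fF; apply: complexP; rewrite ?Re_sum ?Im_sum /=; apply: aux => x /fF -> //.
Qed.

Lemma csum_tail f (F : {fset T}) : csumm f ->
  cabs (csum f - \sum_(x <- F) f x) <= nsum (fun x => if x \in F then 0 else cabs (f x)).
Proof.
move=> sf.
rewrite (_ : \sum_(x <- F) f x = csum (fun x => if x \in F then f x else 0)); last first.
  rewrite (@csum_fsupp _ F); last by move=> x /negPf ->.
  by rewrite big_seq [RHS]big_seq; apply: eq_bigr => x ->.
rewrite -csumB //; last first.
  apply: csumm_le sf => x; case: ifP => // _; by rewrite cabs0 cabs_ge0.
apply: le_trans (cabs_csum _) _.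
  apply: csumm_le sf => x; case: ifP => // _; by rewrite ?subrr ?subr0 ?cabs0 ?cabs_ge0.
rewrite le_eqVlt; apply/orP; left; apply/eqP; apply: eq_nsum => x.
by case: ifP => // _; rewrite ?subrr ?subr0 ?cabs0.
Qed.

End OneIndex.

Lemma csum_fubini (A B : choiceType) (f : A -> B -> R[i]) :
  summ (fun z : A * B => cabs (f z.1 z.2)) ->
  csum (fun x => csum (f x)) = csum (fun y => csum (fun x => f x y)).
Proof.
move=> sf; apply: complexP => /=.
  by apply: (rsum_fubini (f := fun z => Re (f z.1 z.2))); exact: csumm_Re.
by apply: (rsum_fubini (f := fun z => Im (f z.1 z.2))); exact: csumm_Im.
Qed.

End ComplexSums.

(** * l^p norms *)

Section PowerInequalities.
Variable R : realType.

(** The convex function t^p lies above its tangent at s. For p > 1 this is Young's inequality for t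
    and s^(p-1) with the exponents p and p / (p - 1). *)
Lemma powR_tangent (p s t : R) : 1 <= p -> 0 <= s -> 0 <= t ->
  p * powR s (p - 1) * t <= powR t p + (p - 1) * powR s p.
Proof.
move=> p1 s0 t0; have [->|pn1] := eqVneq p 1.
  by rewrite subrr powRr0 mul0r addr0 powRr1 // !mul1r.
have p1' : 1 < p by rewrite lt_neqAle eq_sym pn1.
have p0 : 0 < p by apply: lt_trans p1'.
have pm : 0 < p - 1 by rewrite subr_gt0.
have q0 : 0 < p / (p - 1) by rewrite divr_gt0.
have := @conjugate_powR R t (powR s (p - 1)) p (p / (p - 1)) t0 (powR_ge0 _ _) p0 q0.
rewrite -powRrM (_ : (p - 1) * (p / (p - 1)) = p); last by field; lra.
rewrite invf_div => h.
have /h : p^-1 + (p - 1) / p = 1 by field; lra.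
rewrite -(ler_pM2l p0) mulrDr (mulrC (powR t p)) mulVKf ?gt_eqF //.
rewrite (_ : p * (powR s p * _) = (p - 1) * powR s p); last by field; lra.
by rewrite mulrAC mulrA.
Qed.

Lemma powRD_le (p x y : R) : 0 <= p -> 0 <= x -> 0 <= y ->
  powR (x + y) p <= powR 2 p * (powR x p + powR y p).
Proof.
move=> p0 x0 y0; wlog xy : x y x0 y0 / x <= y.
  move=> h; have [/h|/ltW /h] := leP x y; first exact.
  by rewrite addrC [X in _ -> _ <= _ * X]addrC; exact.
apply: (@le_trans _ _ (powR (2 * y) p)).
  apply: ge0_ler_powR; rewrite ?nnegrE //; lra.
by rewrite powRM // ler_wpM2l ?powR_ge0 // lerDr powR_ge0.
Qed.

(** Multiplied by a summable K, this yields summability of K a from that of K a^p. *)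
Lemma le_1powR (p a : R) : 1 <= p -> 0 <= a -> a <= 1 + powR a p.
Proof.
move=> p1 a0; have [a1|/ltW a1] := leP a 1.
  by apply: le_trans a1 _; rewrite lerDl powR_ge0.
by apply: le_trans (le1r_powR a1 p1) _; rewrite lerDr.
Qed.

(** Jensen's inequality for a measure K of total mass at most D, obtained by summing the tangent
    inequality at one well-chosen point against K. *)
Lemma nsum_jensen (T : choiceType) (K a : T -> R) (D p : R) : 1 <= p -> 0 < D ->
  (forall y, 0 <= K y) -> (forall y, 0 <= a y) -> summ K -> nsum K <= D ->
  summ (fun y => K y * powR (a y) p) ->
  summ (fun y => K y * a y) /\
  powR (nsum (fun y => K y * a y)) p <=
    powR D (p - 1) * nsum (fun y => K y * powR (a y) p).
Proof.
move=> p1 D0 K0 a0 sK KD sKa.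
have p0 : 0 < p by apply: lt_le_trans p1.
have Ka0 y : 0 <= K y * a y by rewrite mulr_ge0.
have Kp0 y : 0 <= K y * powR (a y) p by rewrite mulr_ge0 ?powR_ge0.
have s1 : summ (fun y => K y * a y).
  apply: summ_le (summD sK sKa) => y; rewrite !ger0_norm ?addr_ge0 //.
  by have := ler_wpM2l (K0 y) (le_1powR p1 (a0 y)); rewrite mulrDr mulr1.
split=> //; set S := nsum _; set N := nsum _.
have S0 : 0 <= S by exact: nsum_ge0.
(* The mean of a if K had mass exactly D. With S = D s the tangent inequality collapses to D s^p <=
   N, which is the claim divided by D^(p-1). *)
pose s := S / D; have s0 : 0 <= s by rewrite divr_ge0 // ltW.
have SE : S = D * s by rewrite /s mulrC divfK ?gt_eqF.
have k0 : 0 <= p * powR s (p - 1) by rewrite mulr_ge0 ?powR_ge0 // ltW.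
have k1 : 0 <= (p - 1) * powR s p by rewrite mulr_ge0 ?powR_ge0 // subr_ge0.
have : p * powR s (p - 1) * S <= N + (p - 1) * powR s p * nsum K.
  rewrite -!nsumZ // -nsumD //; first last.
  - exact: summZ.
  - by move=> x; rewrite mulr_ge0.
  apply: le_nsum => [x|x|].
  - by rewrite mulr_ge0.
  - rewrite mulrCA [_ * K x]mulrC -mulrDr ler_wpM2l //.
    exact: powR_tangent.
  - by apply: summD => //; exact: summZ.
have pE := mulr_powRB1 s0 p0.
rewrite {1}SE => h.
have {h} h1 : D * powR s p <= N.
  have h2 : (p - 1) * powR s p * nsum K <= (p - 1) * powR s p * D by rewrite ler_wpM2l.
  have h3 : p * powR s (p - 1) * (D * s) = p * D * powR s p by rewrite -pE; ring.
  move: h h2; rewrite h3; lra.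
rewrite SE powRM ?(ltW D0) // -(mulr_powRB1 (ltW D0) p0).
have := ler_wpM2l (powR_ge0 D (p - 1)) h1; lra.
Qed.

End PowerInequalities.

Lemma summE (R : realType) (T : choiceType) (f : T -> R) : (forall x, 0 <= f x) ->
  summ f = (\esum_(x in [set: T]) (f x)%:E < +oo)%E :> Prop.
Proof. by move=> f0; rewrite /summ; under eq_esum do rewrite ger0_norm //. Qed.

Section LpNorms.
Variables (R : realType) (X : choiceType) (m : X -> R).
Hypothesis hm : forall x, 0 < m x.
Implicit Types (f g : X -> R[i]) (p : R).

(** Summand of the p-th power of the norm. Estimates are made on the real number [nsum (lpt p f)],
    without the root, and only then transferred to [lpnorm]. *)
Definition lpt p f (x : X) : R := powR (cabs (f x)) p * m x.

Lemma lpt_ge0 p f x : 0 <= lpt p f x.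
Proof. by rewrite mulr_ge0 ?powR_ge0 // ltW. Qed.

Lemma lpP p f : 0 < p -> lp m p%:E f <-> summ (lpt p f).
Proof.
move=> p0; rewrite summE; last exact: lpt_ge0.
rewrite /lp /= -/(lpt p f).
split=> [|h]; last exact: poweR_lty.
by apply: lty_poweRy; rewrite invr_neq0 // gt_eqF.
Qed.

Lemma lpnormE p f : 0 < p -> summ (lpt p f) ->
  lpnorm m p%:E f = (powR (nsum (lpt p f)) p^-1)%:E.
Proof.
move=> p0 sf; rewrite /= -/(lpt p f) -poweR_EFin -esum_fin //; exact: lpt_ge0.
Qed.

Lemma lpnorm_le p f g k : 0 < p -> 0 <= k -> summ (lpt p f) -> summ (lpt p g) ->
  nsum (lpt p f) <= powR k p * nsum (lpt p g) ->
  (lpnorm m p%:E f <= k%:E * lpnorm m p%:E g)%E.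
Proof.
move=> p0 k0 sf sg h; rewrite !lpnormE // -EFinM lee_fin.
have ng0 : 0 <= nsum (lpt p g) by apply: nsum_ge0; exact: lpt_ge0.
have nf0 : 0 <= nsum (lpt p f) by apply: nsum_ge0; exact: lpt_ge0.
have {1}-> : k = powR (powR k p) p^-1 by rewrite -powRrM divff ?gt_eqF // powRr1.
rewrite -powRM ?powR_ge0 //; apply: ge0_ler_powR => //.
- by rewrite invr_ge0 ltW.
- by rewrite nnegrE mulr_ge0 ?powR_ge0.
Qed.

Lemma powRV_le p (a b : R) : 0 < p -> 0 <= a -> 0 <= b ->
  powR a p^-1 <= b -> a <= powR b p.
Proof.
move=> p0 a0 b0 h; have {1}-> : a = powR (powR a p^-1) p.
  by rewrite -powRrM mulVf ?gt_eqF // powRr1.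
by apply: ge0_ler_powR => //; rewrite ?nnegrE ?powR_ge0 // ltW.
Qed.

Lemma le_lpnorm p f g k : 0 < p -> 0 <= k -> summ (lpt p g) ->
  (lpnorm m p%:E f <= k%:E * lpnorm m p%:E g)%E ->
  summ (lpt p f) /\ nsum (lpt p f) <= powR k p * nsum (lpt p g).
Proof.
move=> p0 k0 sg h.
have ng0 : 0 <= nsum (lpt p g) by apply: nsum_ge0; exact: lpt_ge0.
have sf : summ (lpt p f).
  by apply/(lpP _ p0); apply: le_lt_trans h _; rewrite lpnormE // -EFinM ltry.
split=> //; move: h; rewrite !lpnormE // -EFinM lee_fin => h.
have nf0 : 0 <= nsum (lpt p f) by apply: nsum_ge0; exact: lpt_ge0.
have := powRV_le p0 nf0 (mulr_ge0 k0 (powR_ge0 _ _)) h.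
by rewrite powRM ?powR_ge0 // -powRrM mulVf ?gt_eqF // powRr1.
Qed.

Lemma lpnorm_cvg0 p (U : Type) (F : set_system U) {FF : Filter F} (h : U -> X -> R[i]) :
  0 < p -> (\forall u \near F, summ (lpt p (h u))) ->
  nsum (lpt p (h u)) @[u --> F] --> (0 : R) ->
  lpnorm m p%:E (h u) @[u --> F] --> 0%E.
Proof.
move=> p0 sh /cvgrPdist_lt h0.
apply/fine_cvgP; split.
  by near=> u; rewrite lpnormE //; near: u.
apply/cvgrPdist_lt => e e0.
have ep : 0 < powR e p by rewrite powR_gt0.
near=> u.
rewrite /comp lpnormE //; last by near: u.
rewrite sub0r normrN ger0_norm ?powR_ge0 //=.
have : `|0 - nsum (lpt p (h u))| < powR e p by near: u; exact: h0.
have nn : 0 <= nsum (lpt p (h u)) by apply: nsum_ge0; exact: lpt_ge0.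
rewrite sub0r normrN ger0_norm // => hh.
have {1}-> : e = powR (powR e p) p^-1 by rewrite -powRrM divff ?gt_eqF // powRr1 // ltW.
by apply: gt0_ltr_powR; rewrite ?nnegrE ?powR_ge0 ?invr_gt0.
Unshelve. all: by end_near. Qed.

(** A limit 0 in the extended reals forces the norms to be finite eventually, so summability is part
    of the conclusion. *)
Lemma cvg0_lpnorm p (U : Type) (F : set_system U) {FF : Filter F} (h : U -> X -> R[i]) :
  0 < p -> lpnorm m p%:E (h u) @[u --> F] --> 0%E ->
  (\forall u \near F, summ (lpt p (h u))) /\
  nsum (lpt p (h u)) @[u --> F] --> (0 : R).
Proof.
move=> p0 /fine_cvgP[fh /cvgrPdist_lt h0].
have sh : \forall u \near F, summ (lpt p (h u)).
  near=> u; apply/(lpP _ p0).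
  have : lpnorm m p%:E (h u) \is a fin_num by near: u.
  by rewrite /lp fin_numElt => /andP[].
split=> //; apply/cvgrPdist_le => e e0.
have ep : 0 < powR e p^-1 by rewrite powR_gt0.
near=> u.
have nn : 0 <= nsum (lpt p (h u)) by apply: nsum_ge0; exact: lpt_ge0.
have : `|0 - fine (lpnorm m p%:E (h u))| < powR e p^-1 by near: u; exact: h0.
rewrite lpnormE //=; last by near: u.
rewrite !sub0r !normrN !ger0_norm ?powR_ge0 // => /ltW /(powRV_le p0 nn (powR_ge0 _ _)).
by rewrite -powRrM mulVf ?gt_eqF // powRr1 // ltW.
Unshelve. all: by end_near. Qed.

(** Pointwise substitute for Minkowski's inequality; the factor 2^p is harmless because it serves
    only for summability, boundedness and convergence to 0. *)
Lemma lptD_le p f g x : 0 <= p ->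
  lpt p (fun x => f x + g x) x <= powR 2 p * (lpt p f x + lpt p g x).
Proof.
move=> p0; rewrite /lpt -mulrDl mulrA ler_wpM2r ?(ltW (hm x)) //.
apply: le_trans (powRD_le p0 (cabs_ge0 _) (cabs_ge0 _)).
by apply: ge0_ler_powR; rewrite ?nnegrE ?addr_ge0 ?cabs_ge0 //; exact: cabsD.
Qed.

Lemma summ_lptD p f g : 0 <= p -> summ (lpt p f) -> summ (lpt p g) ->
  summ (lpt p (fun x => f x + g x)).
Proof.
move=> p0 sf sg; apply: summ_le (summZ (powR 2 p) (summD sf sg)) => x.
rewrite !ger0_norm ?lptD_le ?lpt_ge0 //.
by rewrite mulr_ge0 ?addr_ge0 ?lpt_ge0 ?powR_ge0.
Qed.

Lemma lptZ p (a : R[i]) f x : lpt p (fun x => a * f x) x = powR (cabs a) p * lpt p f x.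
Proof. by rewrite /lpt cabsM powRM ?cabs_ge0 // mulrA. Qed.

Lemma summ_lptZ p (a : R[i]) f : summ (lpt p f) -> summ (lpt p (fun x => a * f x)).
Proof.
move=> sf; rewrite (_ : lpt p _ = fun x => powR (cabs a) p * lpt p f x).
  exact: summZ.
by apply/funext => x; rewrite lptZ.
Qed.

Lemma summ_lpt_fsupp p f (F : {fset X}) : 0 < p -> (forall x, x \notin F -> f x = 0) ->
  summ (lpt p f).
Proof.
move=> p0 fF; have [||s _] := @nsum_fsupp _ _ (lpt p f) F; last exact: s.
- exact: lpt_ge0.
- by move=> x /fF e; rewrite /lpt e cabs0 powR0 ?gt_eqF // mul0r.
Qed.

Lemma Cc_fset f : Cc f -> exists F : {fset X}, forall x, x \notin F -> f x = 0.
Proof.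
move=> cf; exists (fset_set [set x | f x != 0]) => x.
by rewrite in_fset_set // notin_setE /= => /negP; rewrite negbK => /eqP.
Qed.

Lemma fset_Cc f (F : {fset X}) : (forall x, x \notin F -> f x = 0) -> Cc f.
Proof.
move=> fF; apply: (@sub_finite_set _ _ [set` F]); last exact: finite_fset.
by move=> x /= fx; apply: contraNT fx => /fF ->.
Qed.

Lemma lp2_lpt f : lpt 2 f = fun x => cabs (f x) ^+ 2 * m x.
Proof. by apply/funext => x; rewrite /lpt powR_mulrn ?cabs_ge0. Qed.

Lemma lpt1 f : lpt 1 f = fun x => cabs (f x) * m x.
Proof. by apply/funext => x; rewrite /lpt powRr1 ?cabs_ge0. Qed.

Lemma linftyP f : lp m +oo%E f <-> exists2 M, 0 <= M & forall x, cabs (f x) <= M.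
Proof.
rewrite /lp /=; split=> [h|[M M0 h]].
  set S := ereal_sup _ in h.
  have S0 : (0 <= S)%E by apply: ereal_sup_ubound; left.
  have Sf : S \is a fin_num by rewrite ge0_fin_numE.
  exists (fine S); first exact: fine_ge0.
  move=> x; rewrite -lee_fin fineK //; apply: ereal_sup_ubound; right; by exists x.
apply: le_lt_trans (ltry M); apply: ub_ereal_sup => _ [->|[x _ <-]]; by rewrite lee_fin.
Qed.

Lemma linfty_le f : lp m +oo%E f ->
  exists M : R, [/\ 0 <= M, lpnorm m +oo%E f = M%:E & forall x, cabs (f x) <= M].
Proof.
rewrite /lp /= => h; set S := ereal_sup _ in h *.
have S0 : (0 <= S)%E by apply: ereal_sup_ubound; left.
have Sf : S \is a fin_num by rewrite ge0_fin_numE.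
exists (fine S); split; [exact: fine_ge0|by rewrite fineK|].
move=> x; rewrite -lee_fin fineK //; apply: ereal_sup_ubound; right; by exists x.
Qed.

End LpNorms.

(** * Volume growth *)

Lemma le_esum_nsum (R : realType) (T : choiceType) (f : T -> R) M : (forall x, 0 <= f x) ->
  (\esum_(x in [set: T]) (f x)%:E <= M%:E)%E -> summ f /\ nsum f <= M.
Proof.
move=> f0 h; have sf : summ f by rewrite summE //; apply: le_lt_trans h (ltry _).
by split=> //; rewrite -lee_fin -esum_fin.
Qed.

Section VolumeGrowth.
Variables (R : realType) (X : choiceType) (m : X -> R) (d : X -> X -> R).
Variables (nu C : R).
Hypothesis hm : forall x, 0 < m x.
Hypothesis hd : is_pseudo_metric d.
Hypothesis hnu : 0 < nu.
Hypothesis hvol : forall x r, 0 < r ->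
  (mass m (dball d r x) <= (C * expR (nu * r) * m x)%:E)%E.

Let d0 x y : 0 <= d x y. Proof. exact: pmetric_ge0. Qed.

Lemma ball_sum x r : 0 < r ->
  summ (fun y => if d x y <= r then m y else 0) /\
  nsum (fun y => if d x y <= r then m y else 0) <= C * expR (nu * r) * m x.
Proof.
move=> r0; apply: le_esum_nsum.
  by move=> y; case: ifP => // _; exact: ltW.
apply: le_trans (hvol x r0); rewrite /mass [leRHS]esum_mkcond.
apply: le_esum => y _; case: ifPn => h; last by case: ifP => // _; rewrite lee_fin ltW.
by rewrite mem_set.
Qed.

(** A point of a ball weighs at most as much as the ball. This compares the masses of any two points
    in terms of their distance. *)
Lemma ball_point x y r : 0 < r -> d x y <= r -> m y <= C * expR (nu * r) * m x.
Proof.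
move=> r0 xy; have [s h] := ball_sum x r0.
apply: le_trans h; have := point_le_nsum y _ s; rewrite xy; apply.
by move=> z; case: ifP => // _; exact: ltW.
Qed.

(** The point x lies in its own ball of radius 1. Over an empty X nothing would constrain C. *)
Lemma growth_gt0 (x : X) : 0 < C.
Proof.
have := @ball_point x x 1 ltr01; rewrite pmetric_refl // => /(_ ler01).
have := hm x; have := expR_gt0 (nu * 1); rewrite -mulrA => e0 m0 h.
have em : 0 < expR (nu * 1) * m x by rewrite mulr_gt0.
rewrite -(pmulr_lgt0 _ em); exact: lt_le_trans m0 h.
Qed.

(** If y lies in the ball around x, then x lies in the ball around y, so [ball_point] bounds m y
    below by a constant [del] depending on x and r only. A ball of finite mass contains finitely
    many such points: none of them can sit in a tail of mass below [del]. *)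
Lemma ball_finite x r : exists F : {fset X}, forall y, d x y <= r -> y \in F.
Proof.
wlog r0 : r / 0 < r.
  move=> h; have [|F hF] := h (Num.max r 1); first by rewrite lt_max ltr01 orbT.
  by exists F => y xy; apply: hF; rewrite le_max xy.
have C0 := growth_gt0 x.
pose del := m x / (C * expR (nu * r)).
have del0 : 0 < del by rewrite divr_gt0 ?mulr_gt0 ?expR_gt0.
have f0 y : 0 <= (if d x y <= r then m y else 0) by case: ifP => // _; exact: ltW.
have [s _] := ball_sum x r0; have [F hF] := summ_tail f0 s del0.
exists F => y xy; case: (boolP (y \in F)) => // yF; exfalso; move: hF.
apply/negP; rewrite -leNgt.
have : del <= m y.
  rewrite /del ler_pdivrMr ?mulr_gt0 ?expR_gt0 // mulrC.
  by apply: ball_point => //; rewrite pmetric_sym.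
move=> h; apply: le_trans h _.
set g := (X in nsum X).
have g0 z : 0 <= g z by rewrite /g; case: ifP.
have sg : summ g by apply: summ_le s => z; rewrite /g; case: ifP; rewrite ?normr0.
by have := point_le_nsum y g0 sg; rewrite {1}/g (negPf yF) xy.
Qed.

(* Summation over the shells k <= d x y < k + 1. *)
Lemma shell_sum (gam : R) : nu < gam -> exists2 D : R, 0 < D & forall x,
  summ (fun y => expR (- gam * d x y) * m y) /\
  nsum (fun y => expR (- gam * d x y) * m y) <= D * m x.
Proof.
(* Shell j contributes at most e^(- gam j) times the mass of the ball of radius j + 1, that is, A
   q^j m x. The geometric series converges because nu < gam. *)
move=> hg; pose q := expR (nu - gam).
have q0 : 0 < q by exact: expR_gt0.
have q1 : q < 1 by rewrite -expR0 ltr_expR subr_lt0.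
have [[x0]|noX] := pselect (inhabited X); last first.
  by exists 1 => // x; exfalso; apply: noX.
have C0 := growth_gt0 x0.
pose A := C * expR nu; have A0 : 0 < A by rewrite mulr_gt0 ?expR_gt0.
exists (A / (1 - q)); first by rewrite divr_gt0 ?subr_gt0.
move=> x; have f0 y : 0 <= expR (- gam * d x y) * m y by rewrite mulr_ge0 ?expR_ge0 ?ltW.
suff h (F : {fset X}) : \sum_(y <- F) expR (- gam * d x y) * m y <= A / (1 - q) * m x.
  split; last exact: nsum_le_fset.
  apply: summ_ub (A / (1 - q) * m x) _ => F.
  by under eq_bigr do rewrite ger0_norm //.
pose k y := Num.truncn (d x y).
pose N := (\max_(y <- F) k y).+1.
(* Each point is counted in every ball of radius j + 1 that contains it; the term with j the integer
   part of d x y already dominates its summand. *)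
apply: (@le_trans _ _ (\sum_(y <- F) \sum_(j < N)
    (if d x y <= j.+1%:R then expR (- gam * j%:R) * m y else 0))).
  rewrite big_seq [leRHS]big_seq; apply: ler_sum => y yF.
  have kN : (k y < N)%N by rewrite ltnS; apply: (leq_bigmax_seq (F := k)).
  have /andP[k1 k2] := truncn_itv (d0 x y).
  rewrite (bigD1 (Ordinal kN)) //= -/(k y) (ltW k2).
  apply: (@le_trans _ _ (expR (- gam * (k y)%:R) * m y)).
    rewrite ler_wpM2r ?(ltW (hm y)) // ler_expR !mulNr lerN2 ler_wpM2l //.
    by rewrite ltW // (lt_trans hnu).
  rewrite lerDl; apply: sumr_ge0 => j _; case: ifP => // _.
  by rewrite mulr_ge0 ?expR_ge0 ?ltW.
rewrite exchange_big /=.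
apply: (@le_trans _ _ (\sum_(j < N) A * q ^+ j * m x)).
  apply: ler_sum => j _.
  have [s h] := @ball_sum x j.+1%:R (ltr0Sn _ _).
  have g0 y : 0 <= (if d x y <= j.+1%:R then m y else 0) by case: ifP => // _; exact: ltW.
  apply: (@le_trans _ _ (expR (- gam * j%:R) * (C * expR (nu * j.+1%:R) * m x))).
    apply: le_trans (ler_wpM2l (expR_ge0 _) (le_trans (fset_le_nsum F g0 s) h)).
    rewrite mulr_sumr; apply: ler_sum => y _; case: ifP => //; by rewrite mulr0.
  rewrite le_eqVlt; apply/orP; left; apply/eqP.
  rewrite /A /q -expRM_natl -natr1 mulrDr mulr1 expRD.
  rewrite (_ : j%:R * (nu - gam) = - gam * j%:R + nu * j%:R); last by ring.
  rewrite expRD; ring.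
rewrite -mulr_suml ler_wpM2r ?(ltW (hm x)) // -mulr_sumr ler_wpM2l ?(ltW A0) //.
have -> : \sum_(j < N) q ^+ j = (1 - q ^+ N) / (1 - q).
  have q1' : 1 - q != 0 by rewrite gt_eqF // subr_gt0.
  by apply: (mulIf q1'); rewrite divfK // -(opprB (q ^+ N)) subrX1; ring.
by rewrite -[leRHS]mul1r ler_wpM2r ?invr_ge0 ?subr_ge0 ?(ltW q1) // gerBl exprn_ge0 // ltW.
Qed.

(** The root reflects that the indicator of y has norm sqrt(m y) in l^2 and that evaluation at x has
    norm 1 / sqrt(m x). The kernel acts by plain summation over y, without the weight m y. *)
Definition davies_kernel (bet : R) (x y : X) : R :=
  Num.sqrt (m y / m x) * expR (- bet * d x y).

Lemma davies_kernel_ge0 bet x y : 0 <= davies_kernel bet x y.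
Proof. by rewrite mulr_ge0 ?sqrtr_ge0 ?expR_ge0. Qed.

(** Both sides equal sqrt(m x m y) e^(- beta d(x,y)). Weighted column sums thereby become row
    sums. *)
Lemma davies_kernel_sym bet x y :
  davies_kernel bet x y * m x = m y * davies_kernel bet y x.
Proof.
rewrite /davies_kernel (pmetric_sym hd y x).
have mx := hm x; have my := hm y.
have h (a b : R) : 0 < a -> 0 < b -> Num.sqrt (a / b) * b = Num.sqrt a * Num.sqrt b.
  move=> a0 b0; rewrite sqrtrM ?(ltW a0) // sqrtrV ?(ltW b0) //.
  rewrite -{2}(sqr_sqrtr (ltW b0)) expr2 mulrA mulfVK //.
  by rewrite gt_eqF // sqrtr_gt0.
rewrite mulrAC h // mulrA [m y * _]mulrC h //; ring.
Qed.

(** Origin of the threshold 3 nu / 2. Volume growth bounds sqrt(m x / m y) by a multiple of e^(nu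
    d(x,y) / 2), which replaces sqrt(m y / m x) by m y / m x at the expense of nu / 2 in the
    exponent. The remaining rate beta - nu / 2 must exceed nu for the shell sum to converge. *)
Lemma davies_kernel_sums bet : 3 * nu / 2 < bet -> exists2 D : R, 0 < D &
  (forall x, summ (davies_kernel bet x) /\ nsum (davies_kernel bet x) <= D) /\
  (forall y, summ (fun x => davies_kernel bet x y * m x) /\
             nsum (fun x => davies_kernel bet x y * m x) <= D * m y).
Proof.
move=> hb; have hg : nu < bet - nu / 2 by lra.
have [D0 D00 hD0] := shell_sum hg.
have [[x0]|noX] := pselect (inhabited X); last first.
  by exists 1 => //; split=> x; exfalso; apply: noX.
have C0 := growth_gt0 x0.
pose A := Num.sqrt C * expR (nu / 2).
have A0 : 0 < A by rewrite mulr_gt0 ?sqrtr_gt0 ?expR_gt0.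
have row x : summ (davies_kernel bet x) /\ nsum (davies_kernel bet x) <= A * D0.
  have [s h] := hD0 x.
  have K0 y : 0 <= davies_kernel bet x y by exact: davies_kernel_ge0.
  have le y : davies_kernel bet x y <= A / m x * (expR (- (bet - nu / 2) * d x y) * m y).
    have mx := hm x; have my := hm y.
    (* The radius is enlarged by 1 because d x y may be 0 and radii must be positive. *)
    have bp : m x <= C * expR (nu * (d x y + 1)) * m y.
      by apply: ball_point; [rewrite ltr_wpDl|rewrite pmetric_sym // lerDl].
    have : Num.sqrt (m x / m y) <= Num.sqrt (C * expR (nu * (d x y + 1))).
      by apply: ler_wsqrtr; rewrite ler_pdivrMr.
    rewrite [Num.sqrt (C * _)]sqrtrM ?(ltW C0) // (_ : nu * (d x y + 1) = (nu / 2 + nu / 2 * d x y) *+ 2); last first.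
      by rewrite mulr2n; field.
    rewrite mulr2n expRD -expr2 sqrtr_sqr ger0_norm ?expR_ge0 // expRD => sq.
    rewrite /davies_kernel.
    have -> : Num.sqrt (m y / m x) = m y / m x * Num.sqrt (m x / m y).
      have {2}-> : m y / m x = Num.sqrt (m y / m x) ^+ 2 by rewrite sqr_sqrtr // divr_ge0 ?ltW.
      rewrite expr2 -mulrA -sqrtrM ?divr_ge0 ?ltW //.
      by rewrite (_ : m y / m x * (m x / m y) = 1) ?sqrtr1 ?mulr1 //; field; rewrite !gt_eqF.
    apply: (@le_trans _ _ (m y / m x * (Num.sqrt C * (expR (nu / 2) * expR (nu / 2 * d x y)))
        * expR (- bet * d x y))).
      rewrite ler_wpM2r ?expR_ge0 // ler_wpM2l // divr_ge0 ?ltW //.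
    rewrite (_ : - (bet - nu / 2) * d x y = nu / 2 * d x y + - bet * d x y); last by ring.
    by rewrite expRD le_eqVlt /A; apply/orP; left; apply/eqP; ring.
  have s2 := summZ (A / m x) s.
  split; first by apply: summ_le s2 => y; rewrite (ger0_norm (K0 y)) (le_trans (le y)) // ler_norm.
  apply: le_trans (le_nsum K0 le s2) _; rewrite nsumZ; first last.
  - by move=> y; rewrite mulr_ge0 ?expR_ge0 ?ltW.
  - by rewrite divr_ge0 ?ltW.
  apply: le_trans (ler_wpM2l _ h) _; first by rewrite divr_ge0 ?ltW.
  by rewrite le_eqVlt; apply/orP; left; apply/eqP; field; rewrite gt_eqF.
exists (A * D0); first by rewrite mulr_gt0.
split=> // y; have [s h] := row y.
rewrite (_ : (fun x => _) = fun x => m y * davies_kernel bet y x); last first.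
  by apply/funext => x; rewrite davies_kernel_sym.
split; first exact: summZ.
rewrite nsumZ ?(ltW (hm y)) //; last by move=> x; exact: davies_kernel_ge0.
by rewrite mulrC ler_wpM2r // ltW.
Qed.

End VolumeGrowth.

(** * The Schroedinger form on finitely supported functions *)

Lemma conjM (R : realType) (z w : R[i]) : ((z * w)^* = z^* * w^*)%R.
Proof. exact: rmorphM. Qed.

Section SchrodingerForm.
Variables (R : realType) (X : choiceType) (b : X -> X -> R).
Variables (o : X -> X -> R[i]).
Hypothesis hb : is_graph b.
Hypothesis ho : is_magnetic_potential o.
Hypothesis hN : forall x, finite_set [set y | 0 < b x y].
Implicit Types (c m : X -> R) (phi psi u : X -> R[i]).

Local Notation Re := complex.Re.

Definition nbr (x : X) : {fset X} := fset_set [set y | 0 < b x y].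

Lemma notin_nbr x y : y \notin nbr x -> b x y = 0.
Proof.
rewrite in_fset_set // notin_setE /= => h; apply/eqP; rewrite eq_le graph_ge0 // andbT.
by rewrite leNgt; apply/negP.
Qed.

Lemma magnetic_unit x y : o x y * (o x y)^* = 1.
Proof.
have [h _] := ho x y; move: h; rewrite normc_cabs mulc_conj => /complexI ->.
by rewrite expr1n.
Qed.

Lemma magnetic_sym x y : o y x = (o x y)^*.
Proof. by have [_ ->] := ho y x. Qed.

Lemma cabs_magnetic x y : cabs (o x y) = 1.
Proof. by have [h _] := ho x y; move: h; rewrite normc_cabs => /complexI. Qed.

(* m times the formal Schroedinger operator. *)
Definition lap c u (x : X) : R[i] :=
  \sum_(y <- nbr x) (b x y)%:C * (u x - o x y * u y) + (c x)%:C * u x.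

Lemma lapD c a u v x : lap c (fun x => a * u x + v x) x = a * lap c u x + lap c v x.
Proof.
rewrite /lap [a * (_ + _)]mulrDr addrACA mulr_sumr -big_split /=; congr (_ + _); last by ring.
by apply: eq_bigr => y _; ring.
Qed.

Lemma lap_fset c u x (G : {fset X}) : (nbr x `<=` G)%fset ->
  lap c u x = \sum_(y <- G) (b x y)%:C * (u x - o x y * u y) + (c x)%:C * u x.
Proof.
move=> sG; rewrite /lap (big_fset_incl _ sG) // => y _ /notin_nbr ->.
by rewrite rmorph0 mul0r.
Qed.

Lemma csum_pairs (f : X * X -> R[i]) (G : {fset X}) :
  (forall z, (z.1 \notin G) || (z.2 \notin G) -> f z = 0) ->
  csum f = \sum_(x <- G) \sum_(y <- G) f (x, y).
Proof.
move=> fG; pose GG := [fset ((x, y) : X * X) | x in G, y in G]%fset.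
rewrite (@csum_fsupp _ _ _ GG).
  rewrite /GG big_imfset2 //= => -[x y] [x' y'] _ _ /= [-> ->] //.
move=> [x y] xy; apply: fG => /=; rewrite -negb_and; apply: contra xy => /andP[xG yG].
by apply/imfset2P; exists x => //; exists y.
Qed.

(** Green's formula: summation by parts over pairs, carried out inside a finite set of vertices. *)
Lemma green c phi psi (F : {fset X}) : Cc phi -> (forall x, x \notin F -> psi x = 0) ->
  schrodinger_form b o c phi psi = \sum_(x <- F) lap c phi x * (psi x)^*.
Proof.
move=> /Cc_fset[P hP] hF.
(* A pair with b x y > 0 contributes only if one endpoint lies in a support; the other is then a
   neighbour, so both belong to G. *)
pose G := (F `|` P `|` (\bigcup_(x <- F) nbr x) `|` (\bigcup_(x <- P) nbr x))%fset.
have FG : (F `<=` G)%fset by rewrite /G -!fsetUA fsubsetUl.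
have NG x : x \in F -> (nbr x `<=` G)%fset.
  move=> xF; apply: (fsubset_trans (@bigfcup_sup _ _ _ x xpredT nbr xF isT)).
  by apply/fsubsetP => y yU; rewrite /G !inE yU !orbT.
have NP x : x \in P -> (nbr x `<=` G)%fset.
  move=> xF; apply: (fsubset_trans (@bigfcup_sup _ _ _ x xpredT nbr xF isT)).
  by apply/fsubsetP => y yU; rewrite /G !inE yU !orbT.
have hPG x : x \notin G -> phi x = 0.
  by move=> h; apply: hP; apply: contra h; rewrite /G !inE => ->; rewrite !orbT.
have hFG x : x \notin G -> psi x = 0.
  by move=> h; apply: hF; apply: contra h; rewrite /G !inE => ->.
rewrite /schrodinger_form (csum_pairs (G := G)) /=; last first.
  suff aux x y : x \notin G ->
     (b x y)%:C * nabla o phi x y * (nabla o psi x y)^* = 0 /\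
     (b y x)%:C * nabla o phi y x * (nabla o psi y x)^* = 0.
    move=> [x y] /= /orP[xG|yG]; first by have [] := aux x y xG.
    by have [] := aux y x yG.
  move=> xG; rewrite (graph_sym hb y x).
  have [->|b0] := eqVneq (b x y) 0; first by rewrite rmorph0 !mul0r.
  have yP : y \notin P.
    apply: contra xG => /NP/fsubsetP; apply; apply: contraNT b0 => /notin_nbr.
    by rewrite (graph_sym hb) => ->.
  by rewrite /nabla (hPG _ xG) (hP _ yP) !mulr0 subr0 !(mulr0, mul0r).
rewrite (@csum_fsupp _ _ _ F) /=; last by move=> x /hF ->; rewrite conjC0 mulr0.
pose T x y : R[i] := (b x y)%:C * (phi x - o x y * phi y).
(* By this antisymmetry each pair term splits into two halves that are exchanged by swapping x and
   y; their equality absorbs the factor 1/2 of the form. *)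
have TE x y : T x y * (o x y)^* = - T y x.
  rewrite /T (graph_sym hb y x) (magnetic_sym x y).
  have := magnetic_unit x y; move: ((o x y)^*) => z hz.
  transitivity ((b x y)%:C * (phi x * z - (o x y * z) * phi y)); first by ring.
  by rewrite hz; ring.
have E x y : (b x y)%:C * nabla o phi x y * (nabla o psi x y)^* =
    T x y * (psi x)^* + T y x * (psi y)^*.
  rewrite -[T y x]opprK -TE /nabla rmorphB rmorphM /= /T; ring.
under eq_bigr => x _ do (under eq_bigr => y _ do rewrite E; rewrite big_split /=).
rewrite big_split /= [X in _ * (_ + X)]exchange_big /= -mulr2n -[X in 2^-1 * X]mulr_natl.
rewrite mulKf ?pnatr_eq0 // -(big_fset_incl _ FG); last first.
  by move=> x _ /hF ->; apply: big1 => y _; rewrite conjC0 mulr0.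
rewrite -big_split /= big_seq [RHS]big_seq; apply: eq_bigr => x xF.
by rewrite (lap_fset c phi (NG _ xF)) mulrDl -mulr_suml.
Qed.

Lemma form_conj c phi psi :
  schrodinger_form b o c psi phi = (schrodinger_form b o c phi psi)^*.
Proof.
rewrite /schrodinger_form rmorphD rmorphM /= -!csum_conj; congr (_ + _).
  rewrite fmorphV rmorph_nat; congr (_ * _); congr csum; apply/funext => z.
  by rewrite !rmorphM /= conj_real conjCK; ring.
by congr csum; apply/funext => z; rewrite !rmorphM /= conj_real conjCK; ring.
Qed.

Lemma Cc_lin a phi psi : Cc phi -> Cc psi -> Cc (fun x => a * phi x + psi x).
Proof.
move=> /Cc_fset[F hF] /Cc_fset[G hG]; apply: (@fset_Cc _ _ _ (F `|` G)%fset) => x.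
by rewrite inE negb_or => /andP[/hF -> /hG ->]; rewrite mulr0 addr0.
Qed.

Lemma form_linl c a phi phi' psi : Cc phi -> Cc phi' -> Cc psi ->
  schrodinger_form b o c (fun x => a * phi x + phi' x) psi =
  a * schrodinger_form b o c phi psi + schrodinger_form b o c phi' psi.
Proof.
move=> cp cp' /Cc_fset[F hF]; rewrite !(green c (F := F)) //; last exact: Cc_lin.
rewrite mulr_sumr -big_split; apply: eq_bigr => x _ /=.
by rewrite lapD mulrDl mulrA.
Qed.

Lemma form_linr c a phi psi psi' : Cc phi -> Cc psi -> Cc psi' ->
  schrodinger_form b o c phi (fun x => a * psi x + psi' x) =
  a^* * schrodinger_form b o c phi psi + schrodinger_form b o c phi psi'.
Proof.
move=> cp cq cq'; rewrite form_conj form_linl // rmorphD rmorphM /=.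
by rewrite -!form_conj.
Qed.

Definition qre c phi : R := Re (schrodinger_form b o c phi phi).

(** The form is evaluated at - t conj(z) phi + psi with z = Q(phi, psi), a phase that makes the
    cross terms real, and the resulting quadratic in t is nonnegative. The potential c is an
    argument because the inequality is also applied to the shifted form Q - E. *)
Lemma form_cauchy_schwarz c phi psi :
  (forall phi, Cc phi -> 0 <= qre c phi) -> Cc phi -> Cc psi ->
  cabs (schrodinger_form b o c phi psi) ^+ 2 <= qre c phi * qre c psi.
Proof.
move=> pos cp cq; set z := schrodinger_form b o c phi psi.
set A := qre c phi; set B := qre c psi; set Z := cabs z ^+ 2.
have Z0 : 0 <= Z by exact: sqr_ge0.
have A0 : 0 <= A by exact: pos.
have B0 : 0 <= B by exact: pos.
have h (t : R) : 0 <= t ^+ 2 * Z * A - 2 * t * Z + B.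
  have := pos _ (Cc_lin ((- t)%:C * z^*) cp cq).
  rewrite /qre form_linl ?form_linr //; try exact: Cc_lin.
  rewrite (form_conj c phi psi) -/z conjM conjCK conj_real.
  set w := _ + _; rewrite (_ : Re w = t ^+ 2 * Z * A - 2 * t * Z + B) //.
  have -> : w = (t ^+ 2)%:C * (z * z^*) * schrodinger_form b o c phi phi
     - (2 * t)%:C * (z * z^*) + schrodinger_form b o c psi psi.
    rewrite /w !rmorphM rmorphN /= rmorph_nat; ring.
  by rewrite mulc_conj -!(rmorphM (real_complex R)) ReD ReB ReZ.
have [A1|A1] := eqVneq A 0.
  rewrite A1 mul0r; have [Z1|Z1] := eqVneq Z 0; first by rewrite Z1.
  (* If A = 0 the quadratic is affine in t; at this t its value is -1. *)
  have := h ((B + 1) / (2 * Z)); rewrite A1 mulr0 add0r.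
  rewrite (_ : 2 * _ * Z = B + 1); first by lra.
  by field.
have Ap : 0 < A by rewrite lt_neqAle eq_sym A1.
(* The minimum of the quadratic. *)
have := h A^-1.
rewrite (_ : A^-1 ^+ 2 * Z * A - 2 * A^-1 * Z + B = (A * B - Z) / A); last by field.
by rewrite pmulr_lge0 ?invr_gt0 // subr_ge0.
Qed.

Lemma lap_shift m c r u x :
  lap (fun x => c x - r * m x) u x = lap c u x - (r * m x)%:C * u x.
Proof. by rewrite /lap rmorphB mulrBl addrA. Qed.

Lemma dot_fset m phi psi (F : {fset X}) : (forall x, x \notin F -> psi x = 0) ->
  dot m phi psi = \sum_(x <- F) phi x * (psi x)^* * (m x)%:C.
Proof.
move=> hF; rewrite /dot (@csum_fsupp _ _ _ F) // => x /hF ->.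
by rewrite conjC0 mulr0 mul0r.
Qed.

Lemma dot_fsetl m phi psi (F : {fset X}) : (forall x, x \notin F -> phi x = 0) ->
  dot m phi psi = \sum_(x <- F) phi x * (psi x)^* * (m x)%:C.
Proof.
by move=> hF; rewrite /dot (@csum_fsupp _ _ _ F) // => x /hF ->; rewrite !mul0r.
Qed.

(** Subtracting r times the inner product amounts to changing the potential, so Q - r is again a
    Schroedinger form and the lemmas above apply to it. *)
Lemma form_shift m c r phi psi : Cc phi -> Cc psi ->
  schrodinger_form b o (fun x => c x - r * m x) phi psi =
  schrodinger_form b o c phi psi - r%:C * dot m phi psi.
Proof.
move=> cp /Cc_fset[F hF]; rewrite !(green _ (F := F)) // (dot_fset _ _ hF).
rewrite mulr_sumr -sumrB; apply: eq_bigr => x _.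
by rewrite lap_shift rmorphM; ring.
Qed.

End SchrodingerForm.

(** * The Davies form inequality *)

Section CoshScaling.
Variable R : realType.

(* Compare the power series of both sides term by term. *)
Lemma cosh_scale (T del : R) : 0 < T -> `|del| <= T ->
  cosh del - 1 <= (del / T) ^+ 2 * (cosh T - 1).
Proof.
move=> T0 dT; set th := del / T.
have th1 : th ^+ 2 <= 1.
  rewrite -real_normK ?num_real // expr_le1 // /th normrM normfV (gtr0_norm T0).
  by rewrite ler_pdivrMr ?mul1r.
have -> : del = th * T by rewrite /th divfK // gt_eqF.
pose f (t : R) n := series (exp_coeff t) n + series (exp_coeff (- t)) n - 2.
have cf t : f t n @[n --> \oo] --> expR t + expR (- t) - 2.
  apply: cvgB; last exact: cvg_cst.
  by apply: cvgD; exact: is_cvg_series_exp_coeff.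
suff : expR (th * T) + expR (- (th * T)) - 2 <= th ^+ 2 * (expR T + expR (- T) - 2).
  rewrite /cosh; lra.
have cr : th ^+ 2 * f T n @[n --> \oo] --> th ^+ 2 * (expR T + expR (- T) - 2).
  by apply: cvgM; [exact: cvg_cst|exact: cf].
apply: (ler_cvg_to (cf (th * T)) cr).
(* From n = 1 on the constant terms 1 + 1 cancel the 2. Odd powers cancel, and for even k >= 2 the
   term gains th^k <= th^2 because th^2 <= 1. *)
exists 1%N => // -[//|n] _ /=.
have E t : f t n.+1 = \sum_(0 <= k < n) (exp_coeff t k.+1 + exp_coeff (- t) k.+1).
  rewrite /f /series /= !(big_nat_recl n) // big_split /=.
  by rewrite /exp_coeff /= !expr0 fact0 !divr1; ring.
rewrite !E mulr_sumr; apply: ler_sum => j _; set k := j.+1.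
rewrite /exp_coeff /= -!mulrDl mulrA ler_wpM2r ?invr_ge0 ?ler0n //.
rewrite (exprNn (th * T)) (exprNn T) -signr_odd; case: (boolP (odd k)) => ok.
  by rewrite expr1 !mulN1r !subrr mulr0.
rewrite expr0 !mul1r exprMn.
have -> : th ^+ k = th ^+ 2 ^+ k./2 by rewrite -exprM -{1}(odd_double_half k) (negPf ok) add0n mul2n.
have : th ^+ 2 ^+ k./2 <= th ^+ 2.
  have k2 : (0 < k./2)%N by move: ok; rewrite half_gt0 /k; case: (j).
  have q0 : 0 <= th ^+ 2 by exact: sqr_ge0.
  move: k2 q0 th1; case: (k./2) => // i _; set q := th ^+ 2 => q0 q1.
  by have := ler_wpM2l q0 (exprn_ile1 i q0 q1); rewrite mulr1 -exprS.
have Tk : 0 <= T ^+ k by rewrite exprn_ge0 // ltW.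
by move/(ler_wpM2r Tk); lra.
Qed.
End CoshScaling.

Section DaviesForm.
Variables (R : realType) (X : choiceType) (m : X -> R) (b : X -> X -> R).
Variables (o : X -> X -> R[i]) (c : X -> R).
Hypothesis hm : forall x, 0 < m x.
Hypothesis hb : is_graph b.
Hypothesis ho : is_magnetic_potential o.
Hypothesis hN : forall x, finite_set [set y | 0 < b x y].
Implicit Types (phi psi u : X -> R[i]) (eta W : X -> R).

Local Notation Re := complex.Re.

Definition corr u (x y : X) : R := Re (o x y * u y * (u x)^*).

Lemma corr_sym u x y : corr u y x = corr u x y.
Proof.
rewrite /corr -[RHS]Re_conj conjM conjM conjCK (magnetic_sym ho x y); congr Re.
set z := (o x y)^*; set v := (u y)^*; ring.
Qed.

Lemma corr_le u x y : `|corr u x y| <= cabs (u x) * cabs (u y).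
Proof.
apply: le_trans (Re_le_cabs _) _; rewrite !cabsM cabs_conj (cabs_magnetic ho) mul1r.
by rewrite mulrC.
Qed.

(** In the difference of the two sums the potential and the terms |u x|^2 cancel, leaving b(x,y)
    (eta x eta y - eta x^2) times [corr]. As b and [corr] are symmetric, averaging over the swap of
    x and y completes the square. *)
Lemma energy_identity eta u (F G : {fset X}) :
  (forall x, x \notin F -> eta x = 0) -> (F `<=` G)%fset ->
  (forall x, x \in F -> (nbr b x `<=` G)%fset) ->
  \sum_(x <- F) eta x ^+ 2 * Re (lap b o c u x * (u x)^*) =
  qre b o c (fun x => (eta x)%:C * u x) -
  2^-1 * \sum_(x <- G) \sum_(y <- G) b x y * (eta x - eta y) ^+ 2 * corr u x y.
Proof.
move=> hF FG NG; pose phi x := (eta x)%:C * u x.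
have phiF x : x \notin F -> phi x = 0 by move=> /hF e; rewrite /phi e rmorph0 mul0r.
rewrite /qre (green hb ho hN c (fset_Cc phiF) phiF) Re_sum.
suff E : \sum_(x <- F) (eta x ^+ 2 * Re (lap b o c u x * (u x)^*) -
                   Re (lap b o c phi x * (phi x)^*)) =
     - (2^-1 * \sum_(x <- G) \sum_(y <- G) b x y * (eta x - eta y) ^+ 2 * corr u x y).
  by move: E; rewrite sumrB; lra.
transitivity (\sum_(x <- G) \sum_(y <- G) b x y * (eta x * eta y - eta x ^+ 2) * corr u x y).
  rewrite -(big_fset_incl _ FG); last first.
    move=> x _ /hF e; apply: big1 => y _; rewrite e; ring.
  rewrite big_seq [RHS]big_seq; apply: eq_bigr => x xF.
  rewrite !(lap_fset o hb hN _ _ (NG _ xF)) !mulrDl !ReD mulrDr opprD addrACA.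
  rewrite [X in _ + X](_ : _ = 0) ?addr0; last first.
    rewrite /phi conjM conj_real.
    rewrite (_ : (c x)%:C * ((eta x)%:C * u x) * ((eta x)%:C * (u x)^*) =
       (eta x ^+ 2)%:C * ((c x)%:C * u x * (u x)^*)); first by rewrite ReZ subrr.
    by rewrite rmorphXn /=; ring.
  rewrite !mulr_suml !Re_sum mulr_sumr -sumrB; apply: eq_bigr => y _.
  rewrite /phi conjM conj_real /corr.
  have -> : (b x y)%:C * ((eta x)%:C * u x - o x y * ((eta y)%:C * u y)) * ((eta x)%:C * (u x)^*)
    = (b x y * eta x ^+ 2)%:C * (u x * (u x)^*) - (b x y * eta x * eta y)%:C * (o x y * u y * (u x)^*).
    by rewrite !rmorphM; ring.
  have -> : (b x y)%:C * (u x - o x y * u y) * (u x)^* =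
     (b x y)%:C * (u x * (u x)^*) - (b x y)%:C * (o x y * u y * (u x)^*) by ring.
  by rewrite !ReB !ReZ; ring.
have sym : \sum_(x <- G) \sum_(y <- G) b x y * (eta x * eta y - eta x ^+ 2) * corr u x y =
   \sum_(x <- G) \sum_(y <- G) b x y * (eta x * eta y - eta y ^+ 2) * corr u x y.
  rewrite exchange_big /=; apply: eq_bigr => x _; apply: eq_bigr => y _.
  by rewrite (graph_sym hb y x) corr_sym; ring.
set S := \sum_(x <- G) \sum_(y <- G) b x y * (eta x * eta y - eta x ^+ 2) * corr u x y in sym *.
have {1}-> : S = 2^-1 * (S + S) by field.
rewrite {2}sym /S -big_split /= -mulrN; congr (_ * _); rewrite -sumrN.
apply: eq_bigr => x _; rewrite -big_split -sumrN /=; apply: eq_bigr => y _; ring.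
Qed.

Section Weight.
Variables (d : X -> X -> R) (s bet lam : R) (x0 : X).
Hypothesis hd : is_intrinsic_metric m b d.
Hypothesis s0 : 0 < s.
Hypothesis hs : forall x y, 0 < b x y -> d x y <= s.
Hypothesis bet0 : 0 < bet.
Hypothesis hlam : forall phi, Cc phi -> lam * nsum (lpt m 2 phi) <= qre b o c phi.

Let Cb := (s ^+ 2)^-1 * (cosh (bet * s) - 1).
Let W (x : X) := expR (- bet * d x x0).
Let dp : is_pseudo_metric d. Proof. by case: hd. Qed.

Lemma cosh_ge1 (t : R) : 1 <= cosh t.
Proof.
rewrite /cosh expRN.
have e0 : 0 < expR t by exact: expR_gt0.
have : 0 <= (expR t - 1) ^+ 2 / expR t by rewrite divr_ge0 ?sqr_ge0 ?ltW.
rewrite (_ : _ / _ = expR t + (expR t)^-1 - 2); last by field; rewrite gt_eqF //.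
lra.
Qed.

Lemma Cb_ge0 : 0 <= Cb.
Proof. by rewrite mulr_ge0 ?invr_ge0 ?sqr_ge0 // subr_ge0 cosh_ge1. Qed.

(** Divided by W x W y, the left side is 2 (cosh del - 1) with del the difference of the exponents.
    [cosh_scale] compares this with its value at beta s, and |del| <= beta d(x,y) turns the ratio
    into d(x,y)^2 / s^2. This is where C_beta comes from. *)
Lemma weight_diff x y : 0 < b x y ->
  (W x - W y) ^+ 2 <= 2 * Cb * d x y ^+ 2 * (W x * W y).
Proof.
move=> bxy; have dxy := hs bxy; pose del := bet * (d y x0 - d x x0).
have d0 : 0 <= d x y by exact: pmetric_ge0.
have dd : `|del| <= bet * d x y.
  rewrite normrM (gtr0_norm bet0) ler_wpM2l ?(ltW bet0) // ler_norml.
  have := pmetric_triangle dp x y x0; have := pmetric_triangle dp y x x0.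
  by rewrite (pmetric_sym dp y x) => h1 h2; apply/andP; split; lra.
have T0 : 0 < bet * s by rewrite mulr_gt0.
have dT : `|del| <= bet * s by apply: le_trans dd _; rewrite ler_wpM2l // ltW.
have := cosh_scale T0 dT.
have h2 : (del / (bet * s)) ^+ 2 <= (d x y / s) ^+ 2.
  rewrite -(real_normK (num_real (del / _))) ler_sqr ?nnegrE ?divr_ge0 ?(ltW s0) //.
  rewrite normrM normfV (gtr0_norm T0) ler_pdivrMr //.
  rewrite (_ : d x y / s * (bet * s) = bet * d x y) //; field; rewrite gt_eqF //.
have := ler_wpM2r (_ : 0 <= cosh (bet * s) - 1) h2.
rewrite subr_ge0 cosh_ge1 => /(_ isT) h3 h4.
have E : (W x - W y) ^+ 2 = (2 * (cosh del - 1)) * (W x * W y).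
  rewrite /cosh (_ : 2 * _ = expR del + expR (- del) - 2); last by field.
  rewrite /W mulrBl mulrDl -!expRD.
  have -> : del + (- bet * d x x0 + - bet * d y x0) = 2%:R * (- bet * d x x0).
    by rewrite /del; ring.
  have -> : - del + (- bet * d x x0 + - bet * d y x0) = 2%:R * (- bet * d y x0).
    by rewrite /del; ring.
  by rewrite !expRM_natl expRD; ring.
rewrite E; apply: ler_wpM2r; first by rewrite mulr_ge0 ?expR_ge0.
rewrite -mulrA ler_wpM2l // (le_trans h4) // (le_trans h3) //.
by rewrite /Cb exprMn exprVn le_eqVlt; apply/orP; left; apply/eqP; ring.
Qed.

Lemma intrinsic_fset x (G : {fset X}) : \sum_(y <- G) b x y * d x y ^+ 2 <= m x.
Proof.
have [_ /(_ x) h] := hd.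
have g0 y : 0 <= b x y * d x y ^+ 2 by rewrite mulr_ge0 ?(graph_ge0 hb) ?sqr_ge0.
move: h; rewrite -esumZl ?invr_ge0 ?(ltW (hm x)) // => /(le_trans (@esum_fset_le _ _ _ G _)).
rewrite lee_fin -mulr_sumr => h.
have h1 : (m x)^-1 * \sum_(y <- G) b x y * d x y ^+ 2 <= 1.
  by apply: h => y; rewrite mulr_ge0 // invr_ge0 ltW.
by rewrite -(ler_pM2l (_ : 0 < (m x)^-1)) ?invr_gt0 // mulVf // gt_eqF.
Qed.

(** The spectral bound is applied to eta u, and the jump term of the energy identity is absorbed by
    the intrinsic metric. Jumps of eta are controlled by W rather than by eta itself, and going back
    through W^2 <= eta^2 + 2 eps (here W <= 1 enters) produces the error term. *)
Lemma davies_form (eps : R) u (F : {fset X}) :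
  0 <= eps -> summ (lpt m 2 u) ->
  (forall x, x \notin F -> Num.max (W x - eps) 0 = 0) ->
  (lam - Cb) * \sum_(x <- F) Num.max (W x - eps) 0 ^+ 2 * lpt m 2 u x
    - 2 * eps * Cb * nsum (lpt m 2 u) <=
  \sum_(x <- F) Num.max (W x - eps) 0 ^+ 2 * Re (lap b o c u x * (u x)^*).
Proof.
move=> e0 su hF; pose eta x := Num.max (W x - eps) 0.
pose G := (F `|` \bigcup_(x <- F) nbr b x)%fset.
have FG : (F `<=` G)%fset by rewrite fsubsetUl.
have NG x : x \in F -> (nbr b x `<=` G)%fset.
  move=> xF; apply: (fsubset_trans (@bigfcup_sup _ _ _ x xpredT (nbr b) xF isT)).
  by rewrite fsubsetUr.
rewrite -/(eta _) (energy_identity u hF FG NG).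
set I := \sum_(x <- F) _; set Nu := nsum _.
have W0 x : 0 <= W x by exact: expR_ge0.
have W1 x : W x <= 1.
  by rewrite -expR0 ler_expR mulNr oppr_le0 mulr_ge0 ?(ltW bet0) // pmetric_ge0.
have hI : lam * I <= qre b o c (fun x => (eta x)%:C * u x).
  have phiF x : x \notin F -> (eta x)%:C * u x = 0.
    by move=> /hF e; rewrite /eta e rmorph0 mul0r.
  apply: le_trans (hlam (fset_Cc phiF)).
  have [||_ ->] := @nsum_fsupp _ _ (lpt m 2 (fun x => (eta x)%:C * u x)) F.
  - exact: lpt_ge0.
  - by move=> x /phiF e; rewrite /lpt e cabs0 powR0 ?mul0r.
  rewrite /I le_eqVlt; apply/orP; left; apply/eqP; congr (_ * _); apply: eq_bigr => x _.
  by rewrite !lp2_lpt cabsM exprMn cabsR real_normK ?num_real // mulrA.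
have etaW x : W x ^+ 2 <= eta x ^+ 2 + 2 * eps.
  have := W1 x; have := W0 x; rewrite /eta maxEle; case: ifP => h w0 w1.
    rewrite expr0n add0r; have : W x * W x <= eps * 1 by apply: ler_pM => //; lra.
    rewrite -expr2; lra.
  have : eps * W x <= eps * 1 by apply: ler_pM.
  nra.
have etalip x y : (eta x - eta y) ^+ 2 <= (W x - W y) ^+ 2.
  have hyp (p q : R) : `|p| <= `|q| -> p ^+ 2 <= q ^+ 2.
    by move=> pq; rewrite -(real_normK (num_real p)) -(real_normK (num_real q)) ler_sqr ?nnegrE.
  apply: hyp; have h1 := ler_norm (W x - W y); have := ler_norm (W y - W x).
  rewrite distrC => h2; rewrite ler_norml /eta.
  by case: (leP (W x - eps) 0); case: (leP (W y - eps) 0) => *; apply/andP; split; lra.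
suff hS : 2^-1 * \sum_(x <- G) \sum_(y <- G) b x y * (eta x - eta y) ^+ 2 * corr u x y
     <= Cb * (I + 2 * eps * Nu) by move: hI hS; lra.
pose A x := W x ^+ 2 * cabs (u x) ^+ 2.
have h1 : 2^-1 * \sum_(x <- G) \sum_(y <- G) b x y * (eta x - eta y) ^+ 2 * corr u x y <=
   2^-1 * \sum_(x <- G) \sum_(y <- G) (Cb * (b x y * d x y ^+ 2) * (A x + A y)).
  rewrite ler_wpM2l // ?invr_ge0 //; apply: ler_sum => x _; apply: ler_sum => y _.
  have b0 := graph_ge0 hb x y.
  have [->|bn] := eqVneq (b x y) 0; first by rewrite !mul0r mulr0 mul0r.
  have bp : 0 < b x y by rewrite lt_neqAle eq_sym bn.
  have ux := cabs_ge0 (u x); have uy := cabs_ge0 (u y).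
  apply: (@le_trans _ _ (b x y * (2 * Cb * d x y ^+ 2 * (W x * W y)) * (cabs (u x) * cabs (u y)))).
    apply: (@le_trans _ _ (b x y * (eta x - eta y) ^+ 2 * (cabs (u x) * cabs (u y)))).
      apply: ler_wpM2l; first by apply: mulr_ge0 => //; exact: sqr_ge0.
      exact: le_trans (ler_norm _) (corr_le _ _ _).
    rewrite ler_wpM2r ?mulr_ge0 // ler_wpM2l //.
    exact: le_trans (etalip x y) (weight_diff bp).
  have k0 : 0 <= Cb * (b x y * d x y ^+ 2) by apply: mulr_ge0; [exact: Cb_ge0 | apply: mulr_ge0 => //; exact: sqr_ge0].
  have : 2 * (W x * cabs (u x)) * (W y * cabs (u y)) <= A x + A y.
    have := sqr_ge0 (W x * cabs (u x) - W y * cabs (u y)); rewrite /A; nra.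
  by move/(ler_wpM2l k0); lra.
apply: le_trans h1 _.
(* By symmetry of b and d the terms with A y sum to the same as those with A x; the inner sum left
   over is then at most m x. *)
have -> : 2^-1 * \sum_(x <- G) \sum_(y <- G) (Cb * (b x y * d x y ^+ 2) * (A x + A y)) =
    Cb * \sum_(x <- G) A x * \sum_(y <- G) b x y * d x y ^+ 2.
  have E1 : \sum_(x <- G) \sum_(y <- G) (Cb * (b x y * d x y ^+ 2) * (A x + A y)) =
     \sum_(x <- G) \sum_(y <- G) (Cb * (b x y * d x y ^+ 2) * A x) +
     \sum_(x <- G) \sum_(y <- G) (Cb * (b x y * d x y ^+ 2) * A y).
    rewrite -big_split; apply: eq_bigr => x _; rewrite -big_split; apply: eq_bigr => y _ /=; ring.
  have E2 : \sum_(x <- G) \sum_(y <- G) (Cb * (b x y * d x y ^+ 2) * A y) =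
     \sum_(x <- G) \sum_(y <- G) (Cb * (b x y * d x y ^+ 2) * A x).
    rewrite exchange_big; apply: eq_bigr => x _; apply: eq_bigr => y _ /=.
    by rewrite (graph_sym hb y x) (pmetric_sym dp y x).
  rewrite E1 E2; set S := \sum_(x <- G) _.
  have -> : 2^-1 * (S + S) = S by field.
  rewrite /S mulr_sumr; apply: eq_bigr => x _; rewrite !mulr_sumr; apply: eq_bigr => y _; ring.
rewrite ler_wpM2l ?Cb_ge0 //.
apply: (@le_trans _ _ (\sum_(x <- G) (eta x ^+ 2 * lpt m 2 u x + 2 * eps * lpt m 2 u x))).
  apply: ler_sum => x _.
  have A0 : 0 <= A x by apply: mulr_ge0; exact: sqr_ge0.
  apply: le_trans (ler_wpM2l A0 (intrinsic_fset x G)) _.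
  have t0 : 0 <= lpt m 2 u x by exact: lpt_ge0.
  have -> : A x * m x = W x ^+ 2 * lpt m 2 u x by rewrite /A lp2_lpt mulrA.
  by rewrite -mulrDl; exact: ler_wpM2r (etaW x).
rewrite big_split /= lerD //.
  rewrite -(big_fset_incl _ FG) // => x _ /hF; rewrite /eta => ->.
  by rewrite expr0n mul0r.
rewrite -mulr_sumr ler_wpM2l ?mulr_ge0 //; apply: fset_le_nsum => //; exact: lpt_ge0.
Qed.

End Weight.
End DaviesForm.

(** * The form operator *)

Section ComplexLimits.
Variables (R : realType) (U : Type) (F : set_system U).
Context {FF : Filter F}.
Implicit Types (a : U -> R[i]) (z : R[i]).

Local Notation Re := complex.Re.
Local Notation Im := complex.Im.

Definition ccvg a z : Prop := cabs (a u - z) @[u --> F] --> (0 : R).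

Lemma cvg0_squeeze (f g : U -> R) : (\forall u \near F, 0 <= f u <= g u) ->
  g u @[u --> F] --> (0 : R) -> f u @[u --> F] --> (0 : R).
Proof. by move=> fg g0; apply: (squeeze_cvgr fg _ g0); exact: cvg_cst. Qed.

Lemma cvg0_sqrt (f : U -> R) : (forall u, 0 <= f u) -> f u ^+ 2 @[u --> F] --> (0 : R) ->
  f u @[u --> F] --> (0 : R).
Proof.
move=> f0 /cvgrPdist_lt h; apply/cvgrPdist_lt => e e0.
have e2 : 0 < e ^+ 2 by rewrite exprn_gt0.
near=> u.
have : `|0 - f u ^+ 2| < e ^+ 2 by near: u; exact: h.
by rewrite !sub0r !normrN !ger0_norm ?sqr_ge0 // ltr_sqr ?nnegrE ?(ltW e0).
Unshelve. all: by end_near. Qed.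

Lemma ccvgP a z : ccvg a z <->
  (Re (a u) @[u --> F] --> Re z) /\ (Im (a u) @[u --> F] --> Im z).
Proof.
split=> [h|[hr hi]].
  split; apply/subr_cvg0/norm_cvg0P; apply: cvg0_squeeze h; apply: nearW => u /=.
    by rewrite normr_ge0 -ReB Re_le_cabs.
  by rewrite normr_ge0 -ImB Im_le_cabs.
apply: cvg0_sqrt => [u|]; first exact: cabs_ge0.
suff : cabs (a u - z) ^+ 2 @[u --> F] --> (Re z - Re z) ^+ 2 + (Im z - Im z) ^+ 2.
  by rewrite !subrr expr0n addr0.
under eq_cvg do rewrite cabs_sqr ReB ImB !expr2.
by rewrite !expr2; apply: cvgD; apply: cvgM;
  (apply: cvgB; [assumption|exact: cvg_cst]).
Qed.

Lemma ccvg_cst z : ccvg (fun=> z) z.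
Proof. by apply/ccvgP; split; exact: cvg_cst. Qed.

Lemma ccvgD a a' z z' : ccvg a z -> ccvg a' z' -> ccvg (fun u => a u + a' u) (z + z').
Proof.
move=> /ccvgP[r i] /ccvgP[r' i']; apply/ccvgP; rewrite ReD ImD.
split; [under eq_cvg do rewrite ReD|under eq_cvg do rewrite ImD]; exact: cvgD.
Qed.

Lemma ccvgM a a' z z' : ccvg a z -> ccvg a' z' -> ccvg (fun u => a u * a' u) (z * z').
Proof.
move=> /ccvgP[r i] /ccvgP[r' i']; apply/ccvgP; rewrite ReM ImM.
split; [under eq_cvg do rewrite ReM; apply: cvgB|under eq_cvg do rewrite ImM; apply: cvgD];
  exact: cvgM.
Qed.

Lemma ccvg_conj a z : ccvg a z -> ccvg (fun u => (a u)^*) (z^*).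
Proof.
move=> /ccvgP[r i]; apply/ccvgP; rewrite Re_conj Im_conj.
by split; [under eq_cvg do rewrite Re_conj|under eq_cvg do rewrite Im_conj; exact: cvgN].
Qed.

Lemma ccvgZ a z k : ccvg a z -> ccvg (fun u => k * a u) (k * z).
Proof. by apply: ccvgM; exact: ccvg_cst. Qed.

Lemma ccvgB a a' z z' : ccvg a z -> ccvg a' z' -> ccvg (fun u => a u - a' u) (z - z').
Proof.
move=> h h'; rewrite -mulN1r; have := ccvgD h (ccvgZ (-1) h').
by under [X in ccvg X _]eq_fun do rewrite mulN1r.
Qed.

Lemma ccvg_sum (I : Type) (r : seq I) (a : I -> U -> R[i]) (z : I -> R[i]) :
  (forall i, ccvg (a i) (z i)) ->
  ccvg (fun u => \sum_(i <- r) a i u) (\sum_(i <- r) z i).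
Proof.
move=> h; elim: r => [|i r ih].
  by rewrite big_nil; under [X in ccvg X _]eq_fun do rewrite big_nil; exact: ccvg_cst.
rewrite big_cons; under [X in ccvg X _]eq_fun do rewrite big_cons.
exact: ccvgD.
Qed.

Lemma ccvg_sqr a z : ccvg a z -> cabs (a u) ^+ 2 @[u --> F] --> cabs z ^+ 2.
Proof.
move=> /ccvgP[r i]; rewrite cabs_sqr; under eq_cvg do rewrite cabs_sqr !expr2.
by rewrite !expr2; apply: cvgD; apply: cvgM.
Qed.

Lemma ccvg_diff a a' z : ccvg a z -> cabs (a' u - a u) @[u --> F] --> (0 : R) -> ccvg a' z.
Proof.
move=> h h'; have h0 : ccvg (fun u => a' u - a u) 0.
  by rewrite /ccvg; under eq_cvg do rewrite subr0.
have := ccvgD h0 h; rewrite add0r.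
by under [X in ccvg X _]eq_fun do rewrite subrK.
Qed.

End ComplexLimits.

Lemma ccvg_uniq (R : realType) (U : Type) (F : set_system U) {FF : ProperFilter F}
  (a : U -> R[i]) z z' : ccvg F a z -> ccvg F a z' -> z = z'.
Proof.
move=> /ccvgP[r i] /ccvgP[r' i']; apply: complexP.
  exact: (cvg_unique _ r r').
exact: (cvg_unique _ i i').
Qed.

Section L2Limits.
Variables (R : realType) (X : choiceType) (m : X -> R).
Hypothesis hm : forall x, 0 < m x.

Lemma l2_point (f : X -> R[i]) x : summ (lpt m 2 f) ->
  cabs (f x) ^+ 2 * m x <= nsum (lpt m 2 f).
Proof.
by move=> sf; have := point_le_nsum x (lpt_ge0 hm 2 f) sf; rewrite {1}lp2_lpt.
Qed.

(** Points have positive mass, so |f x| <= |f|_2 / sqrt(m x). Limits in l^2 can therefore be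
    evaluated at each point. *)
Lemma l2_cvg_pt (U : Type) (F : set_system U) {FF : Filter F} (h : U -> X -> R[i]) x :
  lpnorm m 2%:E (h u) @[u --> F] --> 0%E -> cabs (h u x) @[u --> F] --> (0 : R).
Proof.
move=> /(cvg0_lpnorm hm (ltr0Sn _ 1)) [s h0].
apply: cvg0_sqrt => [u|]; first exact: cabs_ge0.
have h1 : (m x)^-1 * nsum (lpt m 2 (h u)) @[u --> F] --> (0 : R).
  rewrite -(mulr0 (m x)^-1); apply: cvgM => //; exact: cvg_cst.
apply: cvg0_squeeze h1; near=> u.
rewrite sqr_ge0 /= mulrC ler_pdivlMr //.
by apply: l2_point; near: u.
Unshelve. all: by end_near. Qed.

End L2Limits.

Section FormOperator.
Variables (R : realType) (X : choiceType) (m : X -> R) (b : X -> X -> R).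
Variables (o : X -> X -> R[i]) (c : X -> R).
Hypothesis hm : forall x, 0 < m x.
Hypothesis hb : is_graph b.
Hypothesis ho : is_magnetic_potential o.
Hypothesis hN : forall x, finite_set [set y | 0 < b x y].
Hypothesis hQ : form_positive (schrodinger_form b o c).
Hypothesis hQc : form_closable m (schrodinger_form b o c).

Local Notation Re := complex.Re.
Local Notation Q := (schrodinger_form b o c).
Local Notation A := (form_operator m Q).
Local Notation q := (qre b o c).

Implicit Types (f g h : X -> R[i]) (phi psi : nat -> X -> R[i]).

Lemma q_ge0 f : Cc f -> 0 <= q f.
Proof. by move=> cf; have := hQ cf; rewrite lecE => /andP[_]. Qed.

Lemma cabs_form f : Cc f -> cabs (Q f f) = q f.
Proof. by move=> cf; rewrite cabs_ge0_Re ?hQ. Qed.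

Let subE f g : f - g = (fun x => -1 * g x + f x).
Proof. by apply/funext => x; rewrite mulN1r addrC. Qed.

Lemma Cc_sub f g : Cc f -> Cc g -> Cc (f - g).
Proof. by move=> cf cg; rewrite subE; exact: Cc_lin. Qed.

Lemma form_subl f f' g : Cc f -> Cc f' -> Cc g -> Q (f - f') g = Q f g - Q f' g.
Proof. by move=> *; rewrite subE (form_linl hb ho hN) // mulN1r addrC. Qed.

Lemma form_subr f g g' : Cc f -> Cc g -> Cc g' -> Q f (g - g') = Q f g - Q f g'.
Proof.
by move=> *; rewrite subE (form_linr hb ho hN) // rmorphN rmorph1 mulN1r addrC.
Qed.

(** Parallelogram identity with the nonnegative term q (f + g) dropped. *)
Lemma q_sub f g : Cc f -> Cc g -> q (f - g) <= 2 * q f + 2 * q g.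
Proof.
move=> cf cg.
have cp : Cc (fun x => 1 * g x + f x) by exact: Cc_lin.
have : 0 <= q (fun x => 1 * g x + f x) by exact: q_ge0.
rewrite /qre (form_linl hb ho hN) // !(form_linr hb ho hN) //.
rewrite (form_subl cf cg (Cc_sub cf cg)) !form_subr //.
rewrite rmorph1 !mul1r !(ReD, ReN); lra.
Qed.

Lemma form_approx_sub phi psi f g : form_approx m Q phi f -> form_approx m Q psi g ->
  form_approx m Q (fun n => phi n - psi n) (f - g).
Proof.
move=> [cp hp lp] [cq hq lq]; split.
- by move=> n; exact: Cc_sub.
- move=> e e0; have e4 : 0 < e / 4 by rewrite divr_gt0.
  have [N1 h1] := hp _ e4; have [N2 h2] := hq _ e4.
  exists (maxn N1 N2) => n k; rewrite !geq_max => /andP[n1 n2] /andP[k1 k2].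
  have -> : phi n - psi n - (phi k - psi k) = (phi n - phi k) - (psi n - psi k).
    by apply/funext => x; rewrite !fctE; ring.
  have c1 := Cc_sub (cp n) (cp k); have c2 := Cc_sub (cq n) (cq k).
  rewrite cabs_form; last exact: Cc_sub.
  have := h1 n k n1 k1; have := h2 n k n2 k2; rewrite !cabs_form // => a1 a2.
  by have := q_sub c1 c2; lra.
have two0 : (0 : R) < 2 by [].
have [s1 l1] := cvg0_lpnorm hm two0 lp; have [s2 l2] := cvg0_lpnorm hm two0 lq.
have E n : (phi n - psi n) - (f - g) = fun x => (phi n - f) x + -1 * (psi n - g) x.
  apply/funext => x; rewrite !fctE; ring.
have sn x n : lpt m 2 (fun x => -1 * (psi n - g) x) x = lpt m 2 (psi n - g) x.
  by rewrite lptZ cabsN cabs1 powR1 mul1r.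
apply: (lpnorm_cvg0 hm two0).
  near=> n; rewrite E; apply: summ_lptD => //; first by near: n.
  by apply: summ_lptZ; near: n.
have l3 : powR 2 2 * (nsum (lpt m 2 (phi n - f)) + nsum (lpt m 2 (psi n - g)))
    @[n --> \oo] --> (0 : R).
  rewrite -(mulr0 (powR 2 2)); apply: cvgM; first exact: cvg_cst.
  by rewrite -(addr0 0); exact: cvgD.
apply: cvg0_squeeze l3; near=> n; apply/andP; split.
  by apply: nsum_ge0 => x; exact: lpt_ge0.
have p0 x : 0 <= lpt m 2 (phi n - f) x by exact: lpt_ge0.
have p1 x : 0 <= lpt m 2 (psi n - g) x by exact: lpt_ge0.
have t1 : summ (lpt m 2 (phi n - f)) by near: n.
have t2 : summ (lpt m 2 (psi n - g)) by near: n.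
rewrite -nsumD // -nsumZ ?powR_ge0 //; last by move=> x; rewrite addr_ge0.
apply: le_nsum; last by apply/summZ/summD.
  by move=> x; exact: lpt_ge0.
move=> x; rewrite E -(sn x n); exact: lptD_le.
Unshelve. all: by end_near. Qed.

Lemma lpnorm0 : lpnorm m 2%:E (0 : X -> R[i]) = 0%E.
Proof.
have two0 : (0 : R) < 2 by [].
have [||s e] := @nsum_fsupp R X (lpt m 2 0) fset0.
- exact: lpt_ge0.
- by move=> x _; rewrite /lpt cabs0 powR0 ?mul0r.
by rewrite (lpnormE hm two0 s) e big_seq_fset0 powR0.
Qed.

Lemma form_approx_cst f : Cc f -> form_approx m Q (fun=> f) f.
Proof.
move=> cf; split=> //.
  move=> e e0; exists 0%N => n k _ _; rewrite subrr.
  rewrite (green hb ho hN c (F := fset0)) ?big_seq_fset0 ?cabs0 //.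
  by apply: (@fset_Cc _ _ _ fset0).
rewrite subrr lpnorm0; exact: cvg_cst.
Qed.

Lemma form_approx_bound phi f : form_approx m Q phi f ->
  exists B : R, 0 <= B /\ \forall n \near \oo, q (phi n) <= B.
Proof.
move=> [cp hp _]; have [N hN'] := hp 1 ltr01.
exists (2 + 2 * q (phi N)); split.
  by rewrite addr_ge0 ?mulr_ge0 ?q_ge0.
near=> n.
have nN : (N <= n)%N by near: n; exists N.
have c1 := Cc_sub (cp N) (cp n).
have := hN' N n (leqnn _) nN; rewrite cabs_form // => h1.
have := q_sub (cp N) c1; rewrite opprB addrC subrK; lra.
Unshelve. all: by end_near. Qed.

(** The definition of [closure_value] only asserts that some approximating sequences exist. By
    closability, two approximations of the same function differ by a sequence that vanishes in form,
    and Cauchy-Schwarz with the bounded partner carries this over to the values, so any chosen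
    sequences may be used. *)
Lemma form_approx_uniq phi phi' psi psi' f g z :
  form_approx m Q phi f -> form_approx m Q phi' f ->
  form_approx m Q psi g -> form_approx m Q psi' g ->
  ccvg \oo (fun n => Q (phi n) (psi n)) z -> ccvg \oo (fun n => Q (phi' n) (psi' n)) z.
Proof.
move=> a1 a2 b1 b2 h.
have null f' u v : form_approx m Q u f' -> form_approx m Q v f' ->
    q (u n - v n) @[n --> \oo] --> (0 : R).
  move=> a a'; have ap := form_approx_sub a a'; rewrite subrr in ap.
  have [cuv _ _] := ap.
  have := hQc ap; under eq_cvg do rewrite cabs_form //; exact.
have [B [B0 hB]] := form_approx_bound a1; have [B' [B0' hB']] := form_approx_bound b2.
have [cp _ _] := a1; have [cp' _ _] := a2; have [cs _ _] := b1; have [cs' _ _] := b2.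
apply: ccvg_diff h _.
have t1 : cabs (Q (phi' n - phi n) (psi' n)) @[n --> \oo] --> (0 : R).
  apply: cvg0_sqrt => [u|]; first exact: cabs_ge0.
  have h1 : q (phi' n - phi n) * B' @[n --> \oo] --> (0 : R).
    by rewrite -(mul0r B'); apply: cvgM; [exact: (null f)|exact: cvg_cst].
  apply: cvg0_squeeze h1; near=> n; rewrite sqr_ge0 /=.
  have cd := Cc_sub (cp' n) (cp n).
  apply: le_trans (form_cauchy_schwarz hb ho hN q_ge0 cd (cs' n)) _.
  by rewrite ler_wpM2l ?q_ge0 //; near: n.
have t2 : cabs (Q (phi n) (psi' n - psi n)) @[n --> \oo] --> (0 : R).
  apply: cvg0_sqrt => [u|]; first exact: cabs_ge0.
  have h1 : B * q (psi' n - psi n) @[n --> \oo] --> (0 : R).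
    by rewrite -(mulr0 B); apply: cvgM; [exact: cvg_cst|exact: (null g)].
  apply: cvg0_squeeze h1; near=> n; rewrite sqr_ge0 /=.
  have cd := Cc_sub (cs' n) (cs n).
  apply: le_trans (form_cauchy_schwarz hb ho hN q_ge0 (cp n) cd) _.
  by rewrite ler_wpM2r ?q_ge0 //; near: n.
have t3 : cabs (Q (phi' n - phi n) (psi' n)) + cabs (Q (phi n) (psi' n - psi n))
    @[n --> \oo] --> (0 : R) by rewrite -(addr0 0); exact: cvgD.
apply: cvg0_squeeze t3; apply: nearW => n; rewrite cabs_ge0 /=.
apply: le_trans (cabsD _ _).
by rewrite form_subl // form_subr // addrA subrK.
Unshelve. all: by end_near. Qed.

Lemma form_approx_pt phi f x : form_approx m Q phi f -> ccvg \oo (fun n => phi n x) (f x).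
Proof. by move=> [_ _ h]; exact: (l2_cvg_pt hm x h). Qed.

(** The constant sequence approximates g, and by uniqueness an arbitrary approximation of f may
    stand in the first argument. *)
Lemma operator_form f h phi g : A f h -> Cc g -> form_approx m Q phi f ->
  ccvg \oo (fun n => Q (phi n) g) (dot m h g).
Proof.
move=> [_ _ hA] cg ap; have ag := form_approx_cst cg.
have dg : closure_dom m Q g.
  split; last by exists (fun=> g).
  have [F hF] := Cc_fset cg.
  by apply/lpP => //; exact: (summ_lpt_fsupp hm _ hF).
have [u [v [au av huv]]] := hA _ dg.
exact: (form_approx_uniq au ap av ag huv).
Qed.

Definition delta (y : X) : X -> R[i] := fun x => (x == y)%:R.

Lemma delta_supp y x : x \notin [fset y]%fset -> delta y x = 0.
Proof. by rewrite inE /delta => /negPf ->. Qed.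

Lemma Cc_delta y : Cc (delta y).
Proof. exact: fset_Cc (@delta_supp y). Qed.

Lemma lap_cvg (U : Type) (F : set_system U) {FF : Filter F} (u : U -> X -> R[i]) f x :
  (forall y, ccvg F (fun n => u n y) (f y)) ->
  ccvg F (fun n => lap b o c (u n) x) (lap b o c f x).
Proof.
move=> h; apply: ccvgD; last exact: ccvgZ.
apply: ccvg_sum => y; apply: ccvgZ; apply: ccvgB => //; exact: ccvgZ.
Qed.

(** Tested against the indicator of x, the form reduces by Green's formula to [lap] at x. This is a
    finite sum by local finiteness, hence passes to pointwise limits. *)
Lemma operator_lap f h x : A f h -> lap b o c f x = (m x)%:C * h x.
Proof.
move=> Afh; have [[_ [phi ap]] _ _] := Afh.
have h1 := operator_form Afh (Cc_delta x) ap.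
have [cp _ _] := ap.
have h2 : ccvg \oo (fun n => Q (phi n) (delta x)) (lap b o c f x).
  have -> : (fun n => Q (phi n) (delta x)) = fun n => lap b o c (phi n) x.
    apply/funext => n; rewrite (green hb ho hN c (cp n) (@delta_supp x)) big_seq_fset1.
    by rewrite /delta eqxx rmorph1 mulr1.
  by apply: lap_cvg => y; exact: form_approx_pt.
rewrite (ccvg_uniq h2 h1) (dot_fset _ _ (@delta_supp x)) big_seq_fset1.
by rewrite /delta eqxx rmorph1 mulr1 mulrC.
Qed.

Lemma Cc_lp2 f : Cc f -> lp m 2%:E f.
Proof. by move=> /Cc_fset[F hF]; apply/lpP => //; exact: (summ_lpt_fsupp hm _ hF). Qed.

(** Local finiteness makes [lap] of f finitely supported, hence an element of l^2. In particular the
    indicators lie in the domain, which makes their orbits under the semigroup differentiable. *)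
Lemma operator_Cc f : Cc f -> A f (fun x => ((m x)^-1)%:C * lap b o c f x).
Proof.
move=> cf; have [F hF] := Cc_fset cf.
pose G := (F `|` \bigcup_(x <- F) nbr b x)%fset.
have lG x : x \notin G -> lap b o c f x = 0.
  rewrite /G inE negb_or => /andP[xF xN]; rewrite /lap (hF _ xF) mulr0 addr0.
  apply: big1_seq => y /= yN.
  have [->|b0] := eqVneq (b x y) 0; first by rewrite rmorph0 mul0r.
  rewrite (hF y) ?mulr0 ?subr0 ?mulr0 //; apply: contra xN => yF.
  apply/bigfcupP; exists y; rewrite ?andbT //.
  by apply: contraNT b0 => /(notin_nbr hb hN); rewrite (graph_sym hb) => ->.
pose hh x := ((m x)^-1)%:C * lap b o c f x.
have hG x : x \notin G -> hh x = 0 by move=> /lG e; rewrite /hh e mulr0.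
split.
- by split; [exact: Cc_lp2|exists (fun=> f); exact: form_approx_cst].
- exact/Cc_lp2/(fset_Cc hG).
move=> g [_ [psi ap]]; exists (fun=> f), psi; split=> //; first exact: form_approx_cst.
have [cp _ _] := ap.
have E n : Q f (psi n) = \sum_(x <- G) lap b o c f x * (psi n x)^*.
  have [P hP] := Cc_fset (cp n).
  have h1 : (P `<=` P `|` G)%fset by rewrite fsubsetUl.
  have h2 : (G `<=` P `|` G)%fset by rewrite fsubsetUr.
  rewrite (green hb ho hN c cf hP) (big_fset_incl _ h1) ?(big_fset_incl _ h2) //.
    by move=> x _ /lG ->; rewrite mul0r.
  by move=> x _ /hP ->; rewrite rmorph0 mulr0.
rewrite (dot_fsetl _ _ hG); under eq_cvg do rewrite E.
have -> : \sum_(x <- G) hh x * (g x)^* * (m x)%:C = \sum_(x <- G) lap b o c f x * (g x)^*.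
  apply: eq_bigr => x _; rewrite /hh.
  have mE : ((m x)^-1)%:C * (m x)%:C = 1 :> R[i].
    by rewrite -rmorphM /= mulVf ?rmorph1 // gt_eqF.
  transitivity (((m x)^-1)%:C * (m x)%:C * (lap b o c f x * (g x)^*)); first by ring.
  by rewrite mE mul1r.
apply: ccvg_sum => x; apply: ccvgZ; apply: ccvg_conj; exact: form_approx_pt.
Qed.

Lemma nsum_dot_self f : summ (lpt m 2 f) -> dot m f f = (nsum (lpt m 2 f))%:C.
Proof.
move=> sf; rewrite -csum_nsum; last exact: lpt_ge0.
by congr csum; apply/funext => x; rewrite mulc_conj -rmorphM lp2_lpt.
Qed.

(* If E belonged to the resolvent set, with f = (H - E)^-1 v, Cauchy-Schwarz for
   the form Q - E would give |v|^4 <= <v, f> (Q - E)(v) <= K' |v|^2 (Q - E)(v). *)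
Lemma resolvent_gap (E : R) : 0 <= E ->
  (forall f, Cc f -> E * nsum (lpt m 2 f) <= q f) ->
  resolvent_set m A E%:C ->
  exists2 e : R, 0 < e & forall f, Cc f -> (E + e) * nsum (lpt m 2 f) <= q f.
Proof.
move=> E0 hE [K hK]; have two0 : (0 : R) < 2 by [].
(* The resolvent constant may be negative. The value of K' comes from Re <v, f> <= (|v|^2 + |f|^2) /
   2 together with |f|^2 <= k^2 |v|^2. *)
pose k := Num.max K 0; have k0 : 0 <= k by rewrite le_max lexx orbT.
pose K' := (1 + powR k 2) / 2; have K0 : 0 < K'.
  by rewrite divr_gt0 // ltr_wpDr // powR_ge0.
exists K'^-1; first by rewrite invr_gt0.
move=> v cv; have [F hF] := Cc_fset cv.
have sv : summ (lpt m 2 v) by exact: (summ_lpt_fsupp hm _ hF).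
have lv : lp m 2%:E v by exact: Cc_lp2.
have [f [Af _ nf]] := hK _ lv.
set h := (fun x => v x + _) in Af.
have [sf nfv] : summ (lpt m 2 f) /\ nsum (lpt m 2 f) <= powR k 2 * nsum (lpt m 2 v).
  apply: (le_lpnorm hm) => //; apply: le_trans nf _.
  rewrite lee_wpmul2r ?lee_fin ?le_max ?lexx //.
  by rewrite (lpnormE hm two0 sv) lee_fin powR_ge0.
set Nv := nsum (lpt m 2 v) in nfv *; set Nf := nsum (lpt m 2 f) in nfv *.
have Nv0 : 0 <= Nv by apply: nsum_ge0; exact: lpt_ge0.
pose q' := qre b o (fun x => c x - E * m x).
have q'E g : Cc g -> q' g = q g - E * nsum (lpt m 2 g).
  move=> cg; rewrite /q' /qre (form_shift hb ho hN) // nsum_dot_self.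
    by rewrite -rmorphM ReB.
  by have [P hP] := Cc_fset cg; exact: (summ_lpt_fsupp hm _ hP).
have q'0 g : Cc g -> 0 <= q' g by move=> cg; rewrite q'E // subr_ge0 hE.
have [df _ hA] := Af; have [phi [psi [ap as' hl]]] := hA _ df.
(* The closed form at (f, f) comes with two sequences; uniqueness lets [phi] serve in both
   arguments. *)
have hl' := form_approx_uniq ap ap as' ap hl.
have hv := operator_form Af cv ap.
have [cp _ _] := ap.
have dE : dot m h f = dot m v f + E%:C * (Nf)%:C.
  rewrite -nsum_dot_self // /dot -csumZ; last first.
    apply: csumm_le sf => x; rewrite lp2_lpt !cabsM cabs_conj cabsR.
    by rewrite (gtr0_norm (hm x)) -expr2.
  rewrite -csumD.
  - by congr csum; apply/funext => x; rewrite /h; ring.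
  - by apply: (@csumm_fsupp _ _ _ F) => x /hF ->; rewrite !mul0r.
  - apply: csummZ; apply: csumm_le sf => x; rewrite lp2_lpt !cabsM cabs_conj cabsR.
    by rewrite (gtr0_norm (hm x)) -expr2.
have dvE : dot m h v - E%:C * dot m f v = Nv%:C.
  rewrite -nsum_dot_self // !(dot_fset _ _ hF) mulr_sumr -sumrB.
  by apply: eq_bigr => x _; rewrite /h; ring.
have dvf : Re (dot m v f) <= K' * Nv.
  have : Re (dot m v f) <= (Nv + Nf) / 2.
    have -> : (Nv + Nf) / 2 = nsum (fun x => 2^-1 * (lpt m 2 v x + lpt m 2 f x)).
      rewrite nsumZ ?invr_ge0 //; last by move=> x; rewrite addr_ge0 ?lpt_ge0.
      by rewrite nsumD ?[2^-1 * _]mulrC //; move=> x; exact: lpt_ge0.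
    apply: rsum_le => [x|||].
    - apply: le_trans (ler_norm _) _; apply: le_trans (Re_le_cabs _) _.
      rewrite !lp2_lpt !cabsM cabs_conj cabsR (gtr0_norm (hm x)).
      have := mulr_ge0 (sqr_ge0 (cabs (v x) - cabs (f x))) (ltW (hm x)); lra.
    - apply: csumm_Re; apply: (@csumm_fsupp _ _ _ F) => x /hF ->; by rewrite !mul0r.
    - by move=> x; rewrite mulr_ge0 ?invr_ge0 ?addr_ge0 ?lpt_ge0.
    - by apply/summZ/summD.
  by rewrite /K'; lra.
suff key : Nv ^+ 2 <= K' * Nv * q' v.
  have [Nv1|Nv1] := eqVneq Nv 0; first by rewrite Nv1 mulr0 q_ge0.
  have Nvp : 0 < Nv by rewrite lt_neqAle eq_sym Nv1.
  have : Nv <= K' * q' v by rewrite -(ler_pM2l Nvp); move: key; rewrite expr2; lra.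
  rewrite q'E // -/Nv mulrDl -lerBrDl -(ler_pM2l K0) mulrA mulfV ?mul1r //; exact: lt0r_neq0.
apply/ler_addgt0Pl => e e0.
(* Since phi n is only followed pointwise, |phi n|^2 is bounded below by its part on a finite set P
   carrying |f|^2 up to e'. What is lost in the limit is E e' q' v <= e. *)
pose e' := e / (E * q' v + 1).
have d0 : 0 < E * q' v + 1 by rewrite ltr_wpDl // mulr_ge0 // q'0.
have e'0 : 0 < e' by rewrite divr_gt0.
have [P hP] := summ_tail (lpt_ge0 hm 2 f) sf e'0.
have NfP : Nf <= \sum_(x <- P) lpt m 2 f x + e'.
  by rewrite /Nf (nsum_split P (lpt_ge0 hm 2 f) sf) lerD2l ltW.
have lhs : cabs (Q (phi n) v - E%:C * dot m (phi n) v) ^+ 2 @[n --> \oo] --> Nv ^+ 2.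
  have -> : Nv ^+ 2 = cabs (Nv%:C : R[i]) ^+ 2 by rewrite ger0_cabsR.
  apply: ccvg_sqr; rewrite -dvE; apply: ccvgB hv _; apply: ccvgZ.
  rewrite (dot_fset _ _ hF); under [X in ccvg _ X _]eq_fun do rewrite (dot_fset _ _ hF).
  apply: ccvg_sum => x.
  by apply: ccvgM (ccvg_cst _); apply: ccvgM (ccvg_cst _); exact: form_approx_pt.
have rhs : (q (phi n) - E * \sum_(x <- P) lpt m 2 (phi n) x) * q' v @[n --> \oo] -->
    (Re (dot m h f) - E * \sum_(x <- P) lpt m 2 f x) * q' v.
  apply: cvgM; last exact: cvg_cst.
  apply: cvgB; first by have /ccvgP[] := hl'.
  apply: cvgM; first exact: cvg_cst.
  apply: cvg_sumr => x; rewrite !lp2_lpt; under eq_cvg do rewrite lp2_lpt.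
  apply: cvgM; last exact: cvg_cst.
  by apply: ccvg_sqr; exact: form_approx_pt.
have le1 : Nv ^+ 2 <= (Re (dot m h f) - E * \sum_(x <- P) lpt m 2 f x) * q' v.
  apply: (ler_cvg_to lhs rhs); apply: nearW => n.
  rewrite -(form_shift hb ho hN) //.
  apply: le_trans (form_cauchy_schwarz hb ho hN q'0 (cp n) cv) _.
  rewrite ler_wpM2r ?q'0 // -/q' q'E // lerB // ler_wpM2l //.
  apply: fset_le_nsum; first exact: lpt_ge0.
  by have [G hG] := Cc_fset (cp n); exact: (summ_lpt_fsupp hm _ hG).
have dER : Re (dot m h f) = Re (dot m v f) + E * Nf by rewrite dE ReD ReZ.
apply: le_trans le1 _; rewrite dER.
have qv0 := q'0 _ cv.
have st : Re (dot m v f) + E * Nf - E * \sum_(x <- P) lpt m 2 f x <= K' * Nv + E * e'.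
  have : E * Nf <= E * (\sum_(x <- P) lpt m 2 f x + e') by rewrite ler_wpM2l.
  lra.
have := ler_wpM2r qv0 st.
have : E * q' v * e' <= e.
  rewrite /e' mulrA ler_pdivrMr // mulrC ler_wpM2l ?(ltW e0) // lerDl //.
lra.
Qed.

(** Let E be the largest constant with E |g|^2 <= Q(g) for finitely supported g. Were E in the
    resolvent set, [resolvent_gap] would yield a larger one. Hence E is in the spectrum and the
    bottom of the spectrum is at most E. *)
Lemma spectrum_bottom_le f : Cc f ->
  spectrum_bottom m A * nsum (lpt m 2 f) <= q f.
Proof.
move=> cf; set N := nsum _.
have N0 : 0 <= N by apply: nsum_ge0; exact: lpt_ge0.
have [N1|N1] := eqVneq N 0; first by rewrite N1 mulr0 q_ge0.
have Np : 0 < N by rewrite lt_neqAle eq_sym N1.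
pose S := [set r : R | forall g, Cc g -> r * nsum (lpt m 2 g) <= q g].
have S0 : S 0 by move=> g cg; rewrite mul0r q_ge0.
have Sub g : Cc g -> 0 < nsum (lpt m 2 g) -> ubound S (q g / nsum (lpt m 2 g)).
  by move=> cg ng r Sr; rewrite ler_pdivlMr // Sr.
have hS : has_sup S by split; [exists 0|exists (q f / N); exact: Sub].
pose E := sup S.
have E0 : 0 <= E by exact: (sup_ubound (proj2 hS)).
have SE : S E.
  move=> g cg; have [n0|n0] := eqVneq (nsum (lpt m 2 g)) 0; first by rewrite n0 mulr0 q_ge0.
  have np : 0 < nsum (lpt m 2 g).
    by rewrite lt_neqAle eq_sym n0 nsum_ge0 //; exact: lpt_ge0.
  by rewrite -ler_pdivlMr //; apply: sup_le_ub; [exists 0|exact: Sub].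
have specE : spectrum m A E%:C.
  move=> res; have [e e0 he] := resolvent_gap E0 SE res.
  have : E + e <= E by exact: (sup_ubound (proj2 hS)).
  by rewrite gerDl leNgt e0.
suff : spectrum_bottom m A <= E.
  move=> h; apply: le_trans (SE _ cf); by rewrite ler_wpM2r.
rewrite /spectrum_bottom; set I := [set _ | _].
(* Without an infimum, [inf] has the default value 0, which is still at most E. *)
have [hI|hI] := pselect (has_inf I); last by rewrite inf_out.
by apply: ge_inf => //; case: hI.
Qed.

End FormOperator.

(** * The semigroup and its kernel *)

Section RightDerivative.
Variable R : realType.

(** Stated for right derivatives because these are what the generator provides. With slack e in the
    slope, G has a negative right derivative at every t < T. At the supremum tau of the times up to
    which G <= 0, continuity gives G tau <= 0, and the derivative pushes beyond tau unless tau =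
    T. *)
Lemma right_derivative_le (F : R -> R) (B T : R) : 0 <= T ->
  (forall t, 0 <= t <= T -> F u @[u --> within [set u | 0 <= u] (nbhs t)] --> F t) ->
  (forall t, 0 <= t < T -> exists2 v, v <= B &
     h^-1 * (F (t + h) - F t) @[h --> 0^'+] --> v) ->
  F T <= F 0 + B * T.
Proof.
move=> T0 cF dF; apply/ler_addgt0Pr => e0 e00.
pose e := e0 / (T + 1); have e_gt0 : 0 < e by rewrite divr_gt0 // ltr_wpDl.
pose G t := F t - F 0 - (B + e) * t.
suff : G T <= 0.
  have : e * T <= e0 by rewrite /e mulrAC ler_pdivrMr ?ltr_wpDl // ler_wpM2l ?lerDl // ltW.
  rewrite /G; lra.
have G0 : G 0 = 0 by rewrite /G mulr0 subrr subr0.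
have cG t : 0 <= t <= T -> G u @[u --> within [set u | 0 <= u] (nbhs t)] --> G t.
  move=> ht; apply: cvgB; first by apply: cvgB; [exact: cF|exact: cvg_cst].
  apply: cvgM; first exact: cvg_cst.
  by apply: cvg_within_filter; exact: cvg_id.
pose S := [set t | 0 <= t <= T /\ forall s, 0 <= s <= t -> G s <= 0].
have S0 : S 0.
  split; first by rewrite lexx.
  by move=> s; rewrite -eq_le => /eqP <-; rewrite G0.
have hS : has_sup S by split; [exists 0|exists T => t [/andP[]]//].
pose tau := sup S.
have tau0 : 0 <= tau by exact: (sup_ubound (proj2 hS)).
have tauT : tau <= T by apply: sup_le_ub; [exists 0|move=> t [/andP[]]//].
have below s : 0 <= s < tau -> G s <= 0.
  move=> /andP[s0 st]; have ts : 0 < tau - s by rewrite subr_gt0.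
  have [t [_ ht]] := sup_adherent ts hS; rewrite -/tau => h.
  by apply: ht; rewrite s0; lra.
have Gtau : G tau <= 0.
  have [t0|t0] := eqVneq tau 0; first by rewrite t0 G0.
  rewrite leNgt; apply/negP => Gp.
  have tp : 0 < tau by rewrite lt_neqAle eq_sym t0.
  have tt : 0 <= tau <= T by rewrite tau0.
  have := cG _ tt; move=> /cvgr_gt /(_ _ Gp); rewrite near_withinE.
  move=> /nbhs_ballP[r /= r0 hr].
  (* A time in [0, tau) close enough to tau for G to be positive there, against [below]. *)
  pose s := Num.max 0 (tau - r / 2).
  have sm : s < tau by rewrite gt_max tp /=; lra.
  have s0 : 0 <= s by rewrite le_max lexx.
  have : 0 < G s.
    apply: hr => //; rewrite /ball /= ger0_norm; last by rewrite subr_ge0 ltW.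
    have : tau - r / 2 <= s by rewrite le_max lexx orbT.
    lra.
  by rewrite ltNge below // s0.
have Stau : S tau.
  split; first by rewrite tau0.
  move=> s /andP[s0]; rewrite le_eqVlt => /orP[/eqP -> //|st].
  by apply: below; rewrite s0.
have [-> //|tT] := eqVneq T tau.
have tltT : tau < T by rewrite lt_neqAle eq_sym tT.
have [|v vB hv] := dF tau; first by rewrite tau0.
exfalso.
have : v < B + e by lra.
move=> /(cvgr_lt v hv) [r /= r0 hr].
pose h := Num.min (r / 2) (T - tau).
have h0 : 0 < h by rewrite lt_min divr_gt0 // subr_gt0.
have hr2 : h <= r / 2 by rewrite ge_min lexx.
have hT : h <= T - tau by rewrite ge_min lexx orbT.
have : S (tau + h).
  split; first by apply/andP; split; lra.
  move=> s /andP[s0 sh]; have [st|st] := leP s tau.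
    by case: Stau => _; apply; rewrite s0.
  have k0 : 0 < s - tau by rewrite subr_gt0.
  have := hr (s - tau); rewrite /ball /= sub0r normrN gtr0_norm //.
  have -> : s - tau < r by lra.
  move=> /(_ isT k0); rewrite (addrC tau) subrK mulrC ltr_pdivrMr // => hh.
  have := Gtau; rewrite /G; lra.
move=> /(sup_ubound (proj2 hS)); rewrite -/tau; lra.
Qed.

Lemma expR_right_derivative (k t : R) :
  h^-1 * (expR (k * (t + h)) - expR (k * t)) @[h --> 0^'+] --> k * expR (k * t).
Proof.
have d : is_derive t 1 (fun x => expR (k * x)) (expR (k * t) * k).
  have d1 : is_derive t 1 (fun x : R => k * x) k.
    have := @is_deriveZ _ _ _ (@id R) k t 1 1 (is_derive_id t 1).
    by rewrite /GRing.scale /= mulr1.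
  exact: (@is_derive1_comp _ expR (fun x => k * x)).
have [h e] := d; rewrite [k * expR _]mulrC -e; apply: cvg_dnbhs_at_right.
have : (fun h : R => h^-1 *: (((fun x => expR (k * x)) \o shift t) (h *: 1) - expR (k * t)))
  @ 0^' --> 'D_1 (fun x => expR (k * x)) t by exact: h.
apply: cvg_trans; apply: near_eq_cvg; apply: nearW => u /=.
by rewrite /GRing.scale /= mulr1 (addrC t u).
Qed.

Lemma at_right_shift (t : R) : 0 <= t ->
  (t + h @[h --> 0^'+]) `=>` within [set u | 0 <= u] (nbhs t).
Proof.
move=> t0 P /= /nbhs_ballP[r /= r0 hr]; exists r => //= h.
rewrite /ball /= sub0r normrN => hr' h0; apply: hr; last by rewrite /= addr_ge0 // ltW.
by rewrite /ball /= opprD addrA subrr sub0r normrN.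
Qed.

End RightDerivative.

Lemma cvg0Zl (R : realType) (U : Type) (F : set_system U) {FF : Filter F} (k : R)
  (f : U -> R) : f u @[u --> F] --> (0 : R) -> k * f u @[u --> F] --> (0 : R).
Proof.
move=> f0; have : k * f u @[u --> F] --> k * 0 by apply: cvgM => //; exact: cvg_cst.
by rewrite mulr0.
Qed.

(** * The strongly continuous semigroup on l^2 *)

Section Semigroup.
Variables (R : realType) (X : choiceType) (m : X -> R).
Hypothesis hm : forall x, 0 < m x.
Variable A : (X -> R[i]) -> (X -> R[i]) -> Prop.
Variable S : R -> (X -> R[i]) -> X -> R[i].
Hypothesis hS : exp_semigroup m A S.

Local Notation Re := complex.Re.
Local Notation N f := (nsum (lpt m 2 f)).

Implicit Types (t u T : R) (f g h : X -> R[i]) (x : X).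

Let two0 : (0 : R) < 2. Proof. by []. Qed.

Lemma semigroup_lin t (a : R[i]) f g : 0 <= t -> lp m 2%:E f -> lp m 2%:E g ->
  S t (fun x => a * f x + g x) = (fun x => a * S t f x + S t g x).
Proof. by move=> t0 lf lg; have [[[h _ _] _] _] := hS; have [e _] := h t t0; exact: e. Qed.

Lemma semigroup_bound t : 0 <= t -> exists2 K : R, 0 <= K &
  forall f, summ (lpt m 2 f) -> summ (lpt m 2 (S t f)) /\ N (S t f) <= K * N f.
Proof.
move=> t0; have [[[h _ _] _] _] := hS; have [_ [K K0 hK]] := h t t0.
exists (powR K 2); first exact: powR_ge0.
by move=> f sf; apply: (le_lpnorm hm) => //; apply: hK; apply/(lpP hm).
Qed.

Lemma semigroup_lp t f : 0 <= t -> lp m 2%:E f -> lp m 2%:E (S t f).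
Proof.
move=> t0 /(lpP hm _ two0) sf; apply/(lpP hm _ two0).
by have [K _ h] := semigroup_bound t0; have [] := h f sf.
Qed.

Lemma semigroupD t u f : 0 <= t -> 0 <= u -> lp m 2%:E f -> S (t + u) f = S t (S u f).
Proof. by move=> t0 u0 lf; have [[[_ _ h] _] _] := hS; exact: h. Qed.

Lemma semigroup0 f : lp m 2%:E f -> S 0 f = f.
Proof. by move=> lf; have [[[_ h _] _] _] := hS; exact: h. Qed.

Lemma semigroup_cvg t f : 0 <= t -> lp m 2%:E f ->
  lpnorm m 2%:E (S u f - S t f) @[u --> within [set u | 0 <= u] (nbhs t)] --> 0%E.
Proof. by move=> t0 lf; have [[_ h] _] := hS; exact: h. Qed.

Lemma semigroup_cvg_pt t f x : 0 <= t -> lp m 2%:E f ->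
  ccvg (within [set u | 0 <= u] (nbhs t)) (fun u => S u f x) (S t f x).
Proof. by move=> t0 lf; exact: (l2_cvg_pt hm x (semigroup_cvg t0 lf)). Qed.

Lemma lp_lin (a : R[i]) f g : lp m 2%:E f -> lp m 2%:E g ->
  lp m 2%:E (fun x => a * f x + g x).
Proof.
move=> /(lpP hm _ two0) sf /(lpP hm _ two0) sg; apply/(lpP hm _ two0).
by apply: (summ_lptD hm) => //; exact: summ_lptZ.
Qed.

(** The semigroup commutes with its generator: the error of the difference quotient of S t f is S t
    applied to that of f, and S t is bounded. *)
Lemma operator_semigroup t f h : 0 <= t -> A f h -> A (S t f) (S t h).
Proof.
move=> t0 /(proj2 hS) [lf lh cv]; apply/(proj2 hS); split; try exact: semigroup_lp.
have [K K0 hK] := semigroup_bound t0.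
have [s1 c1] := cvg0_lpnorm hm two0 cv.
pose D (u : R) := fun x => (u^-1)%:C * (f x - S u f x) - h x.
change (\forall u \near 0^'+, summ (lpt m 2 (D u))) in s1.
change (N (D u) @[u --> 0^'+] --> (0 : R)) in c1.
have E (u : R) : 0 < u ->
   (fun x => u^-1%:C * (S t f x - S u (S t f) x) - S t h x) = S t (D u).
  move=> u0; have u0' := ltW u0.
  have lSu : lp m 2%:E (S u f) by exact: semigroup_lp.
  (* Linearity is available only for combinations of the form a f + g, hence this nesting with a
     zero summand at the end; S t of 0 is then found by applying linearity to -1 * 0 + 0. *)
  have -> : D u = fun x => (u^-1)%:C * (-1 * S u f x + f x) + (-1 * h x + 0 * h x).
    by apply/funext => x; rewrite /D; ring.
  have l1 : lp m 2%:E (fun x => -1 * S u f x + f x) by exact: lp_lin.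
  have l0 : lp m 2%:E (fun x => 0 * h x).
    by apply/(lpP hm _ two0)/summ_lptZ/(lpP hm _ two0).
  have l2 : lp m 2%:E (fun x => -1 * h x + 0 * h x) by exact: lp_lin.
  have S0h : S t (fun x => 0 * h x) = fun x => 0.
    have := semigroup_lin (-1) t0 l0 l0.
    have -> : (fun x => -1 * (0 * h x) + 0 * h x) = fun x => 0 * h x.
      by apply/funext => x; ring.
    by move=> ->; apply/funext => x; ring.
  rewrite !semigroup_lin // S0h -semigroupD // (addrC u) semigroupD //.
  by apply/funext => x; ring.
have c2 : K * N (D u) @[u --> 0^'+] --> (0 : R).
  exact: cvg0Zl.
apply: (lpnorm_cvg0 hm two0).
  near=> u; have u0 : 0 < u by near: u; exact: nbhs_right_gt.
  by rewrite E //; apply: (hK _ _).1; near: u.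
apply: cvg0_squeeze c2; near=> u.
have u0 : 0 < u by near: u; exact: nbhs_right_gt.
rewrite E //; apply/andP; split; first by apply: nsum_ge0 => x; exact: lpt_ge0.
by apply: (hK _ _).2; near: u.
Unshelve. all: by end_near. Qed.

Lemma semigroup_derivative t f h x : 0 <= t -> A f h ->
  ccvg 0^'+ (fun u => (u^-1)%:C * (S (t + u) f x - S t f x)) (- S t h x).
Proof.
move=> t0 Afh; have [lf lh cv] := (proj2 hS _ _).1 (operator_semigroup t0 Afh).
have [lf' _ _] := (proj2 hS _ _).1 Afh.
have cv' := l2_cvg_pt (F := 0^'+) hm x cv; rewrite /ccvg.
apply: (cvg0_squeeze _ (cv' _)); near=> u.
have u0 : 0 <= u by apply: ltW; near: u; exact: nbhs_right_gt.
rewrite cabs_ge0 /= -cabsN (addrC t) semigroupD // le_eqVlt.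
by apply/orP; left; apply/eqP; congr cabs; ring.
Unshelve. all: by end_near. Qed.

(** Strong continuity bounds |S u f|^2 near each t. The local bound holds for all large B, so
    compactness of [0, T], as a near-covering property against the filter of large B, gives one B
    for the interval. *)
Lemma semigroup_locally_bounded T f : lp m 2%:E f ->
  exists B : R, forall t, 0 <= t <= T -> N (S t f) <= B.
Proof.
move=> lf; have sf t : 0 <= t -> summ (lpt m 2 (S t f)).
  by move=> t0; apply/(lpP hm _ two0)/semigroup_lp.
have cT : near_covering [set` `[0, T]].
  by apply/compact_near_coveringP; exact: segment_compact.
pose P (B t : R) := 0 <= t -> N (S t f) <= B.
suff /filter_ex[B hB] : \forall B \near pinfty_nbhs R, [set` `[0, T]] `<=` P B.
  by exists B => t ht; have /andP[t0 tT] := ht; apply: hB => //=; rewrite in_itv /=.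
apply: cT => t /=.
rewrite in_itv /= => /andP[t0 _].
  have [s1 c1] := cvg0_lpnorm hm two0 (semigroup_cvg t0 lf).
  have h1 : \forall u \near within [set u | 0 <= u] (nbhs t),
     summ (lpt m 2 (S u f - S t f)) /\ N (S u f - S t f) < 1.
    by near=> u; split; near: u => //; exact: cvgr_lt c1 _ ltr01.
  rewrite near_withinE in h1.
  exists ([set u | 0 <= u -> summ (lpt m 2 (S u f - S t f)) /\ N (S u f - S t f) < 1],
     [set B | powR 2 2 * (1 + N (S t f)) <= B]).
    split=> //=; apply: nbhs_pinfty_ge; exact: num_real.
  move=> [u B] /= [hu hB] u0; have [su nu] := hu u0.
  apply: le_trans hB.
  have p0 x : 0 <= lpt m 2 (S u f - S t f) x by exact: lpt_ge0.
  have p1 x : 0 <= lpt m 2 (S t f) x by exact: lpt_ge0.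
  have : N (S u f) <= powR 2 2 * (N (S u f - S t f) + N (S t f)).
    have st := sf t t0; rewrite -nsumD // -nsumZ ?powR_ge0 //; last by move=> x; rewrite addr_ge0.
    apply: le_nsum; last by apply/summZ/summD => //; exact: sf.
      by move=> x; exact: lpt_ge0.
    move=> x; have := lptD_le hm (S u f - S t f) (S t f) x (ltW two0).
    by rewrite (_ : (fun x => _) = S u f) //; apply/funext => y; rewrite !fctE subrK.
  move=> h; apply: le_trans h _; rewrite ler_wpM2l ?powR_ge0 // lerD2r ltW //.
Unshelve. all: by end_near. Qed.

End Semigroup.

(** * Davies' estimate for the kernel of the semigroup *)

Section DaviesKernelBound.
Variables (R : realType) (X : choiceType) (m : X -> R) (b : X -> X -> R).
Variables (o : X -> X -> R[i]) (c : X -> R) (S : R -> (X -> R[i]) -> X -> R[i]).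
Variables (d : X -> X -> R) (s bet lam : R).
Hypothesis hm : forall x, 0 < m x.
Hypothesis hb : is_graph b.
Hypothesis ho : is_magnetic_potential o.
Hypothesis hN : forall x, finite_set [set y | 0 < b x y].
Hypothesis hQ : form_positive (schrodinger_form b o c).
Hypothesis hQc : form_closable m (schrodinger_form b o c).
Hypothesis hS : exp_semigroup m (form_operator m (schrodinger_form b o c)) S.
Hypothesis hd : is_intrinsic_metric m b d.
Hypothesis hball : forall x (r : R), exists F : {fset X}, forall y, d x y <= r -> y \in F.
Hypothesis s0 : 0 < s.
Hypothesis hs : forall x y, 0 < b x y -> d x y <= s.
Hypothesis bet0 : 0 < bet.
Hypothesis hlam : forall phi, Cc phi -> lam * nsum (lpt m 2 phi) <= qre b o c phi.

Implicit Types (t h v r B T : R).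

Local Notation Re := complex.Re.
Local Notation N f := (nsum (lpt m 2 f)).

Let Cb := (s ^+ 2)^-1 * (cosh (bet * s) - 1).
Let a := Cb - lam.

Section FixedPoints.
Variables (x0 y0 : X).

Let W (x : X) := expR (- bet * d x x0).
Let u (t : R) := S t (delta R y0).

Let dp : is_pseudo_metric d. Proof. by case: hd. Qed.
Let two0 : (0 : R) < 2. Proof. by []. Qed.
Let ld : lp m 2%:E (delta R y0). Proof. exact/(Cc_lp2 hm)/Cc_delta. Qed.
Let su t : 0 <= t -> summ (lpt m 2 (u t)).
Proof. by move=> t0; apply/(lpP hm _ two0); apply: (semigroup_lp hm hS). Qed.

Let W0 x : 0 < W x. Proof. exact: expR_gt0. Qed.
Let Wx0 : W x0 = 1. Proof. by rewrite /W pmetric_refl // mulr0 expR0. Qed.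

Section Cutoff.
Variables (eps : R) (F : {fset X}).
Hypothesis e0 : 0 < eps.
Let eta (x : X) := Num.max (W x - eps) 0.
Hypothesis hF : forall x, x \notin F -> eta x = 0.

Let I (t : R) := \sum_(x <- F) eta x ^+ 2 * lpt m 2 (u t) x.

Let I_cvg t : 0 <= t -> I v @[v --> within [set v | 0 <= v] (nbhs t)] --> I t.
Proof.
move=> t0; apply: cvg_sumr => x; apply: cvgM; first exact: cvg_cst.
rewrite !lp2_lpt; under eq_cvg do rewrite lp2_lpt.
apply: cvgM; last exact: cvg_cst.
apply: ccvg_sqr; exact: (semigroup_cvg_pt hm hS x t0 ld).
Qed.

Let dI (t : R) := - (2 * \sum_(x <- F) eta x ^+ 2 * Re (lap b o c (u t) x * (u t x)^*)).

(* With w = u (t + h) x and v = u t x, |w|^2 - |v|^2 = Re ((w - v) conj (w + v)). *)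
Let I_derivative t : 0 <= t -> h^-1 * (I (t + h) - I t) @[h --> 0^'+] --> dI t.
Proof.
move=> t0; pose hh x := ((m x)^-1)%:C * lap b o c (delta R y0) x.
have Ad := operator_Cc c hm hb ho hN (Cc_delta R y0).
have lapE x : lap b o c (u t) x = (m x)%:C * S t hh x.
  exact: (operator_lap hm hb ho hN hQ hQc x (operator_semigroup hm hS t0 Ad)).
have E h : h^-1 * (I (t + h) - I t) = \sum_(x <- F) eta x ^+ 2 *
    (Re ((h^-1)%:C * (u (t + h) x - u t x) * (u (t + h) x + u t x)^*) * m x).
  rewrite /I -sumrB mulr_sumr; apply: eq_bigr => x _.
  rewrite !lp2_lpt !cabs_sqr -mulrA ReZ ReM ReB ImB Re_conj Im_conj ReD ImD; ring.
under eq_cvg do rewrite E.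
rewrite /dI mulr_sumr -sumrN.
apply: cvg_sumr => x.
have -> : - (2 * (eta x ^+ 2 * Re (lap b o c (u t) x * (u t x)^*))) =
  eta x ^+ 2 * (Re (- S t hh x * (u t x + u t x)^*) * m x).
  rewrite lapE -mulrA ReZ !ReM ReN ImN !Re_conj !Im_conj ReD ImD; ring.
apply: cvgM; first exact: cvg_cst.
apply: cvgM; last exact: cvg_cst.
have h1 := semigroup_derivative hm hS x t0 Ad.
suff h2 : ccvg 0^'+ (fun h => u (t + h) x) (u t x).
  have : ccvg 0^'+ (fun h => (h^-1)%:C * (u (t + h) x - u t x) * (u (t + h) x + u t x)^*)
      (- S t hh x * (u t x + u t x)^*).
    by apply: ccvgM => //; apply: ccvg_conj; apply: ccvgD => //; exact: ccvg_cst.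
  by move=> /ccvgP[].
have h3 := semigroup_cvg_pt hm hS x t0 ld.
exact: (cvg_trans (cvg_app _ (at_right_shift t0)) h3).
Qed.

(** Gronwall's argument: [davies_form] bounds the right derivative of e^(-2at) I(t) by e^(-2at)
    times 4 eps Cb |u(t)|^2. As the sign of a is unknown, e^(-2at) is bounded by e^(2|a|T). At time
    0 only y0 contributes. *)
Let cutoff_bound T B : 0 <= T -> (forall t, 0 <= t <= T -> N (u t) <= B) ->
  expR (- 2 * a * T) * I T <= W y0 ^+ 2 * m y0 + eps * (4 * Cb * B * expR (2 * `|a| * T) * T).
Proof.
move=> T0 hB.
have Cb0 : 0 <= Cb by exact: Cb_ge0.
have B0 : 0 <= B.
  apply: le_trans (hB 0 _); last by rewrite lexx.
  by apply: nsum_ge0 => x; exact: lpt_ge0.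
pose k := - 2 * a.
pose G (t : R) := expR (k * t) * I t.
have expR_cvg t : expR (k * v) @[v --> within [set v | 0 <= v] (nbhs t)] --> expR (k * t).
  apply: cvg_within_filter; apply: continuous_cvg; first exact: continuous_expR.
  by apply: cvgM; [exact: cvg_cst|exact: cvg_id].
have I0 : I 0 <= W y0 ^+ 2 * m y0.
  rewrite /I /u (semigroup0 hS ld).
  have etaW x : eta x ^+ 2 <= W x ^+ 2.
    have := W0 x; rewrite /eta; case: (leP (W x - eps) 0) => ? w; first by rewrite expr0n sqr_ge0.
    have h1 : 0 <= W x - eps by exact: ltW.
    by rewrite ler_sqr ?nnegrE ?(ltW (W0 x)) // gerBl ltW.
  have nn x : 0 <= eta x ^+ 2 * lpt m 2 (delta R y0) x.
    by rewrite mulr_ge0 ?sqr_ge0 ?lpt_ge0.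
  have z x : x \notin [fset y0]%fset -> eta x ^+ 2 * lpt m 2 (delta R y0) x = 0.
    by move=> /(@delta_supp R) e; rewrite lp2_lpt e cabs0 expr0n mul0r mulr0.
  have [sm e] := nsum_fsupp nn z.
  apply: le_trans (fset_le_nsum F nn sm) _; rewrite e big_seq_fset1 lp2_lpt /delta eqxx.
  by rewrite cabs1 expr1n mul1r ler_wpM2r // ltW.
have D t : 0 <= t < T -> exists2 v, v <= eps * (4 * Cb * B * expR (2 * `|a| * T)) &
     h^-1 * (G (t + h) - G t) @[h --> 0^'+] --> v.
  move=> /andP[t0 tT].
  exists (expR (k * t) * dI t + k * expR (k * t) * I t).
    have := davies_form hm hb ho hN hd s0 hs bet0 hlam (ltW e0) (su t0) hF.
    rewrite -/(eta _) -/(I t) -/Cb => dv.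
    have dv' : dI t + k * I t <= 4 * eps * Cb * N (u t).
      by move: dv; rewrite /dI /k /a /I /eta; lra.
    have -> : expR (k * t) * dI t + k * expR (k * t) * I t = expR (k * t) * (dI t + k * I t) by ring.
    have Nt : N (u t) <= B by apply: hB; rewrite t0 ltW.
    have eT : expR (k * t) <= expR (2 * `|a| * T).
      have h1 : - a <= `|a| by rewrite -normrN ler_norm.
      have h2 := ler_wpM2r t0 h1; have h3 := ler_wpM2l (normr_ge0 a) (ltW tT).
      by rewrite ler_expR /k; lra.
    have p1 : 0 <= 4 * eps * Cb by apply: mulr_ge0 => //; apply: mulr_ge0 => //; exact: ltW.
    have : expR (k * t) * (dI t + k * I t) <= expR (k * t) * (4 * eps * Cb * B).
      by rewrite ler_wpM2l ?expR_ge0 // (le_trans dv') // ler_wpM2l.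
    move=> /le_trans; apply.
    have := ler_wpM2r (mulr_ge0 p1 B0) eT; lra.
  have shift : I (t + h) @[h --> 0^'+] --> I t.
    exact: (cvg_trans (cvg_app I (at_right_shift t0)) (I_cvg t0)).
  have E h : h^-1 * (G (t + h) - G t) = expR (k * t) * (h^-1 * (I (t + h) - I t)) +
     h^-1 * (expR (k * (t + h)) - expR (k * t)) * I (t + h) by rewrite /G; ring.
  under eq_cvg do rewrite E.
  apply: cvgD; first by apply: cvgM; [exact: cvg_cst|exact: I_derivative].
  by apply: cvgM => //; exact: expR_right_derivative.
have := right_derivative_le T0 _ D.
rewrite /G mulr0 expR0 mul1r => h.
apply: le_trans (h _) _.
  move=> t /andP[t0 _]; apply: cvgM; [exact: expR_cvg|exact: I_cvg].
by apply: lerD => //; rewrite -mulrA.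
Qed.

(** Of the sum I(T) only the term at x0 is kept, where W = 1 and hence eta = 1 - eps. *)
Lemma cutoff_point T B : 0 <= T -> eps < 1 -> (forall t, 0 <= t <= T -> N (u t) <= B) ->
  (1 - eps) ^+ 2 * (expR (- 2 * a * T) * (cabs (u T x0) ^+ 2 * m x0)) <=
  W y0 ^+ 2 * m y0 + eps * (4 * Cb * B * expR (2 * `|a| * T) * T).
Proof.
move=> T0 e1 hB; apply: le_trans (cutoff_bound T0 hB).
rewrite mulrCA ler_wpM2l ?expR_ge0 //.
have x0F : x0 \in F.
  apply/negPn/negP => /hF; rewrite /eta Wx0 max_l ?subr_ge0 ?(ltW e1) //; lra.
have nn x : 0 <= eta x ^+ 2 * lpt m 2 (u T) x by rewrite mulr_ge0 ?sqr_ge0 ?lpt_ge0.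
rewrite /I (big_fsetD1 x0) //= {1}/eta Wx0 max_l ?subr_ge0 ?(ltW e1) // lp2_lpt.
by rewrite lerDl sumr_ge0 // => i _; have := nn i; rewrite lp2_lpt.
Qed.

End Cutoff.

Lemma semigroup_kernel_sqr T : 0 <= T ->
  cabs (u T x0) ^+ 2 * m x0 <= expR (2 * a * T) * (W y0 ^+ 2 * m y0).
Proof.
move=> T0; set Z := _ * m x0; set V := W y0 ^+ 2 * m y0.
have Z0 : 0 <= Z by rewrite mulr_ge0 ?sqr_ge0 // ltW.
suff : expR (- 2 * a * T) * Z <= V.
  move=> h; have := ler_wpM2l (expR_ge0 (2 * a * T)) h.
  by rewrite mulrA -expRD (_ : _ + _ = 0) ?expR0 ?mul1r //; ring.
have [B hB] := semigroup_locally_bounded hm hS T ld.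
set Z' := expR _ * Z; have Z'0 : 0 <= Z' by rewrite mulr_ge0 ?expR_ge0.
pose K := 4 * Cb * B * expR (2 * `|a| * T) * T.
have B0 : 0 <= B.
  apply: le_trans (hB 0 _); last by rewrite lexx.
  by apply: nsum_ge0 => x; exact: lpt_ge0.
have Cb0 : 0 <= Cb by exact: Cb_ge0.
have K0 : 0 <= K.
  apply: mulr_ge0 => //; apply: mulr_ge0; last exact: expR_ge0.
  by apply: mulr_ge0 => //; apply: mulr_ge0.
apply/ler_addgt0Pr => e e0.
(* As (1 - eps)^2 >= 1 - 2 eps, the total error is at most eps (2 Z' + K) <= e. *)
pose eps := Num.min (2^-1) (e / (2 * Z' + K + 1)).
have D0 : 0 < 2 * Z' + K + 1 by lra.
have eps0 : 0 < eps by rewrite lt_min invr_gt0 divr_gt0 //=; lra.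
have eps1 : eps <= 2^-1 by rewrite ge_min lexx.
have eps2 : eps * (2 * Z' + K + 1) <= e by rewrite -ler_pdivlMr // ge_min lexx orbT.
(* Outside this ball W falls below eps, so eta is supported in a finite set. *)
have [F hF] := hball x0 (- ln eps / bet).
have hF' x : x \notin F -> Num.max (W x - eps) 0 = 0.
  move=> xF; apply: max_r; rewrite subr_le0.
  rewrite -[leRHS]lnK // /W ler_expR mulNr lerNl.
  rewrite leNgt; apply: contra xF => h; apply: hF.
  rewrite (pmetric_sym dp) ler_pdivlMr // mulrC; exact: ltW.
have eps11 : eps < 1 by lra.
have := cutoff_point eps0 hF' T0 eps11 hB.
rewrite -/Z -/Z' -/V -/K => h.
have : (1 - 2 * eps) * Z' <= (1 - eps) ^+ 2 * Z'.
  rewrite ler_wpM2r //; have := sqr_ge0 eps; lra.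
lra.
Qed.

Lemma semigroup_kernel_bound T : 0 <= T ->
  cabs (S T (delta R y0) x0) <= expR (a * T) * davies_kernel m d bet x0 y0.
Proof.
move=> T0; have := semigroup_kernel_sqr T0; rewrite /u => h.
have K0 : 0 <= davies_kernel m d bet x0 y0 by exact: davies_kernel_ge0.
rewrite -ler_sqr ?nnegrE ?cabs_ge0 ?mulr_ge0 ?expR_ge0 //.
rewrite -(ler_pM2r (hm x0)); apply: le_trans h _.
rewrite /davies_kernel !exprMn sqr_sqrtr ?divr_ge0 ?(ltW (hm _)) //.
rewrite /W (pmetric_sym dp) -!expRM_natl.
rewrite (_ : 2 * a * T = 2 * (a * T)); last by ring.
rewrite le_eqVlt; apply/orP; left; apply/eqP; field; exact: lt0r_neq0.
Qed.

End FixedPoints.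
End DaviesKernelBound.

(** * Operators with a dominated kernel *)

Section KernelOperator.
Variables (R : realType) (X : choiceType) (m : X -> R) (K : X -> X -> R) (D : R).
Hypothesis hm : forall x, 0 < m x.
Hypothesis K0 : forall x y, 0 <= K x y.
Hypothesis D0 : 0 < D.
Hypothesis Krow : forall x, summ (K x) /\ nsum (K x) <= D.
Hypothesis Kcol : forall y, summ (fun x => K x y * m x) /\
  nsum (fun x => K x y * m x) <= D * m y.
Implicit Types (f g : X -> R[i]) (w : X -> R) (p : R).

(** Tonelli with the summation over x innermost, where the weighted column sums apply. *)
Lemma col_pairs w : (forall y, 0 <= w y) -> summ (fun y => w y * m y) ->
  summ (fun z : X * X => K z.1 z.2 * w z.2 * m z.1) /\
  nsum (fun z : X * X => K z.1 z.2 * w z.2 * m z.1) <= D * nsum (fun y => w y * m y).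
Proof.
move=> w0 sw; pose p' (z : X * X) := K z.2 z.1 * w z.1 * m z.2.
have p0 z : 0 <= p' z by rewrite !mulr_ge0 // ltW.
have E y : (fun x => p' (y, x)) = fun x => w y * (K x y * m x).
  by apply/funext => x; rewrite /p' /=; ring.
have sl y : summ (fun x => p' (y, x)) by rewrite E; apply: summZ; exact: (Kcol y).1.
have Kc0 y x : 0 <= K x y * m x by rewrite mulr_ge0 // ltW.
have nE y : nsum (fun x => p' (y, x)) = w y * nsum (fun x => K x y * m x).
  by rewrite E nsumZ.
have le y : nsum (fun x => p' (y, x)) <= D * (w y * m y).
  by rewrite nE mulrCA ler_wpM2l //; exact: (Kcol y).2.
have s1 : summ (fun y => nsum (fun x => p' (y, x))).
  apply: summ_le (summZ D sw) => y.
  rewrite ger0_norm; last by apply: nsum_ge0 => x; exact: p0.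
  exact: le_trans (le y) (ler_norm _).
have sp := summ_prod p0 sl s1.
have p0' (z : X * X) : 0 <= p' (z.2, z.1) by exact: p0.
split; first exact: (summ_swap p0 sp).
rewrite -[nsum _](nsum_swap (fun z : X * X => p' (z.2, z.1))).
rewrite (_ : (fun z : X * X => _) = p'); last by apply/funext => -[].
have [_ ->] := nsum_prod p0 sp; rewrite -nsumZ ?(ltW D0) //; last first.
  by move=> y; rewrite mulr_ge0 // ltW.
apply: le_nsum => [y|//|]; last exact: summZ.
by apply: nsum_ge0 => x; exact: p0.
Qed.

Lemma row_pairs w : (forall x, 0 <= w x) -> summ (fun x => w x * m x) ->
  summ (fun z : X * X => K z.1 z.2 * w z.1 * m z.1).
Proof.
move=> w0 sw; apply: summ_prod => [z|x|] /=.
- by rewrite !mulr_ge0 // ltW.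
- rewrite (_ : (fun y => _) = fun y => (w x * m x) * K x y); last by apply/funext => y; ring.
  by apply: summZ; exact: (Krow x).1.
- apply: summ_le (summZ D sw) => x.
  have wm : 0 <= w x * m x by rewrite mulr_ge0 // ltW.
  rewrite (_ : (fun y => _) = fun y => (w x * m x) * K x y); last by apply/funext => y; ring.
  have n0 : 0 <= nsum (K x) by exact: nsum_ge0.
  rewrite nsumZ // (ger0_norm (mulr_ge0 wm n0)) (ger0_norm (mulr_ge0 (ltW D0) wm)).
  by rewrite mulrC ler_wpM2r //; exact: (Krow x).2.
Qed.

Definition majorant f (x : X) : R := nsum (fun y => K x y * cabs (f y)).

(** The functions on which the kernel series converges absolutely. They include all l^p spaces with
    p >= 1 and l^oo, so that one formula defines every extension. *)
Definition admissible f : Prop := forall x, summ (fun y => K x y * cabs (f y)).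

Lemma Kf_ge0 f x y : 0 <= K x y * cabs (f y).
Proof. by rewrite mulr_ge0 ?cabs_ge0. Qed.

Lemma majorant_ge0 f x : 0 <= majorant f x.
Proof. by apply: nsum_ge0 => y; exact: Kf_ge0. Qed.

(** Schur's test: Jensen in each row costs D^(p-1), and the column sums contribute the remaining
    factor D. *)
Lemma lp_admissible p f : 1 <= p -> summ (lpt m p f) ->
  [/\ admissible f, forall x, powR (majorant f x) p <=
        powR D (p - 1) * nsum (fun y => K x y * powR (cabs (f y)) p),
      summ (fun x => powR (majorant f x) p * m x) &
      nsum (fun x => powR (majorant f x) p * m x) <= powR D p * nsum (lpt m p f)].
Proof.
move=> p1 sf; have pw0 y : 0 <= powR (cabs (f y)) p by exact: powR_ge0.
have p0 : 0 < p by apply: lt_le_trans p1.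
have [sP nP] := col_pairs pw0 sf.
have P0 (z : X * X) : 0 <= K z.1 z.2 * powR (cabs (f z.2)) p * m z.1.
  by rewrite !mulr_ge0 // ltW.
have sl x : summ (fun y => K x y * powR (cabs (f y)) p).
  have := summZ (m x)^-1 (summ_slice x P0 sP) => /=.
  rewrite (_ : (fun y => _) = fun y => K x y * powR (cabs (f y)) p) //.
  by apply/funext => y; field; rewrite gt_eqF.
have J x := nsum_jensen p1 D0 (K0 x) (fun y => cabs_ge0 (f y)) (Krow x).1 (Krow x).2 (sl x).
have [s1 e1] := nsum_prod P0 sP.
have E x : nsum (fun y => K (x, y).1 (x, y).2 * powR (cabs (f (x, y).2)) p * m (x, y).1) =
    m x * nsum (fun y => K x y * powR (cabs (f y)) p).
  rewrite -nsumZ ?(ltW (hm x)) //; last by move=> y; rewrite mulr_ge0.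
  by apply: eq_nsum => y; rewrite mulrC.
have le x : powR (majorant f x) p * m x <=
    powR D (p - 1) * nsum (fun y => K (x, y).1 (x, y).2 * powR (cabs (f (x, y).2)) p * m (x, y).1).
  by rewrite E mulrCA mulrC ler_wpM2l ?(ltW (hm x)) //; exact: (J x).2.
have s2 := summZ (powR D (p - 1)) s1.
have M0 x : 0 <= powR (majorant f x) p * m x by rewrite mulr_ge0 ?powR_ge0 // ltW.
split.
- by move=> x; exact: (J x).1.
- by move=> x; exact: (J x).2.
- apply: summ_le s2 => x; rewrite ger0_norm //; exact: le_trans (le x) (ler_norm _).
apply: le_trans (le_nsum M0 le s2) _; rewrite nsumZ ?powR_ge0 // -?e1.
  rewrite -(mulr_powRB1 (ltW D0) p0) -[leRHS]mulrA mulrCA ler_wpM2l ?powR_ge0 //.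
by move=> x; apply: nsum_ge0 => y; exact: P0.
Qed.

Lemma bounded_admissible M f : 0 <= M -> (forall x, cabs (f x) <= M) ->
  admissible f /\ forall x, majorant f x <= D * M.
Proof.
move=> M0 fM; have le x y : K x y * cabs (f y) <= M * K x y.
  by rewrite [leRHS]mulrC ler_wpM2l.
have s x : summ (fun y => M * K x y) by apply: summZ; exact: (Krow x).1.
split=> x.
  by apply: summ_le (s x) => y; rewrite !ger0_norm ?Kf_ge0 ?mulr_ge0.
apply: le_trans (le_nsum (Kf_ge0 f x) (le x) (s x)) _.
by rewrite nsumZ // mulrC ler_wpM2r //; exact: (Krow x).2.
Qed.

Section OneKernel.
Variables (P : X -> X -> R[i]) (e : R).
Hypothesis e0 : 0 <= e.
Hypothesis PK : forall x y, cabs (P x y) <= e * K x y.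

Definition kernel_op f (x : X) : R[i] := csum (fun y => P x y * f y).

Lemma kernel_csumm f x : admissible f -> csumm (fun y => P x y * f y).
Proof.
move=> af; apply: csumm_le (summZ e (af x)) => y.
by rewrite cabsM mulrA ler_wpM2r ?cabs_ge0.
Qed.

Lemma kernel_op_le f x : admissible f -> cabs (kernel_op f x) <= e * majorant f x.
Proof.
move=> af; apply: le_trans (cabs_csum (kernel_csumm x af)) _.
rewrite /majorant -nsumZ //; last by move=> y; exact: Kf_ge0.
apply: le_nsum; last by apply: summZ; exact: af.
  by move=> y; exact: cabs_ge0.
by move=> y; rewrite cabsM mulrA ler_wpM2r ?cabs_ge0.
Qed.

Lemma kernel_op_lin (a : R[i]) f g : admissible f -> admissible g ->
  kernel_op (fun x => a * f x + g x) = fun x => a * kernel_op f x + kernel_op g x.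
Proof.
move=> af ag; apply/funext => x; rewrite /kernel_op.
rewrite -csumZ; last exact: kernel_csumm.
rewrite -csumD; [|exact/csummZ/kernel_csumm|exact: kernel_csumm].
by congr csum; apply/funext => y; ring.
Qed.

Lemma kernel_op_lp p f : 1 <= p -> summ (lpt m p f) ->
  summ (lpt m p (kernel_op f)) /\
  nsum (lpt m p (kernel_op f)) <= powR (e * D) p * nsum (lpt m p f).
Proof.
move=> p1 sf; have p0 : 0 <= p by apply: le_trans p1.
have [af _ s1 n1] := lp_admissible p1 sf.
have le x : lpt m p (kernel_op f) x <= powR e p * (powR (majorant f x) p * m x).
  rewrite mulrA ler_wpM2r ?(ltW (hm x)) // -powRM ?majorant_ge0 //.
  apply: ge0_ler_powR; rewrite ?nnegrE ?cabs_ge0 ?mulr_ge0 ?majorant_ge0 //.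
  exact: kernel_op_le.
have M0 x : 0 <= powR (majorant f x) p * m x by rewrite mulr_ge0 ?powR_ge0 // ltW.
have s2 := summZ (powR e p) s1.
split.
  apply: summ_le s2 => x; rewrite ger0_norm ?lpt_ge0 //; exact: le_trans (le x) (ler_norm _).
apply: le_trans (le_nsum (lpt_ge0 hm p _) le s2) _; rewrite nsumZ ?powR_ge0 //.
by rewrite powRM ?(ltW D0) // -mulrA ler_wpM2l ?powR_ge0.
Qed.

(** The witness is the adjoint kernel applied to g, in l^1 by the row sums. A kernel operator on
    l^oo is thus an adjoint, which is the source of its weak-* continuity. *)
Lemma kernel_op_pairing g : summ (lpt m 1 g) ->
  exists2 h, lp m 1%:E h &
    forall f, lp m +oo%E f -> dot m (kernel_op f) g = dot m f h.
Proof.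
rewrite lpt1 => sg; have g0 x : 0 <= cabs (g x) by exact: cabs_ge0.
have sP := row_pairs g0 sg.
pose Q (z : X * X) := e * (K z.1 z.2 * cabs (g z.1) * m z.1).
have Q0 z : 0 <= Q z by rewrite !mulr_ge0 // ltW.
have sQ : summ Q by exact: summZ.
pose r x y := P x y * (g x)^* * (m x)%:C.
have rQ x y : cabs (r x y) <= Q (x, y).
  rewrite /r /Q !cabsM cabs_conj (ger0_cabsR (ltW (hm x))) /= !mulrA.
  by rewrite ler_wpM2r ?(ltW (hm x)) // ler_wpM2r.
have sQ' := summ_swap Q0 sQ.
have Q0' (z : X * X) : 0 <= Q (z.2, z.1) by [].
have [s2 _] := nsum_prod Q0' sQ'.
have sr y : csumm (fun x => r x y).
  by apply: csumm_le (summ_slice y Q0' sQ') => x; exact: rQ.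
exists (fun y => ((m y)^-1)%:C * (csum (fun x => r x y))^*).
  apply/lpP => //; rewrite lpt1; apply: summ_le s2 => y.
  have q0 : 0 <= nsum (fun x => Q (x, y)) by apply: nsum_ge0 => x; exact: Q0.
  rewrite !ger0_norm ?mulr_ge0 ?cabs_ge0 ?(ltW (hm y)) //.
  rewrite cabsM cabs_conj ger0_cabsR ?invr_ge0 ?(ltW (hm y)) //.
  rewrite mulrC mulVKf ?gt_eqF //; apply: le_trans (cabs_csum (sr y)) _.
  apply: le_nsum; last exact: (summ_slice y Q0' sQ').
    by move=> x; exact: cabs_ge0.
  by move=> x; exact: rQ.
move=> f /linftyP[M M0 fM].
have [af _] := bounded_admissible M0 fM.
transitivity (csum (fun x => csum (fun y => r x y * f y))).
  congr csum; apply/funext => x.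
  rewrite -mulrA mulrC /kernel_op -csumZ; last exact: kernel_csumm.
  by congr csum; apply/funext => y; rewrite /r; ring.
rewrite csum_fubini; last first.
  apply: (summ_le _ (summZ M sQ)) => -[x y] /=.
  rewrite (ger0_norm (cabs_ge0 _)) (ger0_norm (mulr_ge0 M0 (Q0 _))) cabsM mulrC.
  by apply: ler_pM => //; exact: cabs_ge0.
congr csum; apply/funext => y.
have mE : ((m y)^-1)%:C * (m y)%:C = 1 :> R[i].
  by rewrite -rmorphM /= mulVf ?rmorph1 // gt_eqF.
rewrite conjM conjCK conj_real.
have -> : f y * (((m y)^-1)%:C * csum (fun x => r x y)) * (m y)%:C =
   ((m y)^-1)%:C * (m y)%:C * (f y * csum (fun x => r x y)) by ring.
rewrite mE mul1r -csumZ //; congr csum; apply/funext => x; exact: mulrC.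
Qed.

End OneKernel.

(** Fubini for the double series; its absolute convergence is the summability of K x y times the
    majorant of f. *)
Lemma kernel_op_comp (P P' : X -> X -> R[i]) (e e' : R) f x :
  0 <= e -> 0 <= e' ->
  (forall x y, cabs (P x y) <= e * K x y) -> (forall x y, cabs (P' x y) <= e' * K x y) ->
  admissible f -> summ (fun y => K x y * majorant f y) ->
  kernel_op P (kernel_op P' f) x =
    kernel_op (fun x y => kernel_op P (fun z => P' z y) x) f x.
Proof.
move=> e0 e0' hP hP' af aKf.
have sz z : csumm (fun y => P' z y * f y) by exact: (kernel_csumm hP').
transitivity (csum (fun z => csum (fun y => P x z * (P' z y * f y)))).
  by congr csum; apply/funext => z; rewrite csumZ.
pose Q (z : X * X) := e * e' * (K x z.1 * (K z.1 z.2 * cabs (f z.2))).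
have Q0 z : 0 <= Q z by rewrite !mulr_ge0 ?cabs_ge0.
have sQ : summ Q.
  apply: summ_prod => // [z|] /=.
    exact: (summZ (e * e') (summZ (K x z) (af z))).
  rewrite (_ : (fun z => _) = fun z => e * e' * (K x z * majorant f z)).
    exact: (summZ (e * e') aKf).
  apply/funext => z.
  rewrite (nsumZ (k := e * e') (f := fun y => K x z * (K z y * cabs (f y)))).
  - by rewrite (nsumZ (k := K x z) (f := fun y => K z y * cabs (f y))) // => y; exact: Kf_ge0.
  - exact: mulr_ge0.
  - by move=> y; rewrite mulr_ge0 // Kf_ge0.
have hQ z y : cabs (P x z * (P' z y * f y)) <= Q (z, y).
  rewrite !cabsM /Q /=.
  have := ler_pM (cabs_ge0 _) (mulr_ge0 (cabs_ge0 _) (cabs_ge0 _)) (hP x z)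
    (ler_wpM2r (cabs_ge0 (f y)) (hP' z y)).
  move=> /le_trans; apply; rewrite le_eqVlt; apply/orP; left; apply/eqP; ring.
rewrite csum_fubini; last first.
  apply: (summ_le _ sQ) => -[z y] /=.
  by rewrite (ger0_norm (cabs_ge0 _)) (ger0_norm (Q0 _)).
congr csum; apply/funext => y; rewrite /kernel_op mulrC.
(* Summability of the composed kernel at y is obtained by dividing the domination by |f y|, which
   requires f y to be nonzero. *)
have [->|fy0] := eqVneq (f y) 0.
  rewrite mul0r -[RHS](csum0 R X); congr csum; apply/funext => z; by rewrite !mulr0.
have fy : 0 < cabs (f y).
  rewrite lt_neqAle cabs_ge0 andbT eq_sym; by apply: contra fy0 => /eqP/cabs_eq0 ->.
rewrite -csumZ; first by congr csum; apply/funext => z; ring.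
have sQ' := summ_swap Q0 sQ.
have Q0' (z : X * X) : 0 <= Q (z.2, z.1) by [].
have := summZ (cabs (f y))^-1 (summ_slice y Q0' sQ') => /=.
apply: csumm_le => z; rewrite -(ler_pM2l fy) mulrA mulfV ?gt_eqF // mul1r.
by have := hQ z y; rewrite !cabsM; lra.
Qed.

Section KernelLimit.
Variables (U : Type) (F : set_system U).
Context {FF : Filter F}.
Variables (P : U -> X -> X -> R[i]) (P0 : X -> X -> R[i]) (k : R).
Hypothesis k0 : 0 < k.
Hypothesis PkK : \forall u \near F, forall x y, cabs (P u x y) <= k * K x y.
Hypothesis P0kK : forall x y, cabs (P0 x y) <= k * K x y.
Hypothesis PP0 : forall x y, ccvg F (fun u => P u x y) (P0 x y).

Let G u x y := cabs (P u x y - P0 x y).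

Let G0 u x y : 0 <= G u x y. Proof. exact: cabs_ge0. Qed.

Let GK u : (forall x y, cabs (P u x y) <= k * K x y) ->
  forall x y, G u x y <= 2 * k * K x y.
Proof.
move=> h x y; apply: le_trans (cabsD _ _) _; rewrite cabsN.
have := h x y; have := P0kK x y; lra.
Qed.

Let kernel_diff u f x : (forall x y, cabs (P u x y) <= k * K x y) -> admissible f ->
  summ (fun y => G u x y * cabs (f y)) /\
    cabs (kernel_op (P u) f x - kernel_op P0 f x) <= nsum (fun y => G u x y * cabs (f y)).
Proof.
move=> h af.
have sG : summ (fun y => G u x y * cabs (f y)).
  apply: summ_le (summZ (2 * k) (af x)) => y.
  rewrite !ger0_norm ?mulr_ge0 ?cabs_ge0 ?(ltW k0) // mulrA ler_wpM2r ?cabs_ge0 //.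
  exact: GK.
split=> //; rewrite /kernel_op -csumB; [|exact: (kernel_csumm h)|exact: (kernel_csumm P0kK)].
have E : (fun y => cabs (P u x y * f y - P0 x y * f y)) = fun y => G u x y * cabs (f y).
  by apply/funext => y; rewrite -mulrBl cabsM.
by rewrite -E; apply: cabs_csum; rewrite /csumm E.
Qed.

(** Jensen for the kernel |P u - P0|, whose row sums are at most 2 k D, reduces the claim to the
    double sum of |P u x y - P0 x y| |f y|^p m x. This tends to 0 by dominated convergence. *)
Lemma kernel_op_cvg_lp p f : 1 <= p -> summ (lpt m p f) ->
  lpnorm m p%:E (kernel_op (P u) f - kernel_op P0 f) @[u --> F] --> 0%E.
Proof.
move=> p1 sf; have p0 : 0 < p by apply: lt_le_trans p1.
have [af _ _ _] := lp_admissible p1 sf.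
pose w y := powR (cabs (f y)) p.
have w0 y : 0 <= w y by exact: powR_ge0.
have [sw _] := col_pairs w0 sf.
pose g (z : X * X) := 2 * k * (K z.1 z.2 * w z.2 * m z.1).
have sg : summ g by exact: summZ.
have g0 z : 0 <= g z by rewrite !mulr_ge0 ?(ltW k0) ?(ltW (hm _)).
pose h u (z : X * X) := G u z.1 z.2 * w z.2 * m z.1.
have h0 u z : 0 <= h u z by rewrite !mulr_ge0 ?(ltW (hm _)).
have hg u : (forall x y, cabs (P u x y) <= k * K x y) -> forall z, h u z <= g z.
  move=> hu z; rewrite /g !mulrA ler_wpM2r ?(ltW (hm _)) // ler_wpM2r //; exact: GK.
have c1 : nsum (h u) @[u --> F] --> (0 : R).
  apply: (nsum_dct g0 sg).
    near=> u => z; rewrite h0 /=; apply: hg; near: u; exact: PkK.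
  move=> z; have := PP0 z.1 z.2; rewrite /ccvg => cz.
  have : G u z.1 z.2 * (w z.2 * m z.1) @[u --> F] --> 0 * (w z.2 * m z.1).
    by apply: cvgM; [exact: cz|exact: cvg_cst].
  by rewrite mul0r; under eq_cvg do rewrite mulrA.
pose C := powR (2 * k * D) (p - 1).
have kD : 0 < 2 * k * D by rewrite !mulr_gt0.
have key u : (forall x y, cabs (P u x y) <= k * K x y) ->
   summ (lpt m p (kernel_op (P u) f - kernel_op P0 f)) /\
     nsum (lpt m p (kernel_op (P u) f - kernel_op P0 f)) <= C * nsum (h u).
  move=> hu; have sh : summ (h u) by apply: summ_le sg => z; rewrite !ger0_norm //; exact: hg.
  have sGx x : summ (G u x).
    apply: summ_le (summZ (2 * k) (Krow x).1) => y.
    by rewrite !ger0_norm ?mulr_ge0 ?(ltW k0) //; exact: GK.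
  have nGx x : nsum (G u x) <= 2 * k * D.
    apply: le_trans (le_nsum (G0 u x) (GK hu x) (summZ (2 * k) (Krow x).1)) _.
    rewrite nsumZ ?mulr_ge0 ?(ltW k0) // ler_wpM2l ?mulr_ge0 ?(ltW k0) //.
    exact: (Krow x).2.
  have sl x : summ (fun y => G u x y * w y).
    have := summZ (m x)^-1 (summ_slice x (h0 u) sh) => /=.
    rewrite (_ : (fun y => _) = fun y => G u x y * w y) //.
    by apply/funext => y; rewrite /h /=; field; rewrite gt_eqF.
  have J x := nsum_jensen p1 kD (G0 u x) (fun y => cabs_ge0 (f y)) (sGx x) (nGx x) (sl x).
  have [s1 e1] := nsum_prod (h0 u) sh.
  have le x : lpt m p (kernel_op (P u) f - kernel_op P0 f) x <=
      C * nsum (fun y => h u (x, y)).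
    have -> : nsum (fun y => h u (x, y)) = m x * nsum (fun y => G u x y * w y).
      rewrite -nsumZ ?(ltW (hm x)) //; last by move=> y; rewrite mulr_ge0.
      by apply: eq_nsum => y; rewrite mulrC.
    rewrite mulrCA [leRHS]mulrC ler_wpM2r ?(ltW (hm x)) //.
    apply: le_trans (J x).2; have [_ kd] := kernel_diff x hu af.
    apply: ge0_ler_powR; rewrite ?nnegrE ?cabs_ge0 ?(ltW p0) //.
    by apply: nsum_ge0 => y; rewrite mulr_ge0 ?cabs_ge0.
  have s2 := summZ C s1.
  split.
    apply: summ_le s2 => x; rewrite ger0_norm ?lpt_ge0 //; exact: le_trans (le x) (ler_norm _).
  apply: le_trans (le_nsum (lpt_ge0 hm p _) le s2) _.
  by rewrite nsumZ ?powR_ge0 // -?e1 // => x; apply: nsum_ge0 => y; exact: h0.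
apply: (lpnorm_cvg0 hm p0).
  by near=> u; apply: (key _ _).1; near: u; exact: PkK.
apply: cvg0_squeeze (cvg0Zl C c1); near=> u.
apply/andP; split; first by apply: nsum_ge0 => x; exact: lpt_ge0.
by apply: (key _ _).2; near: u; exact: PkK.
Unshelve. all: by end_near. Qed.

(** Here f enters only through its bound M; the dominated double sum carries the weight |g x| m x
    and is controlled by the row sums. *)
Lemma kernel_op_cvg_weakstar f g : lp m +oo%E f -> lp m 1%:E g ->
  cabs (dot m (kernel_op (P u) f) g - dot m (kernel_op P0 f) g) @[u --> F] --> (0 : R).
Proof.
move=> /linftyP[M M0 fM] /(lpP hm _ ltr01) sg'.
have sg : summ (fun x => cabs (g x) * m x) by rewrite -lpt1.
have gg0 x : 0 <= cabs (g x) by exact: cabs_ge0.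
have [af Mf] := bounded_admissible M0 fM.
have sw := row_pairs gg0 sg.
pose gz (z : X * X) := 2 * k * (K z.1 z.2 * cabs (g z.1) * m z.1).
have sgz : summ gz by exact: summZ.
have gz0 z : 0 <= gz z by rewrite !mulr_ge0 ?(ltW k0) ?(ltW (hm _)).
pose h u (z : X * X) := G u z.1 z.2 * cabs (g z.1) * m z.1.
have h0 u z : 0 <= h u z by rewrite !mulr_ge0 ?(ltW (hm _)).
have hg u : (forall x y, cabs (P u x y) <= k * K x y) -> forall z, h u z <= gz z.
  move=> hu z; rewrite /gz !mulrA ler_wpM2r ?(ltW (hm _)) // ler_wpM2r //; exact: GK.
have c1 : nsum (h u) @[u --> F] --> (0 : R).
  apply: (nsum_dct gz0 sgz).
    near=> u => z; rewrite h0 /=; apply: hg; near: u; exact: PkK.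
  move=> z; have := PP0 z.1 z.2; rewrite /ccvg => cz.
  have : G u z.1 z.2 * (cabs (g z.1) * m z.1) @[u --> F] --> 0 * (cabs (g z.1) * m z.1).
    by apply: cvgM; [exact: cz|exact: cvg_cst].
  by rewrite mul0r; under eq_cvg do rewrite mulrA.
have sdot (T : X -> R[i]) C : 0 <= C -> (forall x, cabs (T x) <= C) ->
    csumm (fun x => T x * (g x)^* * (m x)%:C).
  move=> C0 TC; apply: csumm_le (summZ C sg) => x.
  rewrite !cabsM cabs_conj (ger0_cabsR (ltW (hm x))) -mulrA ler_wpM2r //.
  by rewrite mulr_ge0 // ltW.
have bnd P' : (forall x y, cabs (P' x y) <= k * K x y) ->
    forall x, cabs (kernel_op P' f x) <= k * (D * M).
  move=> hP' x; apply: le_trans (kernel_op_le (ltW k0) hP' x af) _.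
  by rewrite ler_wpM2l ?(ltW k0).
have C0 : 0 <= k * (D * M) by rewrite !mulr_ge0 // ltW.
have key u : (forall x y, cabs (P u x y) <= k * K x y) ->
    cabs (dot m (kernel_op (P u) f) g - dot m (kernel_op P0 f) g) <= M * nsum (h u).
  move=> hu; have sh : summ (h u) by apply: summ_le sgz => z; rewrite !ger0_norm //; exact: hg.
  have [s1 e1] := nsum_prod (h0 u) sh.
  have sM := summZ M s1.
  have le x : cabs (kernel_op (P u) f x * (g x)^* * (m x)%:C -
      kernel_op P0 f x * (g x)^* * (m x)%:C) <= M * nsum (fun y => h u (x, y)).
    rewrite -!mulrBl !cabsM cabs_conj (ger0_cabsR (ltW (hm x))).
    have [sG kd] := kernel_diff x hu af.
    have gm : 0 <= cabs (g x) * m x by rewrite mulr_ge0 // ltW.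
    have hE : (fun y => h u (x, y)) = fun y => (cabs (g x) * m x) * G u x y.
      by apply/funext => y; rewrite /h /=; ring.
    rewrite hE nsumZ // mulrCA -mulrA mulrC ler_wpM2l //.
    apply: le_trans kd _; rewrite -nsumZ //.
    apply: le_nsum => [y|y|]; first by rewrite mulr_ge0 ?cabs_ge0.
      by rewrite mulrC ler_wpM2r.
    apply: summZ; apply: summ_le (summZ (2 * k) (Krow x).1) => y.
    by rewrite !ger0_norm ?mulr_ge0 ?(ltW k0) //; exact: GK.
  rewrite /dot -csumB; [|exact: sdot (bnd _ hu)|exact: sdot (bnd _ P0kK)].
  apply: le_trans (cabs_csum _) _; first by apply: csumm_le le sM.
  rewrite e1 -nsumZ //; last by move=> x; apply: nsum_ge0 => y; exact: h0.
  apply: le_nsum => //; by move=> x; exact: cabs_ge0.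
apply: cvg0_squeeze (cvg0Zl M c1); near=> u.
by rewrite cabs_ge0 /=; apply: key; near: u; exact: PkK.
Unshelve. all: by end_near. Qed.

End KernelLimit.
End KernelOperator.

(** * Extension of the semigroup through its kernel *)

Section KernelSemigroup.
Variables (R : realType) (X : choiceType) (m : X -> R) (K : X -> X -> R) (D a : R).
Variables (A : (X -> R[i]) -> (X -> R[i]) -> Prop) (S : R -> (X -> R[i]) -> X -> R[i]).
Hypothesis hm : forall x, 0 < m x.
Hypothesis K0 : forall x y, 0 <= K x y.
Hypothesis D0 : 0 < D.
Hypothesis Krow : forall x, summ (K x) /\ nsum (K x) <= D.
Hypothesis Kcol : forall y, summ (fun x => K x y * m x) /\
  nsum (fun x => K x y * m x) <= D * m y.
Hypothesis hS : exp_semigroup m A S.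
Hypothesis hK : forall t x y, 0 <= t ->
  cabs (S t (delta R y) x) <= expR (a * t) * K x y.
Implicit Types (t u : R) (f g : X -> R[i]).

Let P t x y := S t (delta R y) x.
Let two0 : (0 : R) < 2. Proof. by []. Qed.
Let ld y : lp m 2%:E (delta R y). Proof. exact/(Cc_lp2 hm)/Cc_delta. Qed.

Lemma sum_delta f (F : {fset X}) x :
  \sum_(y <- F) f y * delta R y x = if x \in F then f x else 0.
Proof.
case: ifPn => xF.
  rewrite (big_fsetD1 x) //= /delta eqxx mulr1 big1_seq ?addr0 //.
  by move=> y /andP[_]; rewrite !inE eq_sym => /andP[/negPf -> _]; rewrite mulr0.
apply: big1_seq => y /andP[_ yF]; rewrite /delta; case: eqVneq => [e|_]; last exact: mulr0.
by move: xF; rewrite e yF.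
Qed.

Lemma semigroup_sum_delta t f (r : seq X) : 0 <= t ->
  lp m 2%:E (fun x => \sum_(y <- r) f y * delta R y x) /\
  S t (fun x => \sum_(y <- r) f y * delta R y x) = fun x => \sum_(y <- r) f y * P t x y.
Proof.
move=> t0; elim: r => [|y r [ihl ih]].
  have E : (fun x => \sum_(y <- [::]) f y * delta R y x) = fun=> 0.
    by apply/funext => x; rewrite big_nil.
  have l0 : lp m 2%:E ((fun=> 0) : X -> R[i]).
    by apply: (Cc_lp2 hm); apply: (@fset_Cc _ _ _ fset0).
  rewrite E; split=> //; have := semigroup_lin hS (-1) t0 l0 l0.
  have -> : (fun x : X => -1 * 0 + 0 : R[i]) = fun=> 0 by apply/funext => x; ring.
  by move=> ->; apply/funext => x; rewrite big_nil mulN1r addNr.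
have E : (fun x => \sum_(z <- y :: r) f z * delta R z x) =
   fun x => f y * delta R y x + \sum_(z <- r) f z * delta R z x.
  by apply/funext => x; rewrite big_cons.
rewrite E; split; first exact: lp_lin.
rewrite (semigroup_lin hS) // ih; apply/funext => x; by rewrite big_cons.
Qed.

(** By linearity the identity holds for finite combinations of indicators. The remainder of f is
    small in l^2, hence so is its image at x by boundedness of S t, and the tail of the kernel
    series at x is small as well. *)
Lemma semigroup_kernel_op t f : 0 <= t -> lp m 2%:E f -> S t f = kernel_op (P t) f.
Proof.
move=> t0 lf; apply/funext => x.
have sf : summ (lpt m 2 f) by exact/(lpP hm _ two0).
have [C C0 hC] := semigroup_bound hm hS t0.
have [af _ _ _] := lp_admissible hm K0 D0 Krow Kcol (ler1n R 2) sf.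
have PK y z : cabs (P t y z) <= expR (a * t) * K y z by exact: hK.
have sP := kernel_csumm PK x af.
apply/eqP; rewrite -subr_eq0; apply/eqP/cabs_eq0.
apply/eqP; rewrite eq_le cabs_ge0 andbT leNgt; apply/negP.
set z := cabs _ => z0.
have Cm : 0 < C / m x + 1 by rewrite ltr_wpDl // divr_ge0 // ltW.
(* The first bound makes the tail of the series at most z / 4. The second makes |S t r x|^2 <= C e /
   m x at most z^2 / 16. Together they give z <= z / 2, a contradiction. *)
pose e := Num.min (z / 4) (z ^+ 2 / 16 / (C / m x + 1)).
have e0 : 0 < e by rewrite lt_min !divr_gt0 ?exprn_gt0.
have e1 : e <= z / 4 by rewrite ge_min lexx.
have e2 : C / m x * e <= z ^+ 2 / 16.
  have : e * (C / m x + 1) <= z ^+ 2 / 16 by rewrite -ler_pdivlMr // ge_min lexx orbT.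
  lra.
(* The two families are added so that one finite set controls both tails. *)
pose w y := lpt m 2 f y + cabs (P t x y * f y).
have w0 y : 0 <= w y by rewrite addr_ge0 ?lpt_ge0 ?cabs_ge0.
have [F hF] := summ_tail w0 (summD sf sP) e0.
have [lF SF] := semigroup_sum_delta f F t0.
set fF := (fun x => \sum_(y <- F) _) in lF SF.
pose r y := -1 * fF y + f y.
have rE y : r y = if y \in F then 0 else f y.
  by rewrite /r /fF sum_delta; case: ifP => _; ring.
have sw : summ (fun y => if y \in F then 0 else w y).
  by apply: summ_le (summD sf sP) => y; case: ifP; rewrite ?normr0.
have lw y : lpt m 2 r y <= if y \in F then 0 else w y.
  rewrite lp2_lpt rE; case: ifP => _; first by rewrite cabs0 expr0n mul0r.
  by rewrite /w lp2_lpt lerDl cabs_ge0.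
have sr : summ (lpt m 2 r).
  by apply: summ_le sw => y; rewrite !ger0_norm ?lpt_ge0 //; case: ifP.
have nr : nsum (lpt m 2 r) <= e.
  apply: le_trans (le_nsum (lpt_ge0 hm 2 r) lw sw) _; exact: ltW.
have [s1 n1] := hC r sr.
have b1 : cabs (S t r x) ^+ 2 <= z ^+ 2 / 16.
  apply: le_trans e2; rewrite mulrAC ler_pdivlMr //.
  apply: le_trans (l2_point hm x s1) _; apply: le_trans n1 _.
  by rewrite ler_wpM2l.
have b1' : cabs (S t r x) <= z / 4.
  rewrite -ler_sqr ?nnegrE ?cabs_ge0 ?divr_ge0 ?(ltW z0) //.
  by apply: le_trans b1 _; rewrite expr_div_n -natrX.
have b2 : cabs (kernel_op (P t) f x - \sum_(y <- F) P t x y * f y) <= e.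
  apply: le_trans (csum_tail F sP) _; apply: le_trans (ltW hF).
  apply: le_nsum => // y; first by case: ifP => // _; exact: cabs_ge0.
  by case: ifP => // _; rewrite /w lerDr lpt_ge0.
have E : S t f x - kernel_op (P t) f x =
   S t r x - (kernel_op (P t) f x - \sum_(y <- F) P t x y * f y).
  rewrite /r (semigroup_lin hS) // SF.
  have -> : \sum_(y <- F) f y * P t x y = \sum_(y <- F) P t x y * f y.
    by apply: eq_bigr => y _; exact: mulrC.
  ring.
have : z <= cabs (S t r x) + cabs (kernel_op (P t) f x - \sum_(y <- F) P t x y * f y).
  by rewrite /z E; apply: le_trans (cabsD _ _) _; rewrite cabsN.
lra.
Qed.

Let T t := kernel_op (P t).

Let PK t : 0 <= t -> forall x y, cabs (P t x y) <= expR (a * t) * K x y.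
Proof. by move=> t0 x y; exact: hK. Qed.

Lemma kernel_semigroup0 f : T 0 f = f.
Proof.
apply/funext => x; rewrite /T /kernel_op (@csum_fsupp _ _ _ [fset x]%fset).
  by rewrite big_seq_fset1 /P (semigroup0 hS (ld _)) /delta eqxx mul1r.
move=> y; rewrite inE => yx; rewrite /P (semigroup0 hS (ld _)) /delta eq_sym.
by rewrite (negPf yx) mul0r.
Qed.

(** S u of an indicator is in l^2, where S t is already known to be the kernel operator. So the
    kernel at time t + u is the composition of the kernels at t and u. *)
Lemma kernel_semigroupD t u f : 0 <= t -> 0 <= u -> admissible K f ->
  (forall x, summ (fun y => K x y * majorant K f y)) -> T (t + u) f = T t (T u f).
Proof.
move=> t0 u0 af aKf; apply/funext => x.
have E : P (t + u) = fun x y => kernel_op (P t) (fun z => P u z y) x.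
  apply/funext => x1; apply/funext => y.
  have <- := semigroup_kernel_op t0 (semigroup_lp hm hS u0 (ld y)).
  by rewrite /P (semigroupD hS t0 u0 (ld y)).
rewrite /T E.
by rewrite (kernel_op_comp K0 (expR_ge0 _) (expR_ge0 _) (PK t0) (PK u0) af (aKf x)).
Qed.

(** The majorant of f is itself in l^p by Schur's test, so K may be applied a second time. *)
Lemma lp_majorant_admissible p f : 1 <= p -> summ (lpt m p f) ->
  forall x, summ (fun y => K x y * majorant K f y).
Proof.
move=> p1 sf x.
have [_ _ s1 _] := lp_admissible hm K0 D0 Krow Kcol p1 sf.
have cM y : cabs ((majorant K f y)%:C : R[i]) = majorant K f y.
  by rewrite ger0_cabsR //; exact: majorant_ge0.
have s2 : summ (lpt m p (fun y => (majorant K f y)%:C)).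
  by rewrite (_ : lpt m p _ = fun y => powR (majorant K f y) p * m y) //;
    apply/funext => y; rewrite /lpt cM.
have [a1 _ _ _] := lp_admissible hm K0 D0 Krow Kcol p1 s2.
by move: (a1 x); under eq_fun do rewrite cM.
Qed.

(** A common constant for all times in [0, t + 1], whatever the sign of a. *)
Let kT t := expR (`|a| * (t + 1)).

Let kT_near t : 0 <= t -> \forall u \near within [set u | 0 <= u] (nbhs t),
  forall x y, cabs (P u x y) <= kT t * K x y.
Proof.
move=> t0; rewrite near_withinE; near=> u => u0 x y.
have ut : u <= t + 1.
  have : `|t - u| < 1 by near: u; exact: nbhsx_ballx.
  by rewrite distrC => /(le_lt_trans (ler_norm _)); lra.
apply: le_trans (hK x y u0) _; rewrite ler_wpM2r // ler_expR.
apply: (@le_trans _ _ (`|a| * u)); first by rewrite ler_wpM2r // ler_norm.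
by rewrite ler_wpM2l.
Unshelve. all: by end_near. Qed.

Let kT_at t : 0 <= t -> forall x y, cabs (P t x y) <= kT t * K x y.
Proof.
move=> t0 x y; apply: le_trans (hK x y t0) _; rewrite ler_wpM2r // ler_expR.
apply: (@le_trans _ _ (`|a| * t)); first by rewrite ler_wpM2r // ler_norm.
by rewrite ler_wpM2l // lerDl.
Qed.

Let P_cvg t x y : 0 <= t ->
  ccvg (within [set u | 0 <= u] (nbhs t)) (fun u => P u x y) (P t x y).
Proof. by move=> t0; exact: (semigroup_cvg_pt hm hS x t0 (ld y)). Qed.

Lemma kernel_C0_semigroup p : 1 <= p -> C0_semigroup m p%:E T.
Proof.
move=> p1; have p0 : 0 < p by apply: lt_le_trans p1.
have ad f : lp m p%:E f -> admissible K f.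
  by move=> /(lpP hm _ p0) sf; have [] := lp_admissible hm K0 D0 Krow Kcol p1 sf.
split; first split.
- move=> t t0; split.
    by move=> z f g lf lg; apply: (kernel_op_lin (PK t0)); exact: ad.
  exists (expR (a * t) * D); first by rewrite mulr_ge0 ?expR_ge0 // ltW.
  move=> f /(lpP hm _ p0) sf.
  have [s n] := kernel_op_lp hm K0 D0 Krow Kcol (expR_ge0 _) (PK t0) p1 sf.
  by apply: (lpnorm_le hm) => //; rewrite mulr_ge0 ?expR_ge0 // ltW.
- by move=> f _; exact: kernel_semigroup0.
- move=> t u f t0 u0 lf; apply: kernel_semigroupD => //; first exact: ad.
  by apply: (lp_majorant_admissible p1); apply/(lpP hm _ p0).
- move=> f t /(lpP hm _ p0) sf t0.
  exact: (kernel_op_cvg_lp hm K0 D0 Krow Kcol (expR_gt0 _) (kT_near t0) (kT_at t0)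
    (fun x y => P_cvg x y t0) p1 sf).
Qed.

Lemma kernel_weakstar_semigroup : weakstar_semigroup m T.
Proof.
split; first split.
- move=> t t0; split.
    move=> z f g /linftyP[M M0 fM] /linftyP[M' M0' gM].
    by apply: (kernel_op_lin (PK t0)); [exact: (bounded_admissible K0 Krow M0 fM).1|
      exact: (bounded_admissible K0 Krow M0' gM).1].
  exists (expR (a * t) * D); first by rewrite mulr_ge0 ?expR_ge0 // ltW.
  move=> f /linfty_le[M [M0 -> fM]].
  have [af Mf] := bounded_admissible K0 Krow M0 fM.
  apply: ub_ereal_sup => _ [->|[x _ <-]]; rewrite -EFinM lee_fin.
    by rewrite !mulr_ge0 ?expR_ge0 // ltW.
  apply: le_trans (kernel_op_le K0 (expR_ge0 _) (PK t0) x af) _.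
  by rewrite -mulrA ler_wpM2l ?expR_ge0.
- by move=> f _; exact: kernel_semigroup0.
- move=> t u f t0 u0 /linftyP[M M0 fM].
  have [af Mf] := bounded_admissible K0 Krow M0 fM.
  apply: kernel_semigroupD => // x.
  have DM0 : 0 <= D * M by rewrite mulr_ge0 // ltW.
  have M0' y : 0 <= majorant K f y by exact: majorant_ge0.
  apply: summ_le (summZ (D * M) (Krow x).1) => y.
  rewrite (ger0_norm (mulr_ge0 (K0 x y) (M0' y))) (ger0_norm (mulr_ge0 DM0 (K0 x y))).
  by rewrite mulrC ler_wpM2r.
- move=> t t0 g /(lpP hm _ ltr01) sg e e0.
  have [h lh hE] := kernel_op_pairing hm K0 D0 Krow (expR_ge0 _) (PK t0) sg.
  exists [:: h], e; split=> //; first by move=> h'; rewrite inE => /eqP ->.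
  by move=> f lf hf; rewrite hE //; apply: hf; rewrite inE.
- move=> f g t lf lg t0.
  exact: (kernel_op_cvg_weakstar hm K0 D0 Krow (expR_gt0 _) (kT_near t0) (kT_at t0)
    (fun x y => P_cvg x y t0) lf lg).
Qed.

Lemma kernel_extends (p : \bar R) : extends_consistently m p S T.
Proof. by move=> t f t0 lf _; rewrite /T -(semigroup_kernel_op t0 lf). Qed.

Lemma opnorm1_bound t : 0 <= t -> (opnorm m 1%:E (S t) <= (D * expR (a * t))%:E)%E.
Proof.
move=> t0; apply: ub_ereal_sup => _ [f [l2 /(lpP hm _ ltr01) s1 n1] <-].
rewrite (semigroup_kernel_op t0 l2).
have [s n] := kernel_op_lp hm K0 D0 Krow Kcol (expR_ge0 _) (PK t0) (lexx 1) s1.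
have c0 : 0 <= D * expR (a * t) by rewrite mulr_ge0 ?expR_ge0 // ltW.
rewrite (mulrC _ D) in n.
apply: le_trans (lpnorm_le hm ltr01 c0 s s1 n) _.
by rewrite -[leRHS]mule1 lee_wpmul2l // lee_fin.
Qed.

End KernelSemigroup.

Theorem theorem3p6 (R : realType) (X : choiceType) (m : X -> R)
    (b : X -> X -> R) (o : X -> X -> R[i]) (c : X -> R)
    (d : X -> X -> R) (s nu : R) (S2 : R -> (X -> R[i]) -> X -> R[i])
    (hm : forall x, 0 < m x)
    (hb : is_graph b)
    (ho : is_magnetic_potential o)
    (hQ : form_positive (schrodinger_form b o c))
    (hQc : form_closable m (schrodinger_form b o c))
    (hS2 : exp_semigroup m (form_operator m (schrodinger_form b o c)) S2)
    (hd : is_intrinsic_metric m b d)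
    (hs : jump_size b d = s%:E)
    (hs0 : 0 < s)
    (hnu : 0 < nu)
    (hvol : exp_volume_growth m d nu) :
  let lambda2 := spectrum_bottom m (form_operator m (schrodinger_form b o c)) in
  [/\ forall beta : R, 3 * nu / 2 < beta ->
        let Cbeta := (s ^+ 2)^-1 * (cosh (beta * s) - 1) in
        exists2 M : R, 0 < M &
          forall t : R, 0 <= t ->
            (opnorm m 1%:E (S2 t) <=
             (M * expR ((Cbeta - lambda2) * t))%:E)%E,
      forall p : R, 1 <= p ->
        exists Sp : R -> (X -> R[i]) -> X -> R[i],
          C0_semigroup m p%:E Sp /\ extends_consistently m p%:E S2 Sp &
      exists Soo : R -> (X -> R[i]) -> X -> R[i],
        weakstar_semigroup m Soo /\ extends_consistently m +oo%E S2 Soo].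
Proof.
move=> lam; have [dp _] := hd; have [C _ vol] := hvol.
have ball := ball_finite hm dp vol.
have jump x y : 0 < b x y -> d x y <= s.
  move=> bxy; rewrite -lee_fin -hs; apply: ereal_sup_ubound.
  by exists (x, y).
have fin x : finite_set [set y | 0 < b x y].
  have [F hF] := ball x s.
  apply: (@sub_finite_set _ _ [set` F]); last exact: finite_fset.
  by move=> y /= /jump/hF.
have hlam := spectrum_bottom_le hm hb ho fin hQ hQc.
have main beta : 3 * nu / 2 < beta -> exists D, [/\ 0 < D,
    (forall x, summ (davies_kernel m d beta x) /\ nsum (davies_kernel m d beta x) <= D),
    (forall y, summ (fun x => davies_kernel m d beta x y * m x) /\
             nsum (fun x => davies_kernel m d beta x y * m x) <= D * m y) &
    forall t x y, 0 <= t -> cabs (S2 t (delta R y) x) <=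
      expR (((s ^+ 2)^-1 * (cosh (beta * s) - 1) - lam) * t) * davies_kernel m d beta x y].
  move=> hbeta; have beta0 : 0 < beta by lra.
  have [D D0 [row col]] := davies_kernel_sums hm dp hnu vol hbeta.
  exists D; split=> // t x y t0.
  exact: (semigroup_kernel_bound hm hb ho fin hQ hQc hS2 hd ball hs0 jump beta0 hlam).
have K0 beta x y : 0 <= davies_kernel m d beta x y by exact: davies_kernel_ge0.
(* The extensions do not involve beta; a single value above the threshold provides the
   domination. *)
have [D [D0 row col ker]] := main (3 * nu / 2 + 1) (ltac:(lra)).
split.
- move=> beta hbeta Cb; have [D' [D0' row' col' ker']] := main _ hbeta.
  exists D' => // t t0.
  exact: (opnorm1_bound hm (K0 beta) D0' row' col' hS2 ker').
- move=> p p1; exists (fun t => kernel_op (fun x y => S2 t (delta R y) x)); split.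
    exact: (kernel_C0_semigroup hm (K0 _) D0 row col hS2 ker).
  exact: (kernel_extends hm (K0 _) D0 row col hS2 ker).
- exists (fun t => kernel_op (fun x y => S2 t (delta R y) x)); split.
    exact: (kernel_weakstar_semigroup hm (K0 _) D0 row col hS2 ker).
  exact: (kernel_extends hm (K0 _) D0 row col hS2 ker).
Qed.
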